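(* Let $A$ and $B$ be finite dimensional Gorenstein $k$-algebras. Assume that $k$ is a splitting field for $A$ or $B$. Then $$(A\otimes_k B)\text{-}\mathsf{GProj}=\overline{\mathsf{Filt}}(A\text{-}\mathsf{GProj}\otimes_k B\text{-}\mathsf{GProj}).$$
   Context: $k$ is a fixed field. A finite dimensional algebra $\Gamma$ is Gorenstein if ${}_\Gamma\Gamma$ and $\Gamma_\Gamma$ both have finite injective dimension. $k$ is a splitting field for an algebra if every simple module over it has endomorphism algebra $k$. In this statement modules are arbitrary (not necessarily finitely generated) left modules; $\Gamma\text{-Mod}$ is the category of all left $\Gamma$-modules. A module $M\in\Gamma\text{-Mod}$ is Gorenstein projective if there is an exact complex $P^\bullet=(\cdots\to P^{i}\xrightarrow{d^i}P^{i+1}\to\cdots)$ of (not necessarily finitely generated) projective $\Gamma$-modules with $M=\mathrm{Ker}(d^1)$ such that $\mathrm{Hom}_\Gamma(P^\bullet,Q)$ is exact for every projective $\Gamma$-module $Q$. $\Gamma\text{-}\mathsf{GProj}$ is the full subcategory of $\Gamma\text{-Mod}$ of Gorenstein projective modules. $A\text{-}\mathsf{GProj}\otimes_k B\text{-}\mathsf{GProj}:=\{X\otimes_k Y\mid X\in A\text{-}\mathsf{GProj},\ Y\in B\text{-}\mathsf{GProj}\}$. For a class $\mathscr{X}$ of $\Gamma$-modules, $\mathsf{Filt}(\mathscr{X})$ is the full subcategory of $\Gamma\text{-Mod}$ of modules $X$ for which there exist an ordinal $\alpha$ and a filtration $0=X_0\subset X_1\subset\cdots\subset X_\beta\subset X_{\beta+1}\subset\cdots\subset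 X_\alpha=X$ by submodules, continuous at limit ordinals (i.e. $X_\gamma=\bigcup_{\beta<\gamma}X_\beta$ for each limit ordinal $\gamma\le\alpha$), with all factors $X_{\beta+1}/X_\beta$, $\beta+1\le\alpha$, in $\mathscr{X}$ (up to isomorphism). $\overline{\mathsf{Filt}}(\mathscr{X})$ consists of all direct summands of modules in $\mathsf{Filt}(\mathscr{X})$. *)

(* Defs.v *)
From HB Require Import structures.
From mathcomp Require Import all_boot all_algebra falgebra.
From mathcomp Require Import boolp wochoice.

Set Implicit Arguments.
Unset Strict Implicit.
Unset Printing Implicit Defensive.

Import GRing.Theory VectorInternalTheory.
Local Open Scope ring_scope.
Local Open Scope quotient_scope.

Section Tensor.
Variables (k : fieldType) (U V : lmodType k).

Definition bilin (W : lmodType k) (g : U -> V -> W) : Prop :=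
  (forall v, linear (g ^~ v)) /\ (forall u, linear (g u)).

(* A list stands for the sum of the u (x) v, (u, v) ranging over the list. *)
Definition tsum (W : lmodType k) (g : U -> V -> W) (s : seq (U * V)) : W :=
  \sum_(p <- s) g p.1 p.2.

(* Two formal sums are identified when no bilinear map separates them, which
   amounts to equality modulo the bilinearity relations. The quotient has the
   universal property of the tensor product: tpure_bilin, tlift_linear,
   tlift_pure and tlift_unique. *)
Definition tens_rel : rel (seq (U * V)) := fun s t =>
  `[< forall (W : lmodType k) (g : U -> V -> W), bilin g ->
      tsum g s = tsum g t >].

Lemma tens_rel_equiv : equiv_class_of tens_rel.
Proof.
split=> [s|s t|t s u].
- exact/asboolP.
- by apply/asboolP/asboolP=> h W g bg; rewrite h.
- by move=> /asboolP h1 /asboolP h2; apply/asboolP=> W g bg; rewrite h1 ?h2.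
Qed.

Canonical tens_equiv := EquivRelPack tens_rel_equiv.

Definition tens := {eq_quot tens_equiv}.

HB.instance Definition _ := Choice.on tens.
HB.instance Definition _ := EqQuotient.on tens.

Lemma tens_piP s t :
  (forall (W : lmodType k) (g : U -> V -> W), bilin g -> tsum g s = tsum g t) ->
  \pi_tens s = \pi_tens t.
Proof. by move=> h; apply/eqmodP/asboolP. Qed.

Lemma tsum_repr (W : lmodType k) (g : U -> V -> W) s : bilin g ->
  tsum g (repr (\pi_tens s)) = tsum g s.
Proof.
move=> bg; have /eqmodP/asboolP h : \pi_tens (repr (\pi_tens s)) = \pi_tens s.
  by rewrite reprK.
exact: h.
Qed.

Lemma tsum_cat (W : lmodType k) (g : U -> V -> W) s t :
  tsum g (s ++ t) = tsum g s + tsum g t.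
Proof. by rewrite /tsum big_cat. Qed.

Definition tscale_seq (c : k) (s : seq (U * V)) :=
  [seq (c *: p.1, p.2) | p <- s].

Lemma linearZf (U1 W : lmodType k) (f : U1 -> W) c u :
  linear f -> f (c *: u) = c *: f u.
Proof.
move=> lf; have f0 : f 0 = 0.
  by have := lf (-1) 0 0; rewrite scaler0 addr0 scaleN1r addNr.
by have := lf c u 0; rewrite addr0 f0 addr0.
Qed.

Lemma linearDf (U1 W : lmodType k) (f : U1 -> W) u v :
  linear f -> f (u + v) = f u + f v.
Proof. by move=> lf; have := lf 1 u v; rewrite !scale1r. Qed.

Lemma tsum_scale (W : lmodType k) (g : U -> V -> W) c s : bilin g ->
  tsum g (tscale_seq c s) = c *: tsum g s.
Proof.
move=> bg; rewrite /tsum big_map scaler_sumr; apply: eq_bigr => p _ /=.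
exact: (linearZf c p.1 (bg.1 p.2)).
Qed.

Definition tens_zero : tens := \pi_tens [::].
Definition tens_add (x y : tens) : tens := \pi_tens (repr x ++ repr y).
Definition tens_scale (c : k) (x : tens) : tens :=
  \pi_tens (tscale_seq c (repr x)).
Definition tens_opp (x : tens) : tens := tens_scale (-1) x.

Lemma tens_eq (x y : tens) :
  (forall (W : lmodType k) (g : U -> V -> W), bilin g ->
     tsum g (repr x) = tsum g (repr y)) -> x = y.
Proof. by move=> h; rewrite -[x]reprK -[y]reprK; apply: tens_piP. Qed.

Lemma tens_addA : associative tens_add.
Proof.
by move=> x y z; apply: tens_eq => W g bg;
  rewrite !(tsum_repr _ bg, tsum_cat) addrA.
Qed.
Lemma tens_addC : commutative tens_add.
Proof.
by move=> x y; apply: tens_eq => W g bg;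
  rewrite !(tsum_repr _ bg, tsum_cat) addrC.
Qed.
Lemma tens_add0 : left_id tens_zero tens_add.
Proof.
by move=> x; apply: tens_eq => W g bg;
  rewrite !(tsum_repr _ bg, tsum_cat) /tsum big_nil add0r.
Qed.
Lemma tens_addN : left_inverse tens_zero tens_opp tens_add.
Proof.
by move=> x; apply: tens_eq => W g bg;
  rewrite !(tsum_repr _ bg, tsum_cat, tsum_scale _ _ bg) scaleN1r addNr /tsum big_nil.
Qed.
HB.instance Definition _ :=
  GRing.isZmodule.Build tens tens_addA tens_addC tens_add0 tens_addN.

Lemma tens_scaleA a b v : tens_scale a (tens_scale b v) = tens_scale (a * b) v.
Proof.
by apply: tens_eq => W g bg;
  rewrite !(tsum_repr _ bg, tsum_scale _ _ bg) scalerA.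
Qed.
Lemma tens_scale1 : left_id 1 tens_scale.
Proof.
by move=> x; apply: tens_eq => W g bg;
  rewrite !(tsum_repr _ bg, tsum_scale _ _ bg) scale1r.
Qed.
Lemma tens_scaleDr : right_distributive tens_scale +%R.
Proof.
by move=> c x y; apply: tens_eq => W g bg;
  rewrite !(tsum_repr _ bg, tsum_cat, tsum_scale _ _ bg) scalerDr.
Qed.
Lemma tens_scaleDl v : {morph tens_scale^~ v : a b / a + b}.
Proof.
by move=> a b; apply: tens_eq => W g bg;
  rewrite !(tsum_repr _ bg, tsum_cat, tsum_scale _ _ bg) scalerDl.
Qed.
HB.instance Definition _ := GRing.Zmodule_isLmodule.Build k tens
  tens_scaleA tens_scale1 tens_scaleDr tens_scaleDl.

Definition tpure (u : U) (v : V) : tens := \pi_tens [:: (u, v)].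

Lemma tsum_repr_pure (W : lmodType k) (g : U -> V -> W) u v : bilin g ->
  tsum g (repr (tpure u v)) = g u v.
Proof. by move=> bg; rewrite tsum_repr // /tsum big_seq1. Qed.

Lemma pure_bilin : bilin tpure.
Proof.
split=> [v a x y|u a x y]; apply: tens_eq => W g bg;
  rewrite !(tsum_repr_pure _ _ bg, tsum_repr _ bg, tsum_cat, tsum_scale _ _ bg).
- exact: bg.1.
- exact: bg.2.
Qed.

Lemma tens_pi_sum s : \pi_tens s = \sum_(p <- s) tpure p.1 p.2.
Proof.
elim: s => [|p s IH]; first by rewrite big_nil.
rewrite big_cons -IH; apply: tens_eq => W g bg.
rewrite !(tsum_repr_pure _ _ bg, tsum_repr _ bg, tsum_cat) /tsum.
by rewrite big_cons.
Qed.

Lemma tens_ind (P : tens -> Prop) :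
  P 0 -> (forall u v x, P x -> P (tpure u v + x)) -> forall x, P x.
Proof.
move=> P0 PD x; rewrite -[x]reprK tens_pi_sum; elim: (repr x) => [|p s IH].
  by rewrite big_nil.
by rewrite big_cons; apply: PD.
Qed.

Definition tlift (W : lmodType k) (g : U -> V -> W) (x : tens) : W :=
  tsum g (repr x).

Lemma tlift_linear (W : lmodType k) (g : U -> V -> W) :
  bilin g -> linear (tlift g).
Proof.
by move=> bg a x y;
  rewrite /tlift !(tsum_repr _ bg, tsum_cat, tsum_scale _ _ bg).
Qed.

Lemma tlift_pure (W : lmodType k) (g : U -> V -> W) u v : bilin g ->
  tlift g (tpure u v) = g u v.
Proof. exact: tsum_repr_pure. Qed.

Lemma tlift_unique (W : lmodType k) (f g : tens -> W) :
  linear f -> linear g -> (forall u v, f (tpure u v) = g (tpure u v)) -> f =1 g.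
Proof.
move=> lf lg fg; apply: tens_ind => [|u v x IH].
  by rewrite -(scale0r 0) !linearZf // !scale0r.
by rewrite !linearDf // fg IH.
Qed.

End Tensor.

(* (u (x) v, u' (x) v') |-> f u u' (x) g v v' *)
Section Tensor2.
Variables (k : fieldType) (U U' U'' V V' V'' : lmodType k).
Variables (f : U -> U' -> U'') (g : V -> V' -> V'').

Definition tens2 (x : tens U V) (y : tens U' V') : tens U'' V'' :=
  tlift (fun u v => tlift (fun u' v' => tpure (f u u') (g v v')) y) x.

Hypotheses (bf : bilin f) (bg : bilin g).

Let inner u v : bilin (fun u' v' => tpure (f u u') (g v v')).
Proof.
split=> [v'|u'] a x y /=; first by rewrite bf.2 (pure_bilin _ _).1.
by rewrite bg.2 (pure_bilin _ _).2.
Qed.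

Let outer y :
  bilin (fun u v => tlift (fun u' v' => tpure (f u u') (g v v')) y).
Proof.
split=> [v|u] a x z /=; rewrite -!/(tlift _ _).
- elim/tens_ind: y => [|u' v' y IH].
    by rewrite -(scale0r 0) !(linearZf _ _ (tlift_linear (inner _ _)))
               !scale0r scaler0 addr0.
  rewrite !(linearDf _ _ (tlift_linear (inner _ _))) IH scalerDr.
  rewrite !(tlift_pure _ _ (inner _ _)).
  by rewrite (bf.1 u' a x z) (pure_bilin _ _).1 addrACA.
- elim/tens_ind: y => [|u' v' y IH].
    by rewrite -(scale0r 0) !(linearZf _ _ (tlift_linear (inner _ _)))
               !scale0r scaler0 addr0.
  rewrite !(linearDf _ _ (tlift_linear (inner _ _))) IH scalerDr.
  rewrite !(tlift_pure _ _ (inner _ _)).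
  by rewrite (bg.1 v' a x z) (pure_bilin _ _).2 addrACA.
Qed.

Lemma tens2_pure u v u' v' :
  tens2 (tpure u v) (tpure u' v') = tpure (f u u') (g v v').
Proof. by rewrite /tens2 (tlift_pure _ _ (outer _)) (tlift_pure _ _ (inner _ _)). Qed.

Lemma tens2_linl y : linear (tens2 ^~ y).
Proof. exact: tlift_linear (outer y). Qed.

Lemma tens2_linr x : linear (tens2 x).
Proof.
move=> a y z; elim/tens_ind: x => [|u v x IH].
  by rewrite -(scale0r 0) !(linearZf _ _ (tens2_linl _)) !scale0r scaler0 addr0.
rewrite !(linearDf _ _ (tens2_linl _)) IH /tens2 !(tlift_pure _ _ (outer _)).
by rewrite (tlift_linear (inner u v)) scalerDr addrACA.
Qed.

End Tensor2.

Section TensorAlgebra.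
Variables (k : fieldType) (A B : falgType k).

Definition tensalg := tens (A : lmodType k) (B : lmodType k).

HB.instance Definition _ := GRing.Lmodule.on tensalg.

Definition tensalg_mul : tensalg -> tensalg -> tensalg := tens2 *%R *%R.

Lemma mul_bilin (C : falgType k) : bilin ( *%R : C -> C -> C).
Proof.
split=> u a x y /=; first by rewrite mulrDl scalerAl.
by rewrite mulrDr scalerAr.
Qed.

Let mulE a b a' b' : tensalg_mul (tpure a b) (tpure a' b') =
  tpure (a * a') (b * b').
Proof. exact: (tens2_pure (@mul_bilin _) (@mul_bilin _)). Qed.

Let linl y : linear (tensalg_mul ^~ y).
Proof. exact: (tens2_linl (@mul_bilin _) (@mul_bilin _)). Qed.

Let linr x : linear (tensalg_mul x).
Proof. exact: (tens2_linr (@mul_bilin _) (@mul_bilin _)). Qed.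

Let mul0l y : tensalg_mul 0 y = 0.
Proof. by rewrite -(scale0r 0) (linearZf _ _ (linl y)) !scale0r. Qed.

Let mul0r x : tensalg_mul x 0 = 0.
Proof. by rewrite -(scale0r 0) (linearZf _ _ (linr x)) !scale0r. Qed.

Let mulDl : left_distributive tensalg_mul +%R.
Proof. by move=> x y z; rewrite (linearDf _ _ (linl z)). Qed.

Let mulDr : right_distributive tensalg_mul +%R.
Proof. by move=> x y z; rewrite (linearDf _ _ (linr x)). Qed.

Lemma tensalg_mulA : associative tensalg_mul.
Proof.
elim/tens_ind => [|a b x IHx] y z; first by rewrite !mul0l.
rewrite !mulDl {}IHx; congr (_ + _).
elim/tens_ind: y => [|a' b' y IHy]; first by rewrite !(mul0l, mul0r).
rewrite !(mulDl, mulDr) {}IHy; congr (_ + _).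
elim/tens_ind: z => [|a'' b'' z IHz]; first by rewrite !mul0r.
by rewrite !mulDr {}IHz !mulE !mulrA.
Qed.

Lemma tensalg_mul1 : left_id (tpure 1 1) tensalg_mul.
Proof.
elim/tens_ind => [|a b x IH]; first by rewrite mul0r.
by rewrite mulDr IH mulE !mul1r.
Qed.

Lemma tensalg_mulr1 : right_id (tpure 1 1) tensalg_mul.
Proof.
elim/tens_ind => [|a b x IH]; first by rewrite mul0l.
by rewrite mulDl IH mulE !mulr1.
Qed.

Lemma tensalg_one_neq0 : tpure 1 1 != 0 :> tensalg.
Proof.
have coord1 (C : falgType k) : exists i, v2r (1 : C) 0 i != 0.
  apply/existsP; rewrite -negb_forall; apply/negP => /forallP h.
  have : v2r (1 : C) = v2r 0.
    by rewrite linear0; apply/rowP => i; rewrite mxE; apply/eqP/h.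
  by move/v2r_inj/eqP; rewrite oner_eq0.
have [i i0] := coord1 A; have [j j0] := coord1 B.
pose g (a : A) (b : B) : k^o := v2r a 0 i * v2r b 0 j.
have bg : bilin g.
  split=> u a x y; rewrite /g linearP !mxE; first by rewrite mulrDl -mulrA.
  by rewrite mulrDr mulrCA.
apply/eqP => /(congr1 (tlift g)); rewrite tlift_pure //.
rewrite -(scale0r 0) (linearZf _ _ (tlift_linear bg)) scale0r => /eqP.
by rewrite mulf_eq0 (negPf i0) (negPf j0).
Qed.

HB.instance Definition _ := GRing.Zmodule_isNzRing.Build tensalg
  tensalg_mulA tensalg_mul1 tensalg_mulr1 mulDl mulDr tensalg_one_neq0.

Lemma tensalg_scalerAl (c : k) (x y : tensalg) : c *: (x * y) = (c *: x) * y.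
Proof. by rewrite [RHS](linearZf _ _ (linl y)). Qed.

Lemma tensalg_scalerAr (c : k) (x y : tensalg) : c *: (x * y) = x * (c *: y).
Proof. by rewrite [RHS](linearZf _ _ (linr x)). Qed.

HB.instance Definition _ :=
  GRing.Lmodule_isLalgebra.Build k tensalg tensalg_scalerAl.
HB.instance Definition _ :=
  GRing.Lalgebra_isAlgebra.Build k tensalg tensalg_scalerAr.

Lemma tensalg_mul_pure (a a' : A) (b b' : B) :
  (tpure a b : tensalg) * tpure a' b' = tpure (a * a') (b * b').
Proof. exact: mulE. Qed.

Lemma tensalg_oneE : 1 = tpure 1 1 :> tensalg.
Proof. by []. Qed.

End TensorAlgebra.

(* Restriction of scalars along k -> A, c |-> c%:A. *)
Definition restr (k : fieldType) (A : falgType k) (X : lmodType A) : Type := X.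

Section Restriction.
Variables (k : fieldType) (A : falgType k) (X : lmodType A).

HB.instance Definition _ := GRing.Zmodule.on (restr X).

Definition restr_scale (c : k) (x : restr X) : restr X := c%:A *: (x : X).

Fact restr_scaleA a b v : restr_scale a (restr_scale b v) = restr_scale (a * b) v.
Proof. by rewrite /restr_scale scalerA mulr_algl scalerA. Qed.
Fact restr_scale1 : left_id 1 restr_scale.
Proof. by move=> v; rewrite /restr_scale !scale1r. Qed.
Fact restr_scaleDr : right_distributive restr_scale +%R.
Proof. by move=> a u v; apply: scalerDr. Qed.
Fact restr_scaleDl v : {morph restr_scale^~ v : a b / a + b}.
Proof. by move=> a b; rewrite /restr_scale !scalerDl. Qed.

HB.instance Definition _ := GRing.Zmodule_isLmodule.Build k (restr X)
  restr_scaleA restr_scale1 restr_scaleDr restr_scaleDl.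

Definition act (a : A) (x : restr X) : restr X := a *: (x : X).

Lemma act_bilin : bilin act.
Proof.
split=> [v a x y|u a x y].
  by rewrite /act scalerDl -mulr_algl -scalerA.
rewrite /act scalerDr; congr (_ + _).
by rewrite [LHS]scalerA -scalerAr mulr1 -[in LHS]mulr_algl -scalerA.
Qed.

End Restriction.

Section TensorModule.
Variables (k : fieldType) (A B : falgType k) (X : lmodType A) (Y : lmodType B).

Definition tensmod := tens (restr X) (restr Y).

HB.instance Definition _ := GRing.Zmodule.on tensmod.

Definition tensmod_scale : tensalg A B -> tensmod -> tensmod :=
  tens2 (@act k A X) (@act k B Y).

Let scaleE a b x y :
  tensmod_scale (tpure a b) (tpure x y) = tpure (act a x) (act b y).
Proof. exact: (tens2_pure (@act_bilin _ _ _) (@act_bilin _ _ _)). Qed.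

Let linl y : linear (tensmod_scale ^~ y).
Proof. exact: (tens2_linl (@act_bilin _ _ _) (@act_bilin _ _ _)). Qed.

Let linr x : linear (tensmod_scale x).
Proof. exact: (tens2_linr (@act_bilin _ _ _) (@act_bilin _ _ _)). Qed.

Let scale0l y : tensmod_scale 0 y = 0.
Proof. by rewrite -(scale0r 0) (linearZf _ _ (linl y)) !scale0r. Qed.

Let scaler0' x : tensmod_scale x 0 = 0.
Proof.
by rewrite -(scale0r (0 : tens (restr X) (restr Y))) (linearZf _ _ (linr x))
  !scale0r.
Qed.

Fact tensmod_scaleDr : right_distributive tensmod_scale +%R.
Proof. by move=> x y z; rewrite (linearDf _ _ (linr x)). Qed.

Fact tensmod_scaleDl v : {morph tensmod_scale^~ v : a b / a + b}.
Proof. by move=> x y; rewrite (linearDf _ _ (linl v)). Qed.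

Fact tensmod_scaleA s t v :
  tensmod_scale s (tensmod_scale t v) = tensmod_scale (s * t) v.
Proof.
elim/tens_ind: s => [|a b s IHs]; first by rewrite mul0r !scale0l.
rewrite mulrDl !tensmod_scaleDl {}IHs; congr (_ + _).
elim/tens_ind: t => [|a' b' t IHt].
  by rewrite mulr0 !scale0l scaler0'.
rewrite mulrDr !(tensmod_scaleDl, tensmod_scaleDr) {}IHt; congr (_ + _).
elim/tens_ind: v => [|x y v IHv]; first by rewrite !scaler0'.
rewrite !tensmod_scaleDr {}IHv; congr (_ + _).
by rewrite tensalg_mul_pure !scaleE /act !scalerA.
Qed.

Fact tensmod_scale1 : left_id 1 tensmod_scale.
Proof.
elim/tens_ind => [|x y v IH]; first by rewrite scaler0'.
by rewrite tensmod_scaleDr IH tensalg_oneE scaleE /act !scale1r.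
Qed.

HB.instance Definition _ := GRing.Zmodule_isLmodule.Build (tensalg A B) tensmod
  tensmod_scaleA tensmod_scale1 tensmod_scaleDr tensmod_scaleDl.

Lemma tensmod_scale_pure (a : A) (b : B) (x : X) (y : Y) :
  (tpure a b : tensalg A B) *: (tpure (x : restr X) (y : restr Y) : tensmod) =
  tpure (a *: x : restr X) (b *: y : restr Y).
Proof. exact: scaleE. Qed.

End TensorModule.

Section Modules.
Variable R : pzRingType.

Definition surj (S T : Type) (f : S -> T) : Prop := forall y, exists x, f x = y.

(* Exactness of L -> M -> N at M. *)
Definition exact_at (L M N : lmodType R) (f : L -> M) (g : M -> N) : Prop :=
  forall y, g y = 0 <-> exists x, f x = y.

Definition projective (P : lmodType R) : Prop :=
  forall (M N : lmodType R) (p : {linear M -> N}) (f : {linear P -> N}),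
    surj p -> exists g : {linear P -> M}, forall x, p (g x) = f x.

Definition injective_module (I : lmodType R) : Prop :=
  forall (M N : lmodType R) (i : {linear M -> N}) (f : {linear M -> I}),
    injective i -> exists g : {linear N -> I}, forall x, g (i x) = f x.

(* 0 -> M -> I 0 -> I 1 -> ... exact, with I j injective and I j = 0 for j > n. *)
Definition finite_injdim (M : lmodType R) : Prop :=
  exists (n : nat) (I : nat -> lmodType R)
         (e : {linear M -> I 0%N}) (d : forall j, {linear I j -> I j.+1}),
    [/\ forall j, injective_module (I j),
        forall j, (n < j)%N -> forall x : I j, x = 0,
        injective e,
        exact_at e (d 0%N) &
        forall j, exact_at (d j) (d j.+1)].

Definition simple_module (S : lmodType R) : Prop :=
  (exists x : S, x != 0) /\
  forall V : {pred S}, submod_closed V ->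
    (forall x, x \in V -> x = 0) \/ (forall x, x \in V).

(* The target of the differential is written 1 + i, not i + 1, because 1 + i
   computes for i = Posz n. *)
Definition gproj (M : lmodType R) : Prop :=
  exists (P : int -> lmodType R) (d : forall i : int, {linear P i -> P (1 + i)})
         (e : {linear M -> P 1}),
    [/\ forall i, projective (P i),
        forall i, exact_at (d i) (d (1 + i)),
        forall (Q : lmodType R), projective Q ->
          forall i (f : {linear P (1 + i) -> Q}),
            (forall x, f (d i x) = 0) <->
            exists g : {linear P (1 + (1 + i)) -> Q},
              forall x, g (d (1 + i) x) = f x,
        injective e &
        exact_at e (d 1)].

(* V1 / V0 is isomorphic to F, for submodules V0 <= V1 of M: f matters only on
   V1, where it is linear, onto F and has kernel V0. *)
Definition has_quotient (M : lmodType R) (V0 V1 : {pred M}) (F : lmodType R) :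
    Prop :=
  exists f : M -> F,
    [/\ forall a, {in V1 &, forall x y, f (a *: x + y) = a *: f x + f y},
        forall y, exists2 x, x \in V1 & f x = y &
        {in V1, forall x, f x = 0 <-> x \in V0}].

Definition covers (J : eqType) (le : rel J) (i j : J) : Prop :=
  [/\ le i j, i != j & forall l, le i l -> le l j -> l = i \/ l = j].

Definition limit_point (J : eqType) (le : rel J) (j : J) : Prop :=
  (exists2 i, le i j & i != j) /\ ~ exists i, covers le i j.

(* J plays the set of ordinals <= alpha: up to isomorphism, these sets are the
   well-orders with a greatest element. Successors are the j covering some i,
   and limit ordinals are the limit points. *)
Definition filt (X : lmodType R -> Prop) (M : lmodType R) : Prop :=
  exists (J : eqType) (le : rel J) (bot top : J) (V : J -> {pred M}),
    [/\ well_order le,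
        forall j, le bot j /\ le j top,
        forall j, submod_closed (V j) &
        [/\ forall x, x \in V bot <-> x = 0,
            forall x, x \in V top,
            forall i j, le i j -> {subset V i <= V j},
            forall j, limit_point le j -> forall x,
              x \in V j <-> exists i, [/\ le i j, i != j & x \in V i] &
            forall i j, covers le i j ->
              exists2 F, X F & has_quotient (V i) (V j) F]].

Definition filt_bar (X : lmodType R -> Prop) (M : lmodType R) : Prop :=
  exists (N M' : lmodType R) (f : {linear N -> (M * M')%type}),
    filt X N /\ bijective f.

End Modules.

Definition gorenstein (R : pzRingType) : Prop :=
  finite_injdim (R^o : lmodType R) /\ finite_injdim ((R^c)^o : lmodType R^c).

(* The structure map k -> End_A(S) is automatically injective, since S <> 0. *)
Definition splitting_field (k : fieldType) (A : falgType k) : Prop :=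
  forall S : lmodType A, simple_module S ->
    forall f : {linear S -> S}, exists c : k, forall x, f x = c%:A *: x.

(* X (x) Y, up to isomorphism, with X in P and Y in Q. *)
Definition tens_class (k : fieldType) (A B : falgType k)
    (P : lmodType A -> Prop) (Q : lmodType B -> Prop)
    (Z : lmodType (tensalg A B)) : Prop :=
  exists (X : lmodType A) (Y : lmodType B) (f : {linear tensmod X Y -> Z}),
    [/\ P X, Q Y & bijective f].

(* Main.v *)
(** Let L = A (x) B, and let perf be the class of modules obtained from the
    projective ones by cokernels of monomorphisms and retracts. Over a
    Gorenstein algebra, M is Gorenstein projective iff Ext^1(M, K) = 0 for all
    K in perf. The algebra L is Gorenstein because every projective (injective)
    L-module is a retract of P (x) Q with P, Q projective (injective).

    If X and Y are Gorenstein projective, then X (x) Y embeds in some P (x) Y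
    with P projective and with cokernel X' (x) Y of the same kind, and P (x) Y in
    some projective P (x) Q with cokernel P (x) Y'. Dimension shifting gives
    Ext^1(X (x) Y, K) = 0 for K in perf, and Eklof's lemma carries this over to
    filtrations.

    Conversely, a Gorenstein projective M is an N-th syzygy of some Z, for any
    N. Say B is split. A chain of left ideals of B filters Z by finitely many
    T-isotypic modules with T a simple B-module; as End(T) = k, these are of the
    form X (x) T, with X an arbitrary A-module. High syzygies of X and of T are
    Gorenstein projective, so by the horseshoe lemma Z has a projective
    resolution whose N-th syzygy is a finite extension of products of Gorenstein
    projectives, and M is a retract of that syzygy plus a projective module. *)

From HB Require Import structures.
From mathcomp Require Import all_boot all_algebra falgebra.
From mathcomp Require Import boolp functions wochoice.
Require Import Defs.

Set Implicit Arguments.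
Unset Strict Implicit.
Unset Printing Implicit Defensive.

Import GRing.Theory VectorInternalTheory.
Local Open Scope ring_scope.
Local Open Scope quotient_scope.

(** * Modules *)

Section Basics.
Variable R : pzRingType.
Implicit Types K L M N E P Q I : lmodType R.

(** Ext groups are never formed: [orth M K] is a lifting property, and dimension shifting moves
    lifts along short exact sequences. The two halves of the Gorenstein property enter separately.
    Finite injective dimension on the left bounds that of all projective modules by one number; on
    the right, k-duality turns it into [perf (dreg A)], which puts all injective modules in perf.
    Passing from one module to all of them uses powers instead of direct sums: as A is
    finite-dimensional, A^T is free, and each projective (injective) module is a retract of some A^T
    (some D(A)^T). Powers also provide the map into a projective module that starts the right half
    of a complete resolution.

    In the converse M may have infinite length, so the finite filtration must come from B. The
    splitting field makes X (x) T -> M injective. The filtration so obtained does not live on M but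
    on another syzygy of Z; M is recovered by comparing two resolutions of Z, hence only stably, as
    a direct summand. *)

Definition lin M N (f : M -> N) (lf : linear f) : {linear M -> N} :=
  HB.pack f (GRing.isLinear.Build R M N _ f lf).

Definition ses K E M (i : {linear K -> E}) (p : {linear E -> M}) : Prop :=
  [/\ injective i, surj p & exact_at i p].

Lemma submod_closedP M (S : M -> Prop) :
  S 0 -> (forall a x y, S x -> S y -> S (a *: x + y)) ->
  submod_closed [pred x | `[< S x >]].
Proof.
move=> S0 SD; split=> [|a x y]; rewrite !inE; first exact/asboolP.
by move=> /asboolP Sx /asboolP Sy; apply/asboolP/SD.
Qed.

Section Submodule.
Variables (M : lmodType R) (V : {pred M}) (hV : submod_closed V).

(* The closure proof is an argument, so that the instances can refer to it. *)
Definition subm := fun _ : submod_closed V => {x : M | x \in V}.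
Local Notation S := (subm hV).

HB.instance Definition _ := Choice.on S.
HB.instance Definition _ := SubChoice.on S.
HB.instance Definition _ := @GRing.SubChoice_isSubLmodule.Build R M V S hV.

Lemma submoduleP : exists (N : lmodType R) (i : {linear N -> M}),
  injective i /\ forall x, x \in V <-> exists y, i y = x.
Proof.
exists S, (@lin S M val (fun _ _ _ => erefl)); split; first exact: val_inj.
by move=> x; split=> [xV|[y <-]]; [exists (exist _ x xV) | exact: valP].
Qed.
End Submodule.

Section Quotient.
Variables (M : lmodType R) (V : {pred M}) (hV : submod_closed V).

Let V0 : 0 \in V. Proof. by case: hV. Qed.
Let VZD a x y : x \in V -> y \in V -> a *: x + y \in V.
Proof. by case: hV => _; apply. Qed.
Let VD x y : x \in V -> y \in V -> x + y \in V.
Proof. by move=> Vx Vy; rewrite -[x]scale1r VZD. Qed.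
Let VZ a x : x \in V -> a *: x \in V.
Proof. by move=> Vx; rewrite -[_ *: _]addr0 VZD. Qed.
Let VN x : x \in V -> - x \in V.
Proof. by move=> Vx; rewrite -scaleN1r VZ. Qed.

Definition quotm_rel (_ : submod_closed V) : rel M := fun x y => x - y \in V.

Lemma quotm_rel_equiv : equiv_class_of (quotm_rel hV).
Proof.
rewrite /quotm_rel; split=> [x|x y|y x z]; first by rewrite subrr.
- by apply/idP/idP=> /VN; rewrite opprB.
- by move=> xy yz; rewrite -(subrKA y) VD.
Qed.

Canonical quotm_equiv := EquivRelPack quotm_rel_equiv.

Definition quotm := {eq_quot quotm_equiv}.
HB.instance Definition _ := Choice.on quotm.
HB.instance Definition _ := EqQuotient.on quotm.

Let piP x y : x - y \in V -> \pi_quotm x = \pi_quotm y.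
Proof. by move=> h; apply/eqmodP. Qed.
Let reprV x : x - repr (\pi_quotm x) \in V.
Proof.
suff : quotm_rel hV x (repr (\pi_quotm x)) by [].
by apply/(@eqmodP _ quotm_equiv); rewrite reprK.
Qed.
Let quotP (x : quotm) : exists y, x = \pi_quotm y.
Proof. by exists (repr x); rewrite reprK. Qed.

Definition quotm_add (x y : quotm) : quotm := \pi_quotm (repr x + repr y).
Definition quotm_opp (x : quotm) : quotm := \pi_quotm (- repr x).
Definition quotm_scale a (x : quotm) : quotm := \pi_quotm (a *: repr x).

Let addE x y : quotm_add (\pi_quotm x) (\pi_quotm y) = \pi_quotm (x + y).
Proof. by apply: piP; rewrite -opprB VN // opprD addrACA VD. Qed.
Let oppE x : quotm_opp (\pi_quotm x) = \pi_quotm (- x).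
Proof. by apply: piP; rewrite opprK addrC. Qed.
Let scaleE a x : quotm_scale a (\pi_quotm x) = \pi_quotm (a *: x).
Proof. by apply: piP; rewrite -scalerBr VZ // -opprB VN. Qed.

Fact quotm_addA : associative quotm_add.
Proof.
move=> x y z; have [x' ->] := quotP x; have [y' ->] := quotP y; have [z' ->] := quotP z.
by rewrite !addE addrA.
Qed.
Fact quotm_addC : commutative quotm_add.
Proof.
by move=> x y; have [[x' ->] [y' ->]] := (quotP x, quotP y); rewrite !addE addrC.
Qed.
Fact quotm_add0 : left_id (\pi_quotm 0) quotm_add.
Proof. by move=> x; have [x' ->] := quotP x; rewrite addE add0r. Qed.
Fact quotm_addN : left_inverse (\pi_quotm 0) quotm_opp quotm_add.
Proof. by move=> x; have [x' ->] := quotP x; rewrite oppE addE addNr. Qed.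
HB.instance Definition _ :=
  GRing.isZmodule.Build quotm quotm_addA quotm_addC quotm_add0 quotm_addN.

Fact quotm_scaleA a b v : quotm_scale a (quotm_scale b v) = quotm_scale (a * b) v.
Proof. by have [x ->] := quotP v; rewrite !scaleE scalerA. Qed.
Fact quotm_scale1 : left_id 1 quotm_scale.
Proof. by move=> v; have [x ->] := quotP v; rewrite scaleE scale1r. Qed.
Fact quotm_scaleDr : right_distributive quotm_scale +%R.
Proof.
move=> a x y; have [[x' ->] [y' ->]] := (quotP x, quotP y).
by rewrite [\pi_quotm x' + _]addE !scaleE [RHS]addE scalerDr.
Qed.
Fact quotm_scaleDl v : {morph quotm_scale^~ v : a b / a + b}.
Proof. by move=> a b; have [x ->] := quotP v; rewrite !scaleE [RHS]addE scalerDl. Qed.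
HB.instance Definition _ := GRing.Zmodule_isLmodule.Build R quotm
  quotm_scaleA quotm_scale1 quotm_scaleDr quotm_scaleDl.

Lemma quotientP : exists (N : lmodType R) (p : {linear M -> N}),
  surj p /\ forall x, p x = 0 <-> x \in V.
Proof.
have lp : linear (fun x => \pi_quotm x : quotm).
  by move=> a x y; rewrite -addE -scaleE.
exists quotm, (lin lp); split=> [x|x] /=; first by have [y ->] := quotP x; exists y.
split=> [h|xV]; last by apply: piP; rewrite subr0.
have : \pi_quotm x = \pi_quotm 0 by [].
move/eqmodP; rewrite /= /quotm_rel subr0; exact.
Qed.
End Quotient.

Lemma ker_ses E M (p : {linear E -> M}) : surj p ->
  exists (K : lmodType R) (i : {linear K -> E}), ses i p.
Proof.
move=> sp; have [||K [i [inji iP]]] := submoduleP (@submod_closedP E (fun x => p x = 0) _ _).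
- exact: linear0.
- by move=> a x y px py; rewrite linearP px py scaler0 addr0.
exists K, i; split=> // x; rewrite -iP inE; split=> [?|/asboolP//]; exact/asboolP.
Qed.

Lemma coker_ses K E (i : {linear K -> E}) : injective i ->
  exists (N : lmodType R) (p : {linear E -> N}), ses i p.
Proof.
move=> inji.
have [||N [p [sp pP]]] := quotientP (@submod_closedP E (fun x => exists k, i k = x) _ _).
- by exists 0; rewrite linear0.
- by move=> a x y [u <-] [v <-]; exists (a *: u + v); rewrite linearP.
exists N, p; split=> // x; rewrite pP inE; split=> [/asboolP//|?]; exact/asboolP.
Qed.

Lemma exact_at0 K E M (i : {linear K -> E}) (p : {linear E -> M}) k :
  exact_at i p -> p (i k) = 0.
Proof. by move=> ex; apply/ex; exists k. Qed.

Lemma descend E E' K (q : {linear E' -> E}) (h : {linear E' -> K}) : surj q ->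
  (forall x, q x = 0 -> h x = 0) -> exists g : {linear E -> K}, forall x, g (q x) = h x.
Proof.
move=> sq qh; have [s sK] := choice sq.
have hq x y : q x = q y -> h x = h y.
  move=> e; apply/eqP; rewrite -subr_eq0 -(linearB h); apply/eqP/qh.
  by rewrite linearB e subrr.
have lg : linear (fun y => h (s y)).
  by move=> a x y; rewrite -linearP; apply: hq; rewrite linearP !sK.
by exists (lin lg) => x /=; apply: hq; rewrite sK.
Qed.

Lemma colift K E M (i : {linear K -> E}) (h : {linear M -> E}) : injective i ->
  (forall m, exists k, i k = h m) -> exists g : {linear M -> K}, forall x, i (g x) = h x.
Proof.
move=> inji /choice[s sK].
have lg : linear s by move=> a x y; apply: inji; rewrite linearP !sK linearP.
by exists (lin lg).
Qed.

Lemma ses_colift K E M N (i : {linear K -> E}) (p : {linear E -> M}) (h : {linear N -> E}) :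
  ses i p -> (forall x, p (h x) = 0) -> exists g : {linear N -> K}, forall x, i (g x) = h x.
Proof. by case=> inji _ ex ph; apply: colift => // x; apply/ex. Qed.

Lemma ses_descend K E M N (i : {linear K -> E}) (p : {linear E -> M}) (h : {linear E -> N}) :
  ses i p -> (forall x, h (i x) = 0) -> exists g : {linear M -> N}, forall x, g (p x) = h x.
Proof. by case=> _ sp ex hi; apply: descend => // x /ex[k <-]. Qed.

Lemma bij_inv M N (f : {linear M -> N}) : bijective f ->
  exists g : {linear N -> M}, cancel f g /\ cancel g f.
Proof.
case=> g fg gf; have lg : linear g.
  by move=> a x y; apply: (can_inj fg); rewrite linearP !gf.
by exists (lin lg).
Qed.

Lemma inj_surj_bij M N (f : M -> N) : injective f -> surj f -> bijective f.
Proof. by move=> fi /choice[g gK]; exists g => // x; apply: fi; rewrite gK. Qed.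

Lemma lin_inj M N (f : {linear M -> N}) : (forall x, f x = 0 -> x = 0) -> injective f.
Proof.
by move=> f0 x y fxy; apply/eqP; rewrite -subr_eq0; apply/eqP/f0; rewrite linearB fxy subrr.
Qed.

Definition retract M N : Prop :=
  exists (s : {linear M -> N}) (r : {linear N -> M}), cancel s r.

Lemma retract_refl M : retract M M.
Proof. by exists idfun, idfun. Qed.

Lemma retract_trans M N P : retract M N -> retract N P -> retract M P.
Proof.
move=> [s [r rs]] [s' [r' rs']]; exists (s' \o s), (r \o r') => x /=.
by rewrite rs' rs.
Qed.

Lemma bij_retract M N (f : {linear M -> N}) : bijective f -> retract M N /\ retract N M.
Proof.
by move/bij_inv=> [g [fg gf]]; split; [exists f, g | exists g, f].
Qed.

Lemma projective_retract P Q : retract P Q -> projective Q -> projective P.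
Proof.
move=> [s [r rs]] pQ M N p f sp; have [g gP] := pQ M N p (f \o r) sp.
by exists (g \o s) => x /=; rewrite gP /= rs.
Qed.

Lemma injective_retract P Q : retract P Q -> injective_module Q -> injective_module P.
Proof.
move=> [s [r rs]] iQ M N p f sp; have [g gP] := iQ M N p (s \o f) sp.
by exists (r \o g) => x /=; rewrite gP /= rs.
Qed.

Lemma projective_section P M (p : {linear M -> P}) : projective P -> surj p -> retract P M.
Proof.
by move=> pP sp; have [s sP] := pP _ _ p idfun sp; exists s, p.
Qed.

Lemma injective_retraction I M (i : {linear I -> M}) : injective_module I -> injective i ->
  retract I M.
Proof. by move=> iI ii; have [r rP] := iI _ _ i idfun ii; exists i, r. Qed.

Lemma ses_bijr K E M N (i : {linear K -> E}) (p : {linear E -> M}) (f : {linear M -> N}) :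
  ses i p -> bijective f -> ses i (f \o p).
Proof.
move=> [ii sp ex] bf; split=> // [y|y].
  by case: bf => g fg gf; have [x xP] := sp (g y); exists x; rewrite /= xP gf.
rewrite -ex /=; split=> [h|->]; last exact: linear0.
by apply: (bij_inj bf); rewrite h linear0.
Qed.

End Basics.

(** * Vanishing of Ext *)

Section Orthogonality.
Variable R : pzRingType.
Implicit Types K L M N E P Q I Z : lmodType R.

Definition enough_projectives : Prop := forall M, exists P (p : {linear P -> M}),
  projective P /\ surj p.

Definition enough_injectives : Prop := forall M, exists I (i : {linear M -> I}),
  injective_module I /\ injective i.

(* Ext^1(M, K) = 0 *)
Definition orth M K : Prop := forall E N (i : {linear K -> E}) (p : {linear E -> N})
    (f : {linear M -> N}),
  ses i p -> exists g : {linear M -> E}, forall x, p (g x) = f x.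

Lemma orth_projective P K : projective P -> orth P K.
Proof. by move=> pP E N i p f [_ sp _]; apply: pP. Qed.

(** A retraction r of i : I -> E splits the sequence, and id - i r induces the section of p. *)
Lemma orth_injective M I : injective_module I -> orth M I.
Proof.
move=> iI E N i p f s; have [ii sp ex] := s.
have [r rP] := iI _ _ i idfun ii.
have [|t tP] := ses_descend (h := idfun \- (i \o r)) s.
  by move=> x /=; rewrite rP subrr.
exists (t \o f) => x /=; have [e <-] := sp (f x).
by rewrite tP /= linearB (exact_at0 _ ex) subr0.
Qed.

Lemma orth_retractl M M' K : retract M M' -> orth M' K -> orth M K.
Proof.
move=> [s [r rs]] o E N i p f /(o _ _ _ _ (f \o r))[g gP].
by exists (g \o s) => x /=; rewrite gP /= rs.
Qed.

(** One sequence 0 -> K -> I -> N -> 0 with I injective suffices as a test: every extension of K is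
    a pullback of it. *)
Lemma lift_orth M K I N (i : {linear K -> I}) (p : {linear I -> N}) :
  injective_module I -> ses i p ->
  (forall f : {linear M -> N}, exists g : {linear M -> I}, forall x, p (g x) = f x) ->
  orth M K.
Proof.
move=> iI s lft E N' i' p' f s'; have [ii' sp' ex'] := s'; have [ii sp ex] := s.
have [phi phiP] := iI _ _ i' i ii'.
have [x|psi psiP] := ses_descend (h := p \o phi) s'.
  by rewrite /= phiP (exact_at0 _ ex).
have [h hP] := lft (psi \o f).
(* The middle term of the extension embeds in I * N' as the pullback of [p] and [psi]; the pair (h,
   f) lands in it. *)
have l1 : linear (fun e => (phi e, p' e)) by move=> a x y; rewrite !linearP.
have l2 : linear (fun m => (h m, f m)) by move=> a x y; rewrite !linearP.
have [||g gP] := @colift R E (I * N')%type M (lin l1) (lin l2).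
- apply: lin_inj => x [phix /ex'[k kx]]; move: phix.
  by rewrite -kx phiP => ik0; rewrite (ii k 0) ?linear0.
- move=> m /=; have [e0 e0P] := sp' (f m).
  have /ex[k kP] : p (phi e0 - h m) = 0 by rewrite linearB hP /= -e0P psiP subrr.
  exists (e0 - i' k); rewrite !linearB /= phiP kP subKr e0P.
  by rewrite (exact_at0 _ ex') subr0.
by exists g => x; have /= [] := gP x.
Qed.

(** Dual test, on one projective presentation of M: a lift of f p to P restricts to a map L -> K,
    and subtracting an extension of this map to P makes the lift descend to M. *)
Lemma ext_orth L P M K (i : {linear L -> P}) (p : {linear P -> M}) :
  projective P -> ses i p ->
  (forall f : {linear L -> K}, exists g : {linear P -> K}, forall x, g (i x) = f x) ->
  orth M K.
Proof.
move=> pP s ext E N j q f s'; have [ii sp ex] := s; have [ij sq exq] := s'.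
have [h hP] := pP _ _ q (f \o p) sq.
have [|u uP] := ses_colift (h := h \o i) s'.
  by move=> x; rewrite /= hP /= (exact_at0 _ ex) linear0.
have [v vP] := ext u.
have [x|g gP] := ses_descend (h := h \- (j \o v)) s; first by rewrite /= vP uP subrr.
exists g => y; have [x <-] := sp y.
by rewrite gP /= linearB hP (exact_at0 _ exq) subr0.
Qed.

Hypotheses (eP : enough_projectives) (eI : enough_injectives).

(** With K inside an injective I, the map f extends to E with values in I. The induced map M -> I/K
    lifts to I, and subtracting that lift brings the values back into K. *)
Lemma orth_ext L E M K (i : {linear L -> E}) (p : {linear E -> M}) (f : {linear L -> K}) :
  orth M K -> ses i p -> exists g : {linear E -> K}, forall x, g (i x) = f x.
Proof.
move=> o s; have [ii sp ex] := s.
have [I [j [iI ij]]] := eI K; have [N [q sN]] := coker_ses ij.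
have [phi phiP] := iI _ _ i (j \o f) ii.
have [|psi psiP] := ses_descend (h := q \o phi) s.
  by move=> x; rewrite /= phiP /=; case: sN => _ _ /exact_at0 ->.
have [h hP] := o _ _ _ _ psi sN.
have [|g gP] := ses_colift (h := phi \- (h \o p)) sN.
  by move=> x /=; rewrite linearB hP psiP subrr.
by exists g => x; apply: ij; rewrite gP /= (exact_at0 _ ex) linear0 subr0 phiP.
Qed.

Lemma orth_retractr M K K' : retract K K' -> orth M K' -> orth M K.
Proof.
move=> [s [r rs]] o; have [P [p [pP sp]]] := eP M.
have [L [i si]] := ker_ses sp; apply: (ext_orth pP si) => f.
have [g gP] := orth_ext (s \o f) o si.
by exists (r \o g) => x /=; rewrite gP /= rs.
Qed.

(** Exactness of Hom(M, E) -> Hom(M, N) -> Ext^1(M, K) -> Ext^1(M, E). *)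
Lemma orth_long M K E N (i : {linear K -> E}) (p : {linear E -> N}) :
  ses i p -> orth M E ->
  (forall f : {linear M -> N}, exists g : {linear M -> E}, forall x, p (g x) = f x) ->
  orth M K.
Proof.
move=> s oE lft; have [ii sp ex] := s.
have [P [q [pP sq]]] := eP M; have [L [j t]] := ker_ses sq.
apply: (ext_orth pP t) => f.
have [phi phiP] := orth_ext (i \o f) oE t.
have [x|psi psiP] := ses_descend (h := p \o phi) t.
  by rewrite /= phiP (exact_at0 _ ex).
have [psi' psi'P] := lft psi.
have [x|g gP] := ses_colift (h := phi \- (psi' \o q)) s.
  by rewrite /= linearB psi'P psiP subrr.
exists g => x; apply: ii; rewrite gP /= phiP.
by case: t => _ _ /exact_at0->; rewrite linear0 subr0.
Qed.

(** Dimension shifting in both arguments at once: a map L -> K1 extends to E as Ext^1(Z, K1) = 0,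
    the extension lifts to I as Ext^1(E, K) = 0, and the lift is restricted to L. *)
Lemma orth_shift L E Z K I K1 (i : {linear L -> E}) (p : {linear E -> Z})
    (j : {linear K -> I}) (q : {linear I -> K1}) :
  ses i p -> ses j q -> orth L I -> orth E K -> orth Z K1 -> orth L K.
Proof.
move=> s t oL oE oZ; apply: (orth_long t oL) => u.
have [v vP] := orth_ext u oZ s; have [w wP] := oE _ _ _ _ v t.
by exists (w \o i) => x /=; rewrite wP vP.
Qed.

End Orthogonality.

(** * Finite projective and injective dimension *)

Section FiniteDimension.
Variable R : pzRingType.
Implicit Types K L M N E P Q I G Z : lmodType R.

(* Contains every module of finite projective dimension. *)
Inductive perf : lmodType R -> Prop :=
| perf_proj P of projective P : perf P
| perf_coker K E M (i : {linear K -> E}) (p : {linear E -> M}) of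
    ses i p & perf K & perf E : perf M
| perf_retract M N of retract M N & perf N : perf M.

(** The middle term of a sequence is allowed dimension n + 1 instead of being injective: tensoring
    an injective coresolution with Y yields middle terms I (x) Y that are not injective. *)
Inductive injdim_le : nat -> lmodType R -> Prop :=
| injdim_inj n I of injective_module I : injdim_le n I
| injdim_ker n K E M (i : {linear K -> E}) (p : {linear E -> M}) of
    ses i p & injdim_le n.+1 E & injdim_le n M : injdim_le n.+1 K
| injdim_retract n M N of retract M N & injdim_le n N : injdim_le n M.

Definition perf_orth M := forall K, perf K -> orth M K.

Definition injdim_orth M := forall n K, injdim_le n K -> orth M K.

(** An n-th syzygy whose middle terms need only be orthogonal to modules of finite injective
    dimension. This admits P (x) Y with P projective and Y Gorenstein projective. *)
Inductive gsyz : nat -> lmodType R -> Prop :=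
| gsyz0 G : gsyz 0 G
| gsyzS n G E G' (i : {linear G -> E}) (p : {linear E -> G'}) of
    ses i p & injdim_orth E & gsyz n G' : gsyz n.+1 G.

Lemma gsyzW n G : gsyz n.+1 G -> gsyz n G.
Proof.
elim: n G => [|n IH] G; first by move=> _; apply: gsyz0.
move H: n.+2 => m g; case: g H => // m' G0 E G' i p s oE g' [mE].
by apply: (gsyzS s oE); apply: IH; rewrite mE.
Qed.

Lemma injdim_le_finite M : finite_injdim M -> exists n, injdim_le n M.
Proof.
move=> [n [I [e [d [iI I0 ie exe exd]]]]].
(* Here K is the kernel of [d j]. Induction on m starts where m = 0, hence j > n and I j = 0. *)
have kerd m j K (i : {linear K -> I j}) : (n.+1 <= m + j)%N -> injective i ->
    (forall x, d j x = 0 <-> exists k, i k = x) -> injdim_le m K.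
  elim: m j K i => [|m IH] j K i nmj ii iP.
    have K0 (x : K) : x = 0 by apply: ii; rewrite linear0; apply: I0.
    by apply: injdim_inj => M1 N1 i1 f1 _; exists \0 => x; rewrite [RHS]K0.
  have [||K' [i' [ii' iP']]] := submoduleP (@submod_closedP R _ (fun x => d j.+1 x = 0) _ _).
  - exact: linear0.
  - by move=> a x y dx dy; rewrite linearP dx dy scaler0 addr0.
  have {}iP' x : d j.+1 x = 0 <-> exists k, i' k = x.
    by rewrite -iP' inE; split=> [?|/asboolP]; [exact/asboolP|].
  have [|p pP] := @colift R K' _ _ i' (d j) ii'.
    by move=> x; apply/iP'/exd; exists x.
  apply: (injdim_ker (i := i) (p := p)) (injdim_inj _ (iI j)) (IH j.+1 K' i' _ ii' iP').
    split=> // [y|y].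
      have /exd[x xP] : d j.+1 (i' y) = 0 by apply/iP'; exists y.
      by exists x; apply: ii'; rewrite pP.
    by rewrite -iP -pP; split=> [->|e0]; [rewrite linear0 | apply: ii'; rewrite e0 linear0].
  by rewrite addnS -addSn.
(* One more than the length of the coresolution, since the induction stops at the zero module I (n +
   1). *)
by exists n.+1; apply: (kerd _ 0%N M e) => //; rewrite addn0.
Qed.

Hypotheses (eP : enough_projectives R) (eI : enough_injectives R).

Lemma projective_injdim_orth P : projective P -> injdim_orth P.
Proof. by move=> pP n K _; apply: orth_projective. Qed.

(** Each cosyzygy on the side of K is traded for a cosyzygy on the side of G by [orth_shift]; the n
    steps available on the latter end at an injective module on the former. *)
Lemma gsyz_orth n G K : gsyz n G -> injdim_le n K -> orth G K.
Proof.
move=> g v; elim: v G g => {n K} [n I iI|n K E M i p s vE IHE v IH|n M N r v IH] G g.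
- exact: orth_injective.
- have oGE := IHE _ g; move H: n.+1 g => m g; case: g H oGE => // m' G0 E' G' i' p' s' oE' g' [mE] oGE.
  have gn : gsyz n G' by rewrite mE.
  exact: (orth_shift eP eI s' s oGE (oE' _ _ (injdim_ker s vE v)) (IH _ gn)).
- exact: orth_retractr (IH _ g).
Qed.

(** For K -> E -> M, a map from a syzygy L of G to M lifts to E by Ext^1(L, K) = 0 and then extends
    to P by Ext^1(G, E) = 0. The induction applies to L because n-th syzygies in this sense are
    stable under taking a further syzygy. *)
Lemma gsyz_perf_orth n : (forall P, projective P -> injdim_le n P) ->
  forall G, gsyz n G -> perf_orth G.
Proof.
move=> pv G g K w; elim: w G g => {K} [P pP|K E M i p s wK IHK wE IHE|M N r w IH] G g.
- exact: gsyz_orth (pv _ pP).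
- have [P [q [pP sq]]] := eP G; have [L [j sj]] := ker_ses sq.
  apply: (ext_orth pP sj) => f.
  have gL : gsyz n L by apply/gsyzW/(gsyzS sj) => //; exact: projective_injdim_orth.
  have [h hP] := IHK _ gL _ _ _ _ f s.
  have [h' h'P] := orth_ext eI h (IHE _ g) sj.
  by exists (p \o h') => x /=; rewrite h'P hP.
- by apply: orth_retractr (IH _ g).
Qed.

End FiniteDimension.

(** * Gorenstein projective modules *)

Section GorensteinProjective.
Variable R : pzRingType.
Implicit Types K L M N E P Q I G Z : lmodType R.

Lemma kernel_exact M N (f : {linear M -> N}) : exists K (i : {linear K -> M}),
  injective i /\ exact_at i f.
Proof.
have [||K [i [ii iP]]] := submoduleP (@submod_closedP R M (fun x => f x = 0) _ _).
- exact: linear0.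
- by move=> a x y fx fy; rewrite linearP fx fy scaler0 addr0.
exists K, i; split=> // x.
by rewrite -iP inE; split=> [?|/asboolP]; [exact/asboolP|].
Qed.

(** The cokernel of M -> P 1 is the kernel of the next differential, so the complex shifted by one
    serves for it. *)
Lemma gproj_cosyzygy M : gproj M ->
  exists P M' (i : {linear M -> P}) (p : {linear P -> M'}),
    [/\ ses i p, projective P & gproj M'].
Proof.
move=> [P [d [e [pP exd homd ie exe]]]].
have [M' [e' [ie' exe']]] := kernel_exact (d (1 + 1)).
have [x|p pP'] := colift (h := d 1) ie'; first by apply/exe'/exd; exists x.
exists (P 1), M', e, p; split=> //.
  split=> // [y|y].
    have /exd[x xP] : d (1 + 1) (e' y) = 0 by apply/exe'; exists y.
    by exists x; apply: ie'; rewrite pP'.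
  by rewrite -exe -pP'; split=> [->|h]; [rewrite linear0 | apply: ie'; rewrite h linear0].
exists (fun i => P (1 + i)), (fun i => d (1 + i)), e'; split.
- by [].
- move=> i; exact: exd.
- move=> Q pQ i; exact: (homd Q pQ (1+i)).
- by [].
- exact: exe'.
Qed.

Lemma gproj_gsyz n M : gproj M -> gsyz n M.
Proof.
elim: n M => [|n IH] M gM; first exact: gsyz0.
have [P [M' [i [p [s pP gM']]]]] := gproj_cosyzygy gM.
exact: (gsyzS s (projective_injdim_orth pP) (IH _ gM')).
Qed.

(** A type of data and not a proposition, so that chosen sequences can be iterated and spliced. *)
Definition proj_ses K M : Type :=
  {P : lmodType R & {i : {linear K -> P} & {p : {linear P -> M} | projective P /\ ses i p}}}.

(* The class C is closed under syzygies and under suitable cosyzygies; splicing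
   these gives a complete resolution. *)
Lemma gproj_splice (C : lmodType R -> Prop) :
  (forall M Q, C M -> projective Q -> orth M Q) ->
  enough_injectives R ->
  (forall M, C M -> exists L P (i : {linear L -> P}) (p : {linear P -> M}),
     [/\ C L, projective P & ses i p]) ->
  (forall M, C M -> exists P N (i : {linear M -> P}) (p : {linear P -> N}),
     [/\ C N, projective P & ses i p]) ->
  forall M, C M -> gproj M.
Proof.
move=> Corth eI left right M CM.
pose T := {N : lmodType R | C N}.
have lstep (t : T) : {t' : T & proj_ses (sval t') (sval t)}.
  case: t => N CN; have /cid[L /cid[P /cid[i /cid[p [CL pP s]]]]] := left N CN.
  by exists (exist _ L CL), P, i, p.
have rstep (t : T) : {t' : T & proj_ses (sval t) (sval t')}.
  case: t => N CN; have /cid[P /cid[L /cid[i /cid[p [CL pP s]]]]] := right N CN.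
  by exists (exist _ L CL), P, i, p.
pose l n := iter n (fun t => projT1 (lstep t)) (exist _ M CM).
pose r n := iter n (fun t => projT1 (rstep t)) (exist _ M CM).
(* The module of cocycles in degree j. It is M in degree 1, the iterated cosyzygies lie above and
   the syzygies below, which puts the first syzygy in degree 0. *)
pose Z (j : int) : T :=
  match j with Posz 0 => l 1%N | Posz n.+1 => r n | Negz n => l n.+2 end.
(* The case split is fine enough for [1 + j] to compute in each branch. *)
have st (j : int) : proj_ses (sval (Z j)) (sval (Z (1 + j))).
  case: j => [[|n]|[|[|n]]].
  - exact (projT2 (lstep (l 0%N))).
  - exact (projT2 (rstep (r n))).
  - exact (projT2 (lstep (l 1%N))).
  - exact (projT2 (lstep (l 2%N))).
  - exact (projT2 (lstep (l n.+3))).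
pose P j := projT1 (st j).
pose i (j : int) : {linear sval (Z j) -> P j} := projT1 (projT2 (st j)).
pose p (j : int) : {linear P j -> sval (Z (1 + j))} := sval (projT2 (projT2 (st j))).
have pP j : projective (P j) by case: (svalP (projT2 (projT2 (st j)))).
have s j : ses (i j) (p j) by case: (svalP (projT2 (projT2 (st j)))).
have ip j x : p j (i j x) = 0 by case: (s j) => _ _ /exact_at0.
exists P, (fun j => i (1 + j) \o p j), (i 1); split=> //.
- move=> j y; have [ii1 _ _] := s (1 + (1 + j)); have [_ sp _] := s j.
  have [_ _ ex] := s (1 + j); split=> /= [h|[x <-]]; last by rewrite ip linear0.
  have /ex[z zy] : p (1 + j) y = 0 by apply: ii1; rewrite h linear0.
  by have [x xz] := sp z; exists x; rewrite xz.
(* A map f that vanishes on boundaries factors through the cocycles one degree up, and extends from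
   there to the projective module because the next cocycles lie in C, hence are orthogonal to Q. *)
- move=> Q pQ j f; split=> [fd|[g gP] x]; last first.
    by rewrite -gP /= ip !linear0.
  have [z|h hP] := ses_descend (h := f) (s (1 + j)).
    by have [_ sp _] := s j; have [x <-] := sp z; apply: fd.
  have [g gP] := orth_ext eI h (Corth _ Q (svalP (Z (1 + (1 + (1 + j))))) pQ) (s (1 + (1 + j))).
  by exists g => x /=; rewrite gP.
- by case: (s 1).
- move=> y; have [_ _ ex] := s 1; rewrite -ex /=; have [ii _ _] := s (1 + 1).
  by split=> [h|->]; [apply: ii; rewrite h linear0 | rewrite linear0].
Qed.

(** Existence of projective preenvelopes, also called left approximations; injectivity of [eta] is a
    separate matter. *)
Definition proj_approx : Prop := forall M, exists P (eta : {linear M -> P}), projective P /\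
  forall Q (f : {linear M -> Q}), projective Q -> exists g : {linear P -> Q},
    forall x, g (eta x) = f x.

Hypotheses (eP : enough_projectives R) (eI : enough_injectives R) (aP : proj_approx).
Hypothesis inj_perf : forall I, injective_module I -> perf I.

(** If K is in perf and I is an injective module containing it, then I/K is in perf too, so Ext^1(L,
    K) shifts to Ext^1(M, I/K) = 0. *)
Lemma perf_orth_syzygy L P M (i : {linear L -> P}) (p : {linear P -> M}) :
  ses i p -> projective P -> perf_orth M -> perf_orth L.
Proof.
move=> s pP gM K wK; have [I [j [iI ij]]] := eI K; have [N [q t]] := coker_ses ij.
apply: (orth_shift eP eI s t (orth_injective iI) (orth_projective pP)).
by apply/gM/(perf_coker t wK)/inj_perf.
Qed.

(** Since Ext^1(M, K) = 0, a map from M lifts along E -> E/K, so it can be traced back to one of the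
    projective modules from which the target is built. *)
Lemma perf_orth_factor M K : perf_orth M -> perf K -> forall f : {linear M -> K},
  exists Q (g : {linear M -> Q}) (h : {linear Q -> K}), projective Q /\ forall x, h (g x) = f x.
Proof.
move=> gM; elim=> {K} [P pP f|K E N i p s wK _ wE IH f|K N [s [r rs]] _ IH f].
- by exists P, f, idfun.
- have [f' f'P] := gM _ wK _ _ _ _ f s.
  have [Q [g [h [pQ hP]]]] := IH f'.
  by exists Q, g, (p \o h); split=> // x /=; rewrite hP f'P.
- have [Q [g [h [pQ hP]]]] := IH (s \o f).
  by exists Q, g, (r \o h); split=> // x /=; rewrite hP /= rs.
Qed.

(** The embedding of M into an injective module factors through a projective one, hence through the
    preenvelope, which is therefore injective. Any map from M to K in perf factors through it
    likewise, and this is Ext^1(N, K) = 0 for the cokernel N. *)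
Lemma perf_orth_cosyzygy M : perf_orth M ->
  exists P N (i : {linear M -> P}) (p : {linear P -> N}),
    [/\ perf_orth N, projective P & ses i p].
Proof.
move=> gM; have [P [eta [pP etaP]]] := aP M.
have [I [j [iI ij]]] := eI M.
have [Q [g [h [pQ hP]]]] := perf_orth_factor gM (inj_perf iI) j.
have [g' g'P] := etaP _ g pQ.
have ieta : injective eta.
  by move=> x y e; apply: ij; rewrite -!hP -!g'P e.
have [N [p s]] := coker_ses ieta; exists P, N, eta, p; split=> // K wK.
apply: (ext_orth pP s) => f.
have [Q' [u [v [pQ' uv]]]] := perf_orth_factor gM wK f.
have [w wP] := etaP _ u pQ'.
by exists (v \o w) => x /=; rewrite wP uv.
Qed.

Lemma perf_orth_gproj M : perf_orth M -> gproj M.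
Proof.
apply: gproj_splice => // {M} M.
- by move=> Q gM pQ; apply/gM/perf_proj.
- move=> gM; have [P [p [pP sp]]] := eP M; have [L [i s]] := ker_ses sp.
  by exists L, P, i, p; split=> //; apply: perf_orth_syzygy s pP gM.
- exact: perf_orth_cosyzygy.
Qed.

Variable n : nat.
Hypothesis proj_injdim : forall P, projective P -> injdim_le n P.

Lemma gprojE M : gproj M <-> perf_orth M.
Proof.
split; last exact: perf_orth_gproj.
by move=> gM; apply: (gsyz_perf_orth eP eI proj_injdim); apply: gproj_gsyz.
Qed.

End GorensteinProjective.

(** * Eklof's lemma *)

Section WellOrder.
Variables (J : eqType) (le : rel J).
Hypothesis wo : well_order le.

(** The order axioms below are all drawn from the unique minima that [well_order] provides. *)
Lemma wo_min (P : J -> Prop) : (exists x, P x) -> exists2 z, P z & forall y, P y -> le z y.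
Proof.
move=> [x Px]; have [|z [[+ zmin] _]] := wo (A := [pred y | `[< P y >]]).
  by exists x; rewrite inE; apply/asboolP.
rewrite inE => /asboolP Pz; exists z => // y Py.
by apply: zmin; rewrite inE; apply/asboolP.
Qed.

Lemma wo_total x y : le x y \/ le y x.
Proof.
have [|z zP zmin] := @wo_min (fun z => z = x \/ z = y); first by exists x; left.
by case: zP => zE; rewrite zE in zmin; [left|right]; apply: zmin; [right|left].
Qed.

Lemma wo_refl x : le x x.
Proof. by case: (wo_total x x). Qed.

Lemma wo_anti x y : le x y -> le y x -> x = y.
Proof.
move=> xy yx; have [|z [[_ zmin] uz]] := wo (A := [pred z | (z == x) || (z == y)]).
  by exists x; rewrite inE eqxx.
rewrite -(uz x); last first.
  split; first by rewrite inE eqxx.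
  by move=> t; rewrite inE => /orP[/eqP->|/eqP->//]; exact: wo_refl.
rewrite -(uz y) //; split; first by rewrite inE eqxx orbT.
by move=> t; rewrite inE => /orP[/eqP->//|/eqP->]; exact: wo_refl.
Qed.

Lemma wo_trans x y z : le x y -> le y z -> le x z.
Proof.
move=> xy yz.
have [|m mP mmin] := @wo_min (fun m => [\/ m = x, m = y | m = z]).
  by exists x; apply: Or31.
case: mP => mE; rewrite mE in mmin; first by apply: mmin; apply: Or33.
- by rewrite (wo_anti xy) //; apply: mmin; apply: Or31.
- by rewrite -(wo_anti yz) //; apply: mmin; apply: Or32.
Qed.

End WellOrder.

Section Eklof.
Variable R : pzRingType.
Implicit Types K L M N E P Q I G Z : lmodType R.

(** By [lift_orth], only lifts along I -> I/K matter. Zorn's lemma replaces transfinite recursion: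
    partial lifts glue at limits, and extend over a successor because the factor F has Ext^1(F, K) =
    0. *)
Lemma eklof K M : enough_injectives R -> filt (fun F => orth F K) M -> orth M K.
Proof.
move=> eI [J [le [bot [top [V [wo bt Vsub [Vbot Vtop Vmono Vlim Vsucc]]]]]]].
have [I [j [iI ij]]] := eI K; have [N [q t]] := coker_ses ij.
apply: (lift_orth iI t) => f.
have lerr := wo_refl wo; have letr := wo_trans wo; have leanti := wo_anti wo.
have VZD a c x y : x \in V a -> y \in V a -> c *: x + y \in V a.
  by case: (Vsub a) => _; apply.
(* A maximal partial lift of f, defined on some V a, is defined on V top. *)
pose part (x : J * (M -> I)) : Prop :=
  (forall c, {in V x.1 &, forall y z, x.2 (c *: y + z) = c *: x.2 y + x.2 z}) /\
  {in V x.1, forall y, q (x.2 y) = f y}.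
pose T := {x : J * (M -> I) | part x}.
(* Only a preorder: two functions may agree on V a and differ elsewhere. *)
pose Rl : rel T := fun x y =>
  `[< le (sval x).1 (sval y).1 /\ {in V (sval x).1, (sval x).2 =1 (sval y).2} >].
have t0P : part (bot, fun=> 0).
  split=> /= [c x y _ _|x /Vbot->]; last by rewrite !linear0.
  by rewrite scaler0 addr0.
have [x|x y z|A tA|z zmax] := @classical_sets.ZL_preorder T (exist _ _ t0P) Rl.
- by apply/asboolP; split.
- move=> /asboolP[xy xyE] /asboolP[yz yzE]; apply/asboolP; split; first exact: letr yz.
  by move=> u ux; rewrite xyE // yzE //; apply: Vmono ux.
- have [[x0 Ax0]|A0] := pselect (exists x, A x); last first.
    by exists (exist _ _ t0P) => x Ax; case: A0; exists x.
  (* The supremum of the indices occurring in the chain. *)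
  have [|b bU bmin] := wo_min wo (P := fun b => forall x, A x -> le (sval x).1 b).
    by exists top => x _; case: (bt (sval x).1).
  have [[x [Ax xb]]|nob] := pselect (exists x, A x /\ (sval x).1 = b).
    exists x => y Ay; case: (tA _ _ Ay Ax) => // /asboolP[xy xyE]; apply/asboolP.
    have yb : (sval y).1 = b by apply: leanti; [exact: bU | rewrite -xb].
    by rewrite yb -xb; split=> // u ux; rewrite xyE.
  have nb x : A x -> (sval x).1 <> b by move=> Ax xb; apply: nob; exists x.
  have above i : le i b -> i != b -> exists2 x, A x & le i (sval x).1.
    move=> ib /eqP nib; apply: contrapT => nx; apply: nib; apply: leanti => //.
    apply: bmin => x Ax; case: (wo_total wo (sval x).1 i) => // ix.
    by case: nx; exists x.
  (* An unattained supremum is a limit point, so V b is a union of domains on which the lifts of the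
     chain are defined. *)
  have blim : limit_point le b.
    split; first by exists (sval x0).1; [exact: bU | apply/eqP; exact: nb].
    move=> [i [ib nib cov]]; have [x Ax ix] := above i ib nib.
    case: (cov _ ix (bU _ Ax)) => [xi|]; last exact: nb.
    have /eqP := nib; apply; apply: leanti => //; apply: bmin => y Ay.
    case: (tA _ _ Ay Ax) => /asboolP[]; rewrite xi // => iy _.
    case: (cov _ iy (bU _ Ay)) => [->//|yb]; by case: (nb y).
  have inV u : u \in V b -> exists2 x, A x & u \in V (sval x).1.
    move=> /(Vlim _ blim)[i [ib nib ui]]; have [x Ax ix] := above i ib nib.
    by exists x => //; apply: Vmono ui.
  (* Off V b the glued function is 0, a value that [part] ignores. *)
  have /choice[g gP] u : exists y : I, u \in V b ->
      forall x, A x -> u \in V (sval x).1 -> y = (sval x).2 u.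
    have [ub|_] := boolP (u \in V b); last by exists 0.
    have [x Ax ux] := inV u ub; exists ((sval x).2 u) => _ y Ay uy.
    by case: (tA _ _ Ax Ay) => /asboolP[_ e]; rewrite e.
  have inV2 u v : u \in V b -> v \in V b -> exists x, [/\ A x, u \in V (sval x).1 & v \in V (sval x).1].
    move=> /inV[x Ax ux] /inV[y Ay vy].
    case: (tA _ _ Ax Ay) => /asboolP[xy _]; [exists y|exists x]; split=> //.
      exact: Vmono ux.
    exact: Vmono vy.
  have bP : part (b, g).
    split=> /= [c u v ub vb|u ub].
      have [x [Ax ux vx]] := inV2 _ _ ub vb.
      rewrite !(gP _ _ x) //; try exact: VZD.
      by case: x {Ax} ux vx => x [/= h _] ux vx; rewrite h.
    have [x Ax ux] := inV _ ub; rewrite (gP _ ub x) //.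
    by case: x {Ax} ux => x [/= _ h] ux; rewrite h.
  exists (exist _ _ bP) => x Ax; apply/asboolP; split; first exact: bU.
  move=> u ux /=; rewrite (gP u _ x) //.
  by apply: Vmono ux; apply: bU.
case: z zmax => [[a g] [/= glin gf]] gmax.
have atop : a = top.
  apply: contrapT => nat.
  have [|b [ab nab] bmin] := wo_min wo (P := fun b => le a b /\ b <> a).
    by exists top; split; [case: (bt a) | move=> e; apply: nat].
  have cab : covers le a b.
    split=> //; first by apply/eqP => e; apply: nab.
    move=> l al lb; have [->|nla] := pselect (l = a); first by left.
    by right; apply: leanti => //; apply: bmin.
  have [F oF [pi [pilin pisurj piker]]] := Vsucc a b cab.
  have Vab := Vmono a b ab.
  have [Sa [ia [iia Sa_P]]] := submoduleP (Vsub a).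
  have [Sb [ib [iib Sb_P]]] := submoduleP (Vsub b).
  have iaV x : ia x \in V a by apply/Sa_P; exists x.
  have ibV x : ib x \in V b by apply/Sb_P; exists x.
  have lga : linear (g \o ia) by move=> c x y /=; rewrite linearP glin.
  (* Extend g to h0 on all of M by injectivity of I. The error q h0 - f vanishes on V a, hence on V
     b it factors through F; lifting it to w : F -> I gives the corrected lift h0 - w pi. *)
  have [h0 h0P] := iI _ _ ia (lin lga) iia.
  have lpb : linear (pi \o ib) by move=> c x y /=; rewrite linearP pilin.
  have spb : surj (lin lpb).
    by move=> y; have [x /Sb_P[x' <-] <-] := pisurj y; exists x'.
  have [x|u uP] := descend (h := ((q \o h0) \- f) \o ib) spb.
    move=> /= /(piker _ (ibV x))/Sa_P[y <-].
    by rewrite h0P /= gf //= subrr.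
  have [w wP] := oF _ _ _ _ u t.
  have bP : part (b, fun x => h0 x - w (pi x)).
    split=> /= [c x y xb yb|x xb].
      by rewrite pilin // (linearP h0) (linearP w) scalerBr opprD addrACA.
    rewrite linearB wP; case/Sb_P: xb => x' <-.
    by have /= -> := uP x'; rewrite subKr.
  have /asboolP[/= ba _] : Rl (exist _ _ bP) (exist _ (a, g) (conj glin gf)).
    apply: gmax; apply/asboolP; split=> //= x xa.
    have -> : pi x = 0 by apply/piker => //; exact: Vab.
    by rewrite linear0 subr0; case/Sa_P: xa => y <-; rewrite h0P.
  by apply: nab; apply: leanti.
subst a.
have lg : linear g by move=> c x y; rewrite glin.
by exists (lin lg) => x /=; rewrite gf.
Qed.

End Eklof.

(** * Vector spaces *)

Section VectorSpace.
Variable k : fieldType.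
Implicit Types U V W : lmodType k.

(** A subspace maximal among those meeting the image of i trivially is a complement. *)
Lemma vs_complement U V (i : {linear U -> V}) : injective i ->
  exists S : V -> Prop, [/\ S 0, forall a x y, S x -> S y -> S (a *: x + y),
    forall u, S (i u) -> u = 0 & forall v, exists u, S (v - i u)].
Proof.
move=> ii.
pose good (S : V -> Prop) := [/\ S 0, forall a x y, S x -> S y -> S (a *: x + y) &
  forall u, S (i u) -> u = 0].
pose T := {S : V -> Prop | good S}.
pose Rl : rel T := fun S S' => `[< forall x, sval S x -> sval S' x >].
have g0 : good (fun v => v = 0).
  split=> // [a x y -> ->|u iu]; first by rewrite scaler0 addr0.
  by apply: ii; rewrite linear0.
have [S|S1 S2 S3|A tA|[S gS] Smax] := @classical_sets.ZL_preorder T (exist _ _ g0) Rl.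
- exact/asboolP.
- by move=> /asboolP h1 /asboolP h2; apply/asboolP=> x /h1/h2.
- have [[X AX]|A0] := pselect (exists X, A X); last first.
    by exists (exist _ _ g0) => X AX; case: A0; exists X.
  have gU : good (fun v => exists2 Y, A Y & sval Y v).
    split=> [|a x y [Y AY Yx] [Z AZ Zy]|u [[Y [_ _ Yi]] _ /Yi]//].
      by exists X => //; case: X {AX} => ? [].
    have [/asboolP YZ|/asboolP ZY] := tA _ _ AY AZ.
      by exists Z => //; have YZx := YZ x Yx; case: Z {AZ YZ} Zy YZx => ? [/= _ h _] *; apply: h.
    by exists Y => //; have ZYy := ZY y Zy; case: Y {AY ZY} Yx ZYy => ? [/= _ h _] *; apply: h.
  by exists (exist _ _ gU) => Y AY; apply/asboolP => x Yx; exists Y.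
have [S0 SD Si] := gS; exists S; split=> // v; apply: contrapT => nv.
have SZ a x : S x -> S (a *: x) by move=> Sx; rewrite -[_ *: _]addr0; apply: SD.
(* Adjoin the line of v. A nonzero vector of the image in the larger subspace would, after division
   by its coefficient c at v, exhibit v in S + im i. *)
have gS' : good (fun x => exists c, S (x - c *: v)).
  split=> [|a x y [c Sx] [d Sy]|u [c Su]].
  - by exists 0; rewrite scale0r subr0.
  - exists (a * c + d).
    by rewrite scalerDl -scalerA opprD addrACA -scalerBr; apply: SD.
  - have [c0|c0] := eqVneq c 0; first by apply: Si; move: Su; rewrite c0 scale0r subr0.
    case: nv; exists (c^-1 *: u).
    have -> : v - i (c^-1 *: u) = - c^-1 *: (i u - c *: v).
      by rewrite linearZ /= scalerBr scalerA mulNr mulVf // scaleN1r opprK addrC scaleNr.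
    exact: SZ.
have /asboolP /= h : Rl (exist _ _ gS') (exist _ S gS).
  by apply: Smax; apply/asboolP => x Sx; exists 0; rewrite scale0r subr0.
by apply: nv; exists 0; rewrite linear0 subr0; apply: h; exists 1; rewrite scale1r subrr.
Qed.

Lemma vs_retraction U V (i : {linear U -> V}) : injective i ->
  exists r : {linear V -> U}, cancel i r.
Proof.
move=> ii; have [S [S0 SD Si /choice[r rP]]] := vs_complement ii.
have SB x y : S x -> S y -> S (x - y).
  by move=> Sx Sy; rewrite addrC -scaleN1r; apply: SD.
have ru v u : S (v - i u) -> r v = u.
  move=> Sv; apply/eqP; rewrite -subr_eq0; apply/eqP/Si.
  rewrite linearB; have := SB _ _ Sv (rP v).
  by rewrite opprB addrC addrA subrK.
have lr : linear r.
  move=> a x y; apply: ru; rewrite linearP opprD addrACA -scalerBr.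
  exact: SD.
by exists (lin lr) => u; apply: ru; rewrite subrr.
Qed.

Lemma vs_injective V : injective_module V.
Proof.
move=> M N i f /vs_retraction[r rP]; exists (f \o r) => x.
by rewrite /= rP.
Qed.

Lemma vs_section U V (p : {linear U -> V}) : surj p -> exists s : {linear V -> U}, cancel s p.
Proof.
move=> sp; have [K [i s]] := ker_ses sp; have [ii _ ex] := s.
have [r rP] := vs_retraction ii.
have [|t tP] := ses_descend (h := idfun \- (i \o r)) s.
  by move=> x /=; rewrite rP subrr.
exists t => y; have [x <-] := sp y.
by rewrite tP /= linearB (exact_at0 _ ex) subr0.
Qed.

Lemma vs_separate V (v : V) : (forall f : {linear V -> k^o}, f v = 0) -> v = 0.
Proof.
move=> fv; have [//|v0] := eqVneq v 0.
have lv : linear (fun c : k^o => c *: v) by move=> a x y; rewrite scalerDl scalerA.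
have [|r rP] := @vs_retraction k^o V (lin lv).
  apply: lin_inj => c /= /eqP; rewrite scaler_eq0 => /orP[/eqP//|].
  by rewrite (negPf v0).
have := rP 1; rewrite /= scale1r fv => /esym/eqP; by rewrite oner_eq0.
Qed.

End VectorSpace.

(** * Free and cofree modules *)

HB.instance Definition _ (k : fieldType) (A : falgType k) := GRing.Lmodule.copy A^c A.

Section Converse.
Variables (k : fieldType) (A : falgType k).

(** With these instances [A^c] is a finite-dimensional algebra, so results on left modules apply to
    right ones. *)
Fact conv_scalerAl (c : k) (x y : A^c) : c *: (x * y) = ((c *: x : A^c) * y : A^c).
Proof. exact (@scalerAr k A c y x). Qed.
HB.instance Definition _ := GRing.Lmodule_isLalgebra.Build k A^c conv_scalerAl.
Fact conv_scalerAr (c : k) (x y : A^c) : c *: (x * y) = (x * (c *: y : A^c) : A^c).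
Proof. exact (@scalerAl k A c y x). Qed.
HB.instance Definition _ := GRing.Lalgebra_isAlgebra.Build k A^c conv_scalerAr.
HB.instance Definition _ := Vector.copy A^c A.
End Converse.
Section Bases.
Variable k : fieldType.

(** Indexed by any finite type, so that pairs of basis elements index a basis of the tensor product
    with no renumbering. *)
Record basis (A : falgType k) := Basis {
  bI : finType;
  be : bI -> A;
  bc : bI -> {linear A -> k^o};
  bcE : forall a, a = \sum_i bc i a *: be i;
  bc_be : forall i j, bc i (be j) = (i == j)%:R
}.

Definition coord_fun (A : falgType k) i (a : A) : k^o := v2r a 0 i.
Fact coord_linear A i : linear (@coord_fun A i).
Proof. by move=> c x y; rewrite /coord_fun linearP !mxE. Qed.

Definition std_basis (A : falgType k) : basis A.
Proof.
apply: (@Basis A 'I_(dim A) (fun i => r2v (delta_mx 0 i)) (fun i => lin (@coord_linear A i))).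
- move=> a /=; apply: v2r_inj; rewrite {1}[v2r a]row_sum_delta linear_sum /=.
  by apply: eq_bigr => i _; rewrite linearZ /= r2vK.
- by move=> i j /=; rewrite /coord_fun r2vK mxE eqxx.
Defined.

End Bases.

Arguments be {k A} b i.
Arguments bc {k A} b i.
Arguments bcE {k A} b a.

Section FreeCofree.
Variables (k : fieldType) (A : falgType k) (b : basis A).
Implicit Types (X Y N M : lmodType A) (V W : lmodType k).

Lemma restr_linear X Y (f : {linear X -> Y}) : linear (f : restr X -> restr Y).
Proof. by move=> c x y; apply: linearP. Qed.
Definition resl X Y (f : {linear X -> Y}) : {linear restr X -> restr Y} :=
  lin (@restr_linear X Y f).

Lemma restrZ X V (h : {linear restr X -> V}) (c : k) (x : X) : h (c%:A *: x) = c *: h x.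
Proof. exact: (linearZ_LR h c x). Qed.

Lemma restrZV X V (h : {linear V -> restr X}) (c : k) v : h (c *: v) = c%:A *: (h v : X) :> X.
Proof. exact: (linearZ_LR h c v). Qed.

Lemma algZC (c : k) (a : A) X (x : X) : a *: (c%:A *: x) = c%:A *: (a *: x).
Proof. by rewrite !scalerA mulr_algr mulr_algl. Qed.

Lemma basis_sum X (a : A) (x : X) : a *: x = \sum_i (bc b i a)%:A *: (be b i *: x).
Proof.
rewrite {1}[a](bcE b) scaler_suml; apply: eq_bigr => i _.
by rewrite scalerA mulr_algl.
Qed.

(* X = A (x) V, the elements j v being 1 (x) v. *)
Definition free_on X V (j : {linear V -> restr X}) (kap : bI b -> {linear restr X -> V}) : Prop :=
  (forall x : X, x = \sum_i be b i *: (j (kap i x) : X)) /\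
  (forall i r v, kap i (be b r *: (j v : X)) = (i == r)%:R *: v).

(* X = Hom_k(A, V), and eps is the evaluation at 1. *)
Definition cofree_on X V (eps : {linear restr X -> V}) (sig : bI b -> {linear V -> restr X}) : Prop :=
  (forall x : X, x = \sum_i (sig i (eps (be b i *: x)) : X)) /\
  (forall i r v, eps (be b r *: (sig i v : X)) = (i == r)%:R *: v).

(** Hom_A(A (x) V, N) = Hom_k(V, N). The map is written in coordinates; linearity over A follows
    from its values on the elements a (j v), which span. *)
Lemma free_ext X V j kap N (h : {linear V -> restr N}) : @free_on X V j kap ->
  exists g : {linear X -> N}, forall v, g (j v) = h v.
Proof.
move=> [fE fK].
pose g (x : X) : N := \sum_i be b i *: (h (kap i x) : N).
have gj (a : A) v : g (a *: (j v : X)) = a *: (h v : N).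
  rewrite [in RHS](basis_sum a) /g; apply: eq_bigr => i _.
  rewrite -algZC -restrZV; congr (_ *: _); apply: (congr1 h).
  rewrite (basis_sum a) linear_sum (bigD1 i) //= restrZ fK eqxx scale1r.
  by rewrite big1 ?addr0 // => r ri; rewrite restrZ fK eq_sym (negPf ri) scale0r scaler0.
have gD x y : g (x + y) = g x + g y.
  rewrite /g -big_split; apply: eq_bigr => i _ /=.
  by rewrite [kap i _](linearD (kap i)) [h _]linearD scalerDr.
have g0 : g 0 = 0 by apply: (addrI (g 0)); rewrite -gD !addr0.
have gZ a x : g (a *: x) = a *: g x.
  rewrite (fE x) scaler_sumr !(big_morph g gD g0) scaler_sumr.
  by apply: eq_bigr => i _; rewrite scalerA !gj scalerA.
have lg : linear g by move=> a x y; rewrite gD gZ.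
by exists (lin lg) => v; rewrite /= -[in LHS](scale1r (j v : X)) gj scale1r.
Qed.

Lemma free_uniq X V j kap N (g g' : {linear X -> N}) : @free_on X V j kap ->
  (forall v, g (j v) = g' (j v)) -> g =1 g'.
Proof.
move=> [fE _] gg x; rewrite (fE x) !linear_sum; apply: eq_bigr => i _.
by rewrite !linearZ /= gg.
Qed.

(** The lifting problem moves to vector spaces, where surjections split. *)
Lemma free_projective X V j kap : @free_on X V j kap -> projective X.
Proof.
move=> fr M N p f sp; have [s sK] := @vs_section k (restr M) (restr N) (resl p) sp.
have [g gP] := free_ext (s \o (resl f \o j)) fr.
exists g; apply: (free_uniq (g := p \o g) fr) => v /=.
by rewrite gP; apply: sK.
Qed.

Lemma free_cover X V j kap N (h : {linear V -> restr N}) : @free_on X V j kap -> surj h ->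
  exists g : {linear X -> N}, surj g.
Proof.
move=> /(free_ext h)[g gP] sh; exists g => y.
by have [v <-] := sh y; exists (j v).
Qed.

Lemma cofree_eq X V eps sig (x y : X) : @cofree_on X V eps sig ->
  (forall i, eps (be b i *: x) = eps (be b i *: y)) -> x = y.
Proof.
by move=> [cE _] xy; rewrite (cE x) (cE y); apply: eq_bigr => i _; rewrite xy.
Qed.

Lemma cofree_ext X V eps sig N (h : {linear restr N -> V}) : @cofree_on X V eps sig ->
  exists g : {linear N -> X}, forall n, eps (g n) = h n.
Proof.
move=> co; have [cE cK] := co.
pose g (n : N) : X := \sum_i (sig i (h (be b i *: n)) : X).
have ge a n : eps (a *: g n) = h (a *: n).
  rewrite !(basis_sum a) !linear_sum; apply: eq_bigr => r _; rewrite !restrZ.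
  congr (_ *: _); rewrite /g scaler_sumr linear_sum (bigD1 r) //= cK eqxx scale1r.
  by rewrite big1 ?addr0 // => i ir; rewrite cK (negPf ir) scale0r.
have lg : linear g.
  move=> a x y; apply: (cofree_eq co) => i; rewrite ge scalerDr.
  rewrite [in RHS]scalerDr [eps _]linearD scalerA !ge scalerA.
  by rewrite (ge _ x) [LHS](linearD h).
by exists (lin lg) => n /=; rewrite -[g n]scale1r ge scale1r.
Qed.

(** Hom_A(N, Hom_k(A, V)) = Hom_k(N, V), and every vector space is injective. *)
Lemma cofree_injective X V eps sig : @cofree_on X V eps sig -> injective_module X.
Proof.
move=> co M N i f ii.
have [h hP] := @vs_injective k V (restr M) (restr N) (resl i) (eps \o resl f) ii.
have [g gP] := cofree_ext h co; exists g => m.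
apply: (cofree_eq co) => r; rewrite -!linearZ /= gP.
exact: hP.
Qed.

Lemma cofree_embed X V eps sig N (h : {linear restr N -> V}) : @cofree_on X V eps sig ->
  injective h -> exists g : {linear N -> X}, injective g.
Proof.
move=> /(cofree_ext h)[g gP] ih; exists g => x y e.
by apply: ih; rewrite -!gP e.
Qed.

End FreeCofree.

(** * Duality *)

Section DualSpace.
Variables (k : fieldType) (V : lmodType k).

Fact dualk_closed : submod_closed [pred f : V -> k^o | `[< linear f >]].
Proof.
apply: submod_closedP => [a x y|a f g lf lg c x y]; first by rewrite scaler0 addr0.
have -> u : (a *: f + g) u = a *: f u + g u by [].
rewrite lf lg !scalerDr !scalerA -(mulrC a) -!scalerA -!addrA; congr (_ + _).
by rewrite addrCA.
Qed.

Definition dualk := subm dualk_closed.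
HB.instance Definition _ := GRing.Lmodule.on dualk.

Lemma dualkP (f : dualk) : linear (sval f).
Proof. by have := valP f; rewrite inE => /asboolP. Qed.

Definition mkdual (f : V -> k^o) (lf : linear f) : dualk :=
  exist _ f (introT (asboolP _) lf).

Lemma dualk_eq (f g : dualk) : sval f =1 sval g -> f = g.
Proof. by move=> fg; apply/val_inj/funext. Qed.

End DualSpace.

Section DualModule.
Variables (k : fieldType) (A : falgType k).
Implicit Types K E M N X : lmodType A^c.

(** D N = Hom_k(N, k) for a right module N, with left action (a f)(n) = f(n a). *)
Definition dualm N : Type := dualk (restr N).
Section Instance.
Variable N : lmodType A^c.
HB.instance Definition _ := GRing.Zmodule.on (dualm N).

Fact dualm_linear (a : A) (f : dualm N) :
  linear (fun n : restr N => sval f ((a : A^c) *: (n : N)) : k^o).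
Proof.
move=> c x y; rewrite -(dualkP f); congr (sval f _).
rewrite scalerDr; congr (_ + _).
exact: (algZC c (a : A^c) (x : N)).
Qed.

Definition dualm_scale (a : A) (f : dualm N) : dualm N := mkdual (dualm_linear a f).

Fact dualm_scaleA a b v : dualm_scale a (dualm_scale b v) = dualm_scale (a * b) v.
Proof. by apply: dualk_eq => n /=; rewrite scalerA. Qed.
Fact dualm_scale1 : left_id 1 dualm_scale.
Proof. by move=> v; apply: dualk_eq => n /=; rewrite scale1r. Qed.
Fact dualm_scaleDr : right_distributive dualm_scale +%R.
Proof. by move=> a u v; apply: dualk_eq. Qed.
Fact dualm_scaleDl v : {morph dualm_scale^~ v : a b / a + b}.
Proof.
move=> a b; apply: dualk_eq => n /=; rewrite scalerDl.
exact: (linearDf _ _ (dualkP v)).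
Qed.
HB.instance Definition _ := GRing.Zmodule_isLmodule.Build A (dualm N)
  dualm_scaleA dualm_scale1 dualm_scaleDr dualm_scaleDl.

Lemma dualm_scaleE (a : A) (f : dualm N) n : sval (a *: f) n = sval f ((a : A^c) *: n).
Proof. by []. Qed.
Lemma dualm_addE (f g : dualm N) n : sval (f + g) n = sval f n + sval g n.
Proof. by []. Qed.
End Instance.

Section Functor.
Variables (M N : lmodType A^c) (f : {linear M -> N}).
Fact dual_map_linear1 (u : dualm N) : linear (fun m : restr M => sval u (f m) : k^o).
Proof. by move=> c x y; rewrite [f _](linearP (resl f)) dualkP. Qed.
Fact dual_map_linear : linear (fun u : dualm N => mkdual (dual_map_linear1 u) : dualm M).
Proof.
move=> a u v; apply: dualk_eq => m.
exact: (congr1 (fun z => sval u z + sval v (f m)) (esym (linearZ_LR f (a : A^c) m))).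
Qed.
Definition dual_map : {linear dualm N -> dualm M} := lin dual_map_linear.
End Functor.

Lemma dual_ses K E M (i : {linear K -> E}) (p : {linear E -> M}) :
  ses i p -> ses (dual_map p) (dual_map i).
Proof.
move=> s; have [ii sp ex] := s; split.
- move=> u v e; apply: dualk_eq => m; have [x <-] := sp m.
  exact: (congr1 (fun w => sval w x) e).
- move=> u; have [g gP] := @vs_injective k k^o (restr K) (restr E) (resl i) (lin (dualkP u)) ii.
  have lg : linear (g : restr E -> k^o) by exact: linearP.
  by exists (mkdual lg); apply: dualk_eq => x /=; apply: gP.
- move=> u; split=> [u0|[v <-]]; last first.
    apply: dualk_eq => x /=; rewrite (exact_at0 _ ex).
    by have := linear0 (lin (dualkP v)).
  have [x|g gP] := @descend k (restr M) (restr E) k^o (resl p) (lin (dualkP u)) sp.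
    move=> /ex[y <-] /=; exact: (congr1 (fun w => sval w y) u0).
  have lg : linear (g : restr M -> k^o) by exact: linearP.
  by exists (mkdual lg); apply: dualk_eq => x /=; apply: gP.
Qed.

Lemma dual_retract M N : retract M N -> retract (dualm M) (dualm N).
Proof.
move=> [s [r rs]]; exists (dual_map r), (dual_map s) => u.
by apply: dualk_eq => m /=; rewrite rs.
Qed.

Definition conv_basis (b : basis A) : basis A^c :=
  @Basis k A^c (bI b) (be b) (bc b) (bcE b) (@bc_be k A b).

(** D Hom_k(A, V) = A (x) D V, as A is finite-dimensional; the structure maps are the transposes of
    [eps] and [sig]. This is how D turns injective right modules into projective left modules. *)
Lemma dual_cofree_free (b : basis A) X (V : lmodType k) eps sig :
  @cofree_on k A^c (conv_basis b) X V eps sig ->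
  exists j kap, @free_on k A b (dualm X) (dualk V) j kap.
Proof.
move=> [cE cK].
have lj1 (u : dualk V) : linear (fun x : restr X => sval u (eps x) : k^o).
  by move=> c x y; rewrite linearP dualkP.
have lj : linear (fun u => mkdual (lj1 u) : restr (dualm X)).
  move=> c u v; apply: dualk_eq => x /=.
  exact: (congr1 (fun z => z + sval v (eps x))
    (esym (etrans (congr1 (sval u) (restrZ eps c x)) (linearZf c _ (dualkP u))))).
have lk1 i (u : restr (dualm X)) : linear (fun v : V => sval (u : dualm X) (sig i v) : k^o).
  by move=> c x y; rewrite linearP dualkP.
have lk i : linear (fun u => mkdual (lk1 i u)).
  move=> c u v; apply: dualk_eq => x /=.
  exact: (congr1 (fun z => z + sval v (sig i x)) (linearZf c _ (dualkP u))).
exists (lin lj), (fun i => lin (lk i)); split=> [u|i r v].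
  apply: dualk_eq => x.
  have -> : sval (\sum_i be b i *: ((lin lj (lin (lk i) u)) : dualm X)) x =
     \sum_i sval u (sig i (eps ((be b i : A^c) *: x))).
    by elim/big_rec2: _ => // i y1 y2 _ <-.
  rewrite {1}(cE x); elim/big_rec2: _ => [|i y1 y2 _ <-]; first exact: (linear0 (lin (dualkP u))).
  exact: (linearDf _ _ (dualkP u)).
apply: dualk_eq => x /=.
transitivity (sval v ((i == r)%:R *: x)); first by rewrite -cK.
by rewrite (linearZf _ _ (dualkP v)).
Qed.

End DualModule.

(** * Powers *)

Section Powers.
Variable R : pzRingType.
Implicit Types K E M N P I : lmodType R.

Fact pow_map_linear T M N (f : {linear M -> N}) : linear (fun (u : T -> M) (t : T) => f (u t)).
Proof. by move=> a u v; apply/funext => t; apply: linearP. Qed.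
Definition pow_map T M N (f : {linear M -> N}) : {linear (T -> M) -> (T -> N)} :=
  lin (@pow_map_linear T M N f).

Fact proj_fun_linear T M (t : T) : linear (fun u : T -> M => u t).
Proof. by []. Qed.
Definition proj_fun T M (t : T) : {linear (T -> M) -> M} := lin (@proj_fun_linear T M t).

Lemma pow_ses T K E M (i : {linear K -> E}) (p : {linear E -> M}) :
  ses i p -> ses (pow_map T i) (pow_map T p).
Proof.
move=> [ii sp ex]; split.
- move=> u v e; apply/funext => t; apply: ii; exact: (congr1 (fun w => w t) e).
- by move=> u; have [e eP] := choice (fun t => sp (u t)); exists e; apply/funext.
- move=> u; split=> [u0|[v <-]].
    have /choice[v vP] t : exists x, i x = u t.
      by apply/ex; exact: (congr1 (fun w => w t) u0).
    by exists v; apply/funext.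
  by apply/funext => t; apply: (exact_at0 _ ex).
Qed.

Lemma pow_retract T M N : retract M N -> retract (T -> M) (T -> N).
Proof.
move=> [s [r rs]]; exists (pow_map T s), (pow_map T r) => u.
by apply/funext => t; apply: rs.
Qed.

Lemma pow_injective T I : injective_module I -> injective_module (T -> I).
Proof.
move=> iI M N i f ii.
have /choice[g gP] t := iI _ _ i (proj_fun I t \o f) ii.
have lg : linear (fun n t => g t n).
  by move=> a x y; apply/funext => t; apply: linearP.
by exists (lin lg) => x; apply/funext => t; apply: gP.
Qed.

Lemma pow_injdim T n M : injdim_le n M -> injdim_le n (T -> M).
Proof.
elim=> {n M} [n I iI|n K E M i p s _ IHE _ IH|n M N r _ IH].
- exact/injdim_inj/pow_injective.
- exact: (injdim_ker (pow_ses T s) IHE IH).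
- exact: injdim_retract (pow_retract T r) IH.
Qed.

End Powers.

(** * Powers of the regular module and of its dual *)

Section AlgebraModules.
Variables (k : fieldType) (A : falgType k).
Implicit Types (M N P Q I : lmodType A).

(** D(A), the dual of the right regular module: an injective cogenerator. *)
Definition dreg : lmodType A := dualm ((A^c)^o : lmodType A^c).

(** A^T = A (x) k^T even for infinite T, because A is finite-dimensional. *)
Lemma pow_free (b : basis A) T : exists j kap,
  @free_on k A b (T -> A^o : lmodType A) (T -> k^o : lmodType k) j kap.
Proof.
have lj : linear (fun v : T -> k^o => (fun t => (v t)%:A) : restr (T -> A^o : lmodType A)).
  move=> c u v; apply/funext => t.
  have -> : (c *: u + v) t = c * u t + v t by [].
  by rewrite scalerDl -scalerA -[in LHS]mulr_algl.
have lk i : linear (fun (u : restr (T -> A^o : lmodType A)) (t : T) => bc b i (u t) : k^o).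
  move=> c u v; apply/funext => t.
  rewrite [LHS](linearD (bc b i)); congr (_ + _).
  exact: (etrans (congr1 (bc b i) (mulr_algl c (u t : A))) (linearZ_LR (bc b i) c (u t : A))).
exists (lin lj), (fun i => lin (lk i)); split=> [u|i r v].
  apply/funext => t; rewrite [LHS](bcE b (u t)) fct_sumE; apply: eq_bigr => i _ /=.
  by rewrite -[LHS]mulr_algr.
apply/funext => t /=.
have -> : (be b r *: (fun t0 => (v t0)%:A : A^o)) t = v t *: be b r by exact: mulr_algr.
by rewrite linearZ_LR bc_be [LHS]mulrC.
Qed.

Lemma dreg_scale1 (a : A) (f : dreg) : sval (a *: f) 1 = sval f a.
Proof.
rewrite dualm_scaleE; congr (sval f _).
exact: (@mul1r A a).
Qed.

Lemma restr_dreg_scale (c : k) (f : dreg) (a : A) : sval (c%:A *: f) a = c * sval f a.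
Proof. exact: (linearZf c (a : restr ((A^c)^o : lmodType A^c)) (dualkP f)). Qed.

Definition dcoef (b : basis A) i (c : k) (a : restr ((A^c)^o : lmodType A^c)) : k^o :=
  c * bc b i a.

Lemma dcoef_linear b i c : linear (@dcoef b i c).
Proof.
move=> d x y; rewrite /dcoef [bc b i _](linearD (bc b i)) mulrDr; congr (_ + _).
have -> : d *: x = d *: (x : A) by exact: (@mulr_algr k A d x).
by rewrite linearZ_LR; exact: mulrCA.
Qed.

(** D(A)^T = Hom_k(A, k^T). *)
Lemma pow_cofree (b : basis A) T : exists eps sig,
  @cofree_on k A b (T -> dreg : lmodType A) (T -> k^o : lmodType k) eps sig.
Proof.
have le : linear (fun (u : restr (T -> dreg : lmodType A)) (t : T) => sval (u t) 1 : k^o).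
  move=> c u v; apply/funext => t.
  exact: (congr1 (fun z => z + sval (v t) 1) (restr_dreg_scale c (u t) 1)).
have ls i : linear (fun (v : T -> k^o) => (fun t => mkdual (@dcoef_linear b i (v t)))
    : restr (T -> dreg : lmodType A)).
  move=> c u v; apply/funext => t; apply: dualk_eq => a.
  rewrite [LHS](mulrDl (c * u t)) -mulrA.
  exact: (congr1 (fun z => z + v t * bc b i a)
            (esym (restr_dreg_scale c (mkdual (@dcoef_linear b i (u t)) : dreg) a))).
exists (lin le), (fun i => lin (ls i)); split=> [u|i r v].
  apply/funext => t; apply: dualk_eq => a.
  have -> : sval ((\sum_i (lin (ls i) (lin le (be b i *: u)) : T -> dreg)) t) a =
      \sum_i sval (u t) (be b i) * bc b i a.
    rewrite fct_sumE; elim/big_rec2: _ => // i y1 y2 _ <-.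
    rewrite [LHS]dualm_addE -(dreg_scale1 (be b i) (u t)).
    by [].
  rewrite {1}[a](bcE b).
  elim/big_rec2: _ => [|i y1 y2 _ <-]; first exact: (linear0 (lin (dualkP (u t)))).
  rewrite [LHS](linearDf _ _ (dualkP (u t))); congr (_ + _).
  rewrite mulrC -restr_dreg_scale dualm_scaleE; congr (sval (u t) _).
  exact (esym (@mulr_algr k A (bc b i a) (be b i))).
apply/funext => t.
transitivity (v t * bc b i (be b r)); last by rewrite bc_be mulrC.
exact: (dreg_scale1 (be b r) (mkdual (@dcoef_linear b i (v t)) : dreg)).
Qed.

End AlgebraModules.

(** * Gorenstein algebras *)

Section AlgebraHomology.
Variables (k : fieldType) (A : falgType k).
Implicit Types (M N P Q I : lmodType A).

Lemma embed_space (V : lmodType k) : exists T (f : {linear V -> (T -> k^o)}), injective f.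
Proof.
have lev : linear (fun (v : V) (f : {linear V -> k^o}) => f v).
  by move=> a x y; apply/funext => f; apply: linearP.
exists {linear V -> k^o}, (lin lev); apply: lin_inj => x x0; apply: vs_separate => f.
exact: (congr1 (fun w => w f) x0).
Qed.

(** As a vector space N is a retract of some k^T, so A (x) k^T = A^T maps onto N. *)
Lemma cover_pow N : exists T (g : {linear (T -> A^o) -> N}), surj g.
Proof.
have [T [f fi]] := embed_space (restr N); exists T.
have [r rP] := vs_retraction fi.
have [j [kap fr]] := pow_free (std_basis A) T.
by apply: (free_cover (h := r) fr) => y; exists (f y); apply: rP.
Qed.

Lemma embed_pow N : exists T (g : {linear N -> (T -> dreg A)}), injective g.
Proof.
have [T [f fi]] := embed_space (restr N); exists T.
have [eps [sig co]] := pow_cofree (std_basis A) T.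
exact: (cofree_embed (h := f) co).
Qed.

Lemma pow_projective T : projective (T -> A^o : lmodType A).
Proof. by have [j [kap fr]] := pow_free (std_basis A) T; apply: free_projective fr. Qed.

Lemma pow_dreg_injective T : injective_module (T -> dreg A : lmodType A).
Proof. by have [e [s co]] := pow_cofree (std_basis A) T; apply: cofree_injective co. Qed.

(** Reduces statements on all projective modules to stability under powers and retracts. *)
Lemma projective_pow P : projective P -> exists T, retract P (T -> A^o : lmodType A).
Proof.
by have [T [g sg]] := cover_pow P => pP; exists T; apply: projective_section sg.
Qed.

Lemma injective_pow I : injective_module I -> exists T, retract I (T -> dreg A : lmodType A).
Proof.
by have [T [g ig]] := embed_pow I => iI; exists T; apply: injective_retraction ig.
Qed.

Lemma falg_enough_projectives : enough_projectives A.
Proof.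
by move=> M; have [T [g sg]] := cover_pow M; exists (T -> A^o), g; split=> //; apply: pow_projective.
Qed.

Lemma falg_enough_injectives : enough_injectives A.
Proof.
by move=> M; have [T [g ig]] := embed_pow M; exists (T -> dreg A), g; split=> //; apply: pow_dreg_injective.
Qed.

(** The evaluation map from M to the power of A indexed by Hom(M, A). A map from M to A^S has
    components in Hom(M, A), so it factors through evaluation by reindexing. *)
Lemma falg_proj_approx : proj_approx A.
Proof.
move=> M; pose T := {linear M -> A^o}.
have le : linear (fun (m : M) (f : T) => f m).
  by move=> a x y; apply/funext => f; apply: linearP.
exists (T -> A^o), (lin le); split=> [|Q f pQ]; first exact: pow_projective.
have [S [s [r rs]]] := projective_pow pQ.
pose fs (t : S) : T := proj_fun A^o t \o (s \o f).
have lg : linear (fun (u : T -> A^o) (t : S) => u (fs t)) by [].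
exists (r \o lin lg) => x; exact: (rs (f x)).
Qed.

Lemma pow_perf T M : perf M -> perf (T -> M : lmodType A).
Proof.
elim=> {M} [P pP|K E M i p s _ IHK _ IHE|M N r _ IH].
- have [S rS] := projective_pow pP.
  have [lf lg] : linear (fun (u : T -> S -> A^o) (x : T * S) => u x.1 x.2) /\
     linear (fun (u : T * S -> A^o) (t : T) (s : S) => u (t, s)) by [].
  apply: perf_proj; have h : projective (T * S -> A^o : lmodType A) by exact: pow_projective.
  refine (projective_retract _ h).
  apply: retract_trans (pow_retract T rS) _.
  by exists (lin lf), (lin lg).
- exact: perf_coker (pow_ses T s) IHK IHE.
- exact: perf_retract (pow_retract T r) IH.
Qed.

End AlgebraHomology.

Section GorensteinAlgebra.
Variables (k : fieldType) (A : falgType k).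

(** Duality reverses short exact sequences, so the kernels that build [injdim_le] become the
    cokernels that build [perf]. *)
Lemma dual_perf n (N : lmodType A^c) : injdim_le n N -> perf (dualm N).
Proof.
elim=> {n N} [n I iI|n K E M i p s _ IHE _ IH|n M N r _ IH].
- have [T rT] := injective_pow iI; apply: perf_proj.
  apply: projective_retract (dual_retract rT) _.
  have [e [s co]] := pow_cofree (conv_basis (std_basis A)) T.
  by have [j [kap fr]] := dual_cofree_free co; apply: free_projective fr.
- exact: perf_coker (dual_ses s) IH IHE.
- exact: perf_retract (dual_retract r) IH.
Qed.

(** The form in which the Gorenstein property is used: the first half comes from the right regular
    module by duality, the second from the left one. *)
Definition gorenstein_dims (n : nat) : Prop :=
  (forall I : lmodType A, injective_module I -> perf I) /\
  (forall P : lmodType A, projective P -> injdim_le n P).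

Lemma gorenstein_dreg : gorenstein A -> perf (dreg A).
Proof. by case=> _ /injdim_le_finite[n /dual_perf]. Qed.

Lemma gorenstein_reg : gorenstein A -> exists n, injdim_le n (A^o : lmodType A).
Proof. by case=> /injdim_le_finite. Qed.

Lemma gorenstein_dimsP : gorenstein A -> exists n, gorenstein_dims n.
Proof.
move=> gA; have [n vA] := gorenstein_reg gA; exists n; split=> [I|P].
- move=> /injective_pow[T rT].
  exact: perf_retract rT (pow_perf T (gorenstein_dreg gA)).
- by move=> /projective_pow[T rT]; apply: injdim_retract rT (pow_injdim T vA).
Qed.

Lemma gorenstein_gprojE n M : gorenstein_dims n -> gproj M <-> @perf_orth A M.
Proof.
case=> ip pv; apply: (gprojE _ _ _ ip pv).
- exact: falg_enough_projectives.
- exact: falg_enough_injectives.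
- exact: falg_proj_approx.
Qed.

End GorensteinAlgebra.

(** * Tensor products *)

Section TensorMaps.
Variable k : fieldType.
Implicit Types (U V W K E M : lmodType k).

Lemma lin_bilin U V U' V' (f : {linear U -> U'}) (g : {linear V -> V'}) :
  bilin (fun u v => tpure (f u) (g v)).
Proof.
split=> [v|u] a x y /=; first by rewrite linearP (pure_bilin _ _).1.
by rewrite linearP (pure_bilin _ _).2.
Qed.

Lemma tmapk_ex U V U' V' (f : {linear U -> U'}) (g : {linear V -> V'}) :
  exists h : {linear tens U V -> tens U' V'}, forall u v, h (tpure u v) = tpure (f u) (g v).
Proof.
exists (lin (tlift_linear (lin_bilin f g))) => u v.
exact: (tlift_pure _ _ (lin_bilin f g)).
Qed.

(* Kept opaque, so that simplification does not unfold it. *)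
Definition tmapk U V U' V' (f : {linear U -> U'}) (g : {linear V -> V'}) :
  {linear tens U V -> tens U' V'} := sval (cid (tmapk_ex f g)).

Lemma tmapk_pure U V U' V' (f : {linear U -> U'}) (g : {linear V -> V'}) u v :
  tmapk f g (tpure u v) = tpure (f u) (g v).
Proof. exact: (svalP (cid (tmapk_ex f g))). Qed.

Lemma tens_lin_eq U V W (f g : {linear tens U V -> W}) :
  (forall u v, f (tpure u v) = g (tpure u v)) -> f =1 g.
Proof. by apply: tlift_unique; exact: linearP. Qed.

Lemma tmapk_comp U V U' V' U'' V'' (f : {linear U -> U'}) (g : {linear V -> V'})
    (f' : {linear U' -> U''}) (g' : {linear V' -> V''}) z :
  tmapk f' g' (tmapk f g z) = tmapk (f' \o f) (g' \o g) z.
Proof.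
by apply: (tens_lin_eq (f := tmapk f' g' \o tmapk f g)) => u v; rewrite /= !tmapk_pure.
Qed.

Lemma tmapk_eq U V U' V' (f f' : {linear U -> U'}) (g g' : {linear V -> V'}) :
  f =1 f' -> g =1 g' -> tmapk f g =1 tmapk f' g'.
Proof. by move=> ff gg; apply: tens_lin_eq => u v; rewrite !tmapk_pure ff gg. Qed.

Lemma tmapk_id U V (f : {linear U -> U}) (g : {linear V -> V}) z :
  f =1 id -> g =1 id -> tmapk f g z = z.
Proof.
move=> fE gE; apply: (tens_lin_eq (g := idfun)) => u v /=.
by rewrite tmapk_pure fE gE.
Qed.

Lemma tpure0l U V (v : V) : tpure (0 : U) v = 0.
Proof. by rewrite -[0 in LHS](scale0r 0) (linearZf _ _ ((pure_bilin _ _).1 v)) scale0r. Qed.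
Lemma tpure0r U V (u : U) : tpure u (0 : V) = 0.
Proof. by rewrite -[0 in LHS](scale0r 0) (linearZf _ _ ((pure_bilin _ _).2 u)) scale0r. Qed.

Lemma ses_split K E M (i : {linear K -> E}) (p : {linear E -> M}) : ses i p ->
  exists (r : {linear E -> K}) (s : {linear M -> E}),
   [/\ cancel i r, cancel s p & forall x, i (r x) + s (p x) = x].
Proof.
move=> t; have [ii sp ex] := t; have [r rP] := vs_retraction ii.
have [|s sP] := ses_descend (h := idfun \- (i \o r)) t.
  by move=> x /=; rewrite rP subrr.
exists r, s; split=> // [y|x]; last by rewrite sP /= addrC subrK.
by have [x <-] := sp y; rewrite sP /= linearB (exact_at0 _ ex) subr0.
Qed.

(** Sequences of vector spaces split, and the identity i r + s p = id survives tensoring. *)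
Lemma tens_sesl K E M V (i : {linear K -> E}) (p : {linear E -> M}) : ses i p ->
  ses (tmapk i (idfun : {linear V -> V})) (tmapk p idfun).
Proof.
move=> t; have [ii sp ex] := t; have [r [s [rP sP rs]]] := ses_split t.
split.
- by apply: (can_inj (g := tmapk r idfun)) => z; rewrite tmapk_comp tmapk_id.
- by move=> z; exists (tmapk s idfun z); rewrite tmapk_comp tmapk_id.
- move=> z; split=> [pz|[y <-]]; last first.
    rewrite tmapk_comp; apply: (tens_lin_eq (g := \0)) => u v.
    by rewrite tmapk_pure /= (exact_at0 _ ex) tpure0l.
  have h (u : E) (v : V) : tpure u v = tmapk (i \o r) idfun (tpure u v) + tmapk (s \o p) idfun (tpure u v).
    by rewrite !tmapk_pure /= -[in LHS](rs u) (linearDf _ _ ((pure_bilin _ _).1 v)).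
  have := tens_lin_eq (f := idfun) (g := tmapk (i \o r) idfun \+ tmapk (s \o p) idfun) h z; rewrite /=.
  have <- : tmapk s idfun (tmapk p idfun z) = tmapk (s \o p) idfun z.
    by rewrite tmapk_comp; apply: tmapk_eq.
  rewrite pz linear0 addr0 => zE.
  by exists (tmapk r idfun z); rewrite [RHS]zE tmapk_comp; apply: tmapk_eq.
Qed.

Lemma tswap_ex U V : exists h : {linear tens U V -> tens V U},
  forall u v, h (tpure u v) = tpure v u.
Proof.
have b : bilin (fun (u : U) (v : V) => tpure v u).
  by split=> [v|u] a x y; [exact: (pure_bilin V U).2 | exact: (pure_bilin V U).1].
by exists (lin (tlift_linear b)) => u v; exact: (tlift_pure _ _ b).
Qed.

Definition tswap U V : {linear tens U V -> tens V U} := sval (cid (tswap_ex U V)).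

Lemma tswap_pure U V u v : tswap U V (tpure u v) = tpure v u.
Proof. exact: (svalP (cid (tswap_ex U V))). Qed.

Lemma tswapK U V : cancel (tswap U V) (tswap V U).
Proof.
move=> z; apply: (tens_lin_eq (f := tswap V U \o tswap U V) (g := idfun)) => u v /=.
by rewrite !tswap_pure.
Qed.

Lemma tswap_tmapk U V U' V' (f : {linear U -> U'}) (g : {linear V -> V'}) z :
  tswap U' V' (tmapk f g z) = tmapk g f (tswap U V z).
Proof.
apply: (tens_lin_eq (f := tswap U' V' \o tmapk f g) (g := tmapk g f \o tswap U V)) => u v /=.
by rewrite tswap_pure !tmapk_pure tswap_pure.
Qed.

Lemma tens_sesr K E M V (i : {linear K -> E}) (p : {linear E -> M}) : ses i p ->
  ses (tmapk (idfun : {linear V -> V}) i) (tmapk idfun p).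
Proof.
move=> /(tens_sesl V)[ii sp ex]; split.
- by move=> x y e; apply: (can_inj (@tswapK V K)); apply: ii; rewrite -!tswap_tmapk e.
- move=> z; have [y yP] := sp (tswap _ _ z); exists (tswap _ _ y).
  by rewrite -tswap_tmapk yP tswapK.
- move=> z; split=> [pz|[y <-]].
    have /ex[y yP] : tmapk p idfun (tswap _ _ z) = 0 by rewrite -tswap_tmapk pz linear0.
    by exists (tswap _ _ y); rewrite -tswap_tmapk yP tswapK.
  apply: (can_inj (@tswapK V M)); rewrite !tswap_tmapk linear0.
  exact: exact_at0 ex.
Qed.
End TensorMaps.

(** * The tensor product as a finite-dimensional algebra *)

Section TensorAlgebraBasis.
Variables (k : fieldType) (A B : falgType k).
Implicit Types (ba : basis A) (bb : basis B).

Lemma coord_bilin (f : {linear A -> k^o}) (g : {linear B -> k^o}) :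
  bilin (fun a b => f a * g b : k^o).
Proof.
split=> [b|a] c x y /=; first by rewrite linearP mulrDl -mulrA.
by rewrite linearP mulrDr mulrCA.
Qed.

Lemma tcoord_ex (f : {linear A -> k^o}) (g : {linear B -> k^o}) :
  exists h : {linear tensalg A B -> k^o}, forall a b, h (tpure a b) = f a * g b.
Proof.
exists (lin (tlift_linear (coord_bilin f g)) : {linear tensalg A B -> k^o}) => a b.
exact: (tlift_pure _ _ (coord_bilin f g)).
Qed.

Definition tcoord f g : {linear tensalg A B -> k^o} := sval (cid (tcoord_ex f g)).

Lemma tcoord_pure f g a b : tcoord f g (tpure a b) = f a * g b.
Proof. exact: (svalP (cid (tcoord_ex f g))). Qed.

Lemma tens_basisE ba bb (z : tensalg A B) :
  z = \sum_(p : bI ba * bI bb) (tcoord (bc ba p.1) (bc bb p.2) z : k) *: (tpure (be ba p.1) (be bb p.2) : tensalg A B).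
Proof.
elim/tens_ind: z => [|a b z IH].
  by rewrite big1 // => p _; rewrite linear0 scale0r.
rewrite {1}IH.
under [RHS]eq_bigr => p _ do rewrite linearD scalerDl.
rewrite big_split /=; congr (_ + _).
under eq_bigr => p _ do rewrite tcoord_pure.
rewrite -(pair_bigA _ (fun i j => (bc ba i a * bc bb j b : k) *: (tpure (be ba i) (be bb j) : tensalg A B))) /=.
rewrite {1}(bcE ba a) (big_morph (fun a : A => tpure a b) (id1 := 0) (op1 := +%R)); first last.
- by rewrite tpure0l.
- by move=> x y; rewrite (linearDf _ _ ((pure_bilin _ _).1 b)).
apply: eq_bigr => i _; rewrite (linearZf _ _ ((pure_bilin _ _).1 b)).
rewrite {1}(bcE bb b) (big_morph (fun b : B => tpure (be ba i) b) (id1 := 0) (op1 := +%R)); first last.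
- by rewrite tpure0r.
- by move=> x y; rewrite (linearDf _ _ ((pure_bilin _ _).2 _)).
rewrite scaler_sumr; apply: eq_bigr => j _.
by rewrite (linearZf _ _ ((pure_bilin _ _).2 _)) scalerA.
Qed.

Lemma tens_basis_coord ba bb (p q : bI ba * bI bb) :
  tcoord (bc ba p.1) (bc bb p.2) (tpure (be ba q.1) (be bb q.2)) = (p == q)%:R.
Proof. by rewrite tcoord_pure !bc_be -natrM mulnb. Qed.

(** Coordinates in the product of the standard bases; they give access to all that is proved for
    finite-dimensional algebras. *)
Definition tens_v2r (z : tensalg A B) : 'rV[k]_(dim A * dim B) :=
  mxvec (\matrix_(i, j) tcoord (bc (std_basis A) i) (bc (std_basis B) j) z).

Fact tens_v2r_linear : linear tens_v2r.
Proof.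
move=> c x y; rewrite /tens_v2r -linearP; congr mxvec.
by apply/matrixP => i j; rewrite !mxE linearP.
Qed.

Fact tens_v2r_bij : bijective tens_v2r.
Proof.
exists (fun w => \sum_(p : 'I_(dim A) * 'I_(dim B))
   vec_mx w p.1 p.2 *: (tpure (be (std_basis A) p.1) (be (std_basis B) p.2) : tensalg A B)).
  move=> z; rewrite [RHS](tens_basisE (std_basis A) (std_basis B)).
  by apply: eq_bigr => p _; rewrite /tens_v2r mxvecK mxE.
move=> w; rewrite /tens_v2r -[RHS]vec_mxK; congr mxvec.
apply/matrixP => i j; rewrite mxE linear_sum (bigD1 (i, j)) //=.
rewrite linearZ /= (@tens_basis_coord (std_basis A) (std_basis B) (i, j) (i, j)) eqxx.
rewrite [_ *: _]mulr1 big1 ?addr0 // => p pij; rewrite linearZ /=.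
rewrite (@tens_basis_coord (std_basis A) (std_basis B) (i, j) p) eq_sym.
by rewrite (negPf pij); exact: mulr0.
Qed.

HB.instance Definition _ := Lmodule_hasFinDim.Build k (tensalg A B)
  (exist2 _ _ tens_v2r tens_v2r_linear tens_v2r_bij).
HB.instance Definition _ := Algebra_isFalgebra.Build k (tensalg A B).

Definition tens_basis ba bb : basis (tensalg A B) :=
  @Basis k (tensalg A B) (bI ba * bI bb)%type
    (fun p => tpure (be ba p.1) (be bb p.2)) (fun p => tcoord (bc ba p.1) (bc bb p.2))
    (tens_basisE ba bb) (@tens_basis_coord ba bb).

End TensorAlgebraBasis.

Section TensorModules.
Variables (k : fieldType) (A B : falgType k).
Local Notation L := (tensalg A B).
Implicit Types (X : lmodType A) (Y : lmodType B).

Lemma tens_linear X Y (N : lmodType L) (phi : tensmod X Y -> N) :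
  (forall x y, phi (x + y) = phi x + phi y) ->
  (forall a b (x : X) (y : Y), phi (tpure (a *: x : restr X) (b *: y : restr Y)) =
     (tpure a b : L) *: phi (tpure (x : restr X) (y : restr Y))) ->
  linear phi.
Proof.
move=> pD pP; have p0 : phi 0 = 0 by apply: (addrI (phi 0)); rewrite -pD !addr0.
suff pZ a x : phi (a *: x) = a *: phi x by move=> a x y; rewrite pD pZ.
elim/tens_ind: a => [|a b l IHl]; first by rewrite !scale0r.
rewrite !scalerDl pD {}IHl; congr (_ + _).
elim/tens_ind: x => [|x y z IHz]; first by rewrite p0 !scaler0 p0.
by rewrite !scalerDr !pD scalerDr {}IHz tensmod_scale_pure pP.
Qed.

(** Reconciles the two k-structures on X (x) Y, the restriction from L and the tensor product over
    k. *)
Lemma restr_tens X Y (c : k) (z : tens (restr X) (restr Y)) :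
  (c%:A : L) *: (z : tensmod X Y) = c *: z.
Proof.
elim/tens_ind: z => [|x y z IH]; first by rewrite [LHS]scaler0 scaler0.
rewrite [LHS]scalerDr scalerDr IH; congr (_ + _).
have -> : (c%:A : L) = tpure (c%:A : A) (1 : B).
  by rewrite (linearZf _ _ ((pure_bilin _ _).1 (1 : B))).
rewrite tensmod_scale_pure scale1r.
exact: (linearZf c (x : restr X) ((pure_bilin _ _).1 y)).
Qed.

Section Map.
Variables (X X' : lmodType A) (Y Y' : lmodType B).
Variables (f : {linear X -> X'}) (g : {linear Y -> Y'}).

Fact tmap_linear : linear (tmapk (resl f) (resl g) : tensmod X Y -> tensmod X' Y').
Proof.
apply: tens_linear => [x y|a b x y]; first exact: (linearD (tmapk (resl f) (resl g))).
by rewrite !tmapk_pure tensmod_scale_pure /= !linearZ.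
Qed.
Definition tmap : {linear tensmod X Y -> tensmod X' Y'} := lin tmap_linear.
End Map.

Lemma tens_mod_sesl (K E M : lmodType A) Y (i : {linear K -> E}) (p : {linear E -> M}) : ses i p ->
  ses (tmap i (idfun : {linear Y -> Y})) (tmap p idfun).
Proof.
move=> [ii sp ex].
have t : @ses k (restr K) (restr E) (restr M) (resl i) (resl p) by [].
have [ii' sp' ex'] := tens_sesl (restr Y) t.
have e (K1 K2 : lmodType A) (f : {linear K1 -> K2}) (z : tensmod K1 Y) :
    tmap f (idfun : {linear Y -> Y}) z = tmapk (resl f) idfun z by apply: tmapk_eq.
split=> [x y|z|z]; first by rewrite !e; apply: ii'.
  by have [w wz] := sp' z; exists w; rewrite e.
rewrite e; split=> [/ex'[w <-]|[w <-]]; first by exists w; rewrite e.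
by rewrite e; apply/ex'; exists w.
Qed.

Lemma tens_mod_sesr (K E M : lmodType B) X (i : {linear K -> E}) (p : {linear E -> M}) : ses i p ->
  ses (tmap (idfun : {linear X -> X}) i) (tmap idfun p).
Proof.
move=> [ii sp ex].
have t : @ses k (restr K) (restr E) (restr M) (resl i) (resl p) by [].
have [ii' sp' ex'] := tens_sesr (restr X) t.
have e (K1 K2 : lmodType B) (f : {linear K1 -> K2}) (z : tensmod X K1) :
    tmap (idfun : {linear X -> X}) f z = tmapk idfun (resl f) z by apply: tmapk_eq.
split=> [x y|z|z]; first by rewrite !e; apply: ii'.
  by have [w wz] := sp' z; exists w; rewrite e.
rewrite e; split=> [/ex'[w <-]|[w <-]]; first by exists w; rewrite e.
by rewrite e; apply/ex'; exists w.
Qed.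

Lemma tens_retract X X' Y Y' : retract X X' -> retract Y Y' ->
  retract (tensmod X Y) (tensmod X' Y').
Proof.
move=> [s [r rs]] [s' [r' rs']]; exists (tmap s s'), (tmap r r') => z /=.
by rewrite tmapk_comp tmapk_id.
Qed.

(** (A (x) V) (x) (B (x) W) = L (x) (V (x) W). *)
Lemma tens_free ba bb X Y (V W : lmodType k) j kap j' kap' :
  @free_on k A ba X V j kap -> @free_on k B bb Y W j' kap' ->
  exists J Kap, @free_on k L (tens_basis ba bb) (tensmod X Y) (tens V W) J Kap.
Proof.
move=> [fE fK] [gE gK].
have lJ : linear (tmapk j j' : tens V W -> restr (tensmod X Y)).
  move=> c x y; rewrite [LHS]linearP; congr (_ + _); exact: esym (restr_tens _ _).
have lK p : linear (tmapk (kap p.1) (kap' p.2) : restr (tensmod X Y) -> tens V W).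
  move=> c x y; rewrite -[RHS]linearP; congr (tmapk _ _ _); congr (_ + _); exact: restr_tens.
exists (lin lJ), (fun p => lin (lK p)); split=> [z|p q v].
  elim/tens_ind: z => [|x y z IH].
    rewrite big1 // => p _ /=; rewrite linear0 [tmapk _ _ 0]linear0; exact: scaler0.
  rewrite {1}IH.
  have pE : tpure x y = \sum_p be (tens_basis ba bb) p *:
      (lin lJ (lin (lK p) (tpure x y)) : tensmod X Y).
    rewrite -(pair_bigA _ (fun i i' => be (tens_basis ba bb) (i, i') *:
      (lin lJ (lin (lK (i, i')) (tpure x y)) : tensmod X Y))) /=.
    rewrite {1}[x](fE x) (big_morph (fun x : restr X => tpure x y) (id1 := 0) (op1 := +%R)); first last.
    - by rewrite tpure0l.
    - by move=> u v; rewrite (linearDf _ _ ((pure_bilin _ _).1 y)).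
    apply: eq_bigr => i _.
    rewrite {1}[y](gE y) (big_morph (tpure (_ : restr X)) (id1 := 0) (op1 := +%R)); first last.
    - by rewrite tpure0r.
    - by move=> u v; rewrite (linearDf _ _ ((pure_bilin _ _).2 _)).
    by apply: eq_bigr => i' _; rewrite !tmapk_pure tensmod_scale_pure.
  rewrite {1}pE -big_split; apply: eq_bigr => p _.
  rewrite [lin (lK p) (_ + _)](linearD (lin (lK p))) [lin lJ (_ + _)](linearD (lin lJ)).
  exact: (esym (@scalerDr L (tensmod X Y) _ _ _)).
elim/tens_ind: v => [|v w z IH].
  rewrite scaler0 [lin lJ 0]linear0 [X in lin _ X]scaler0; exact: linear0.
rewrite [lin lJ _]linearD [be _ q *: _]scalerDr [lin (lK p) _]linearD IH scalerDr; congr (_ + _).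
rewrite /= tmapk_pure tensmod_scale_pure tmapk_pure fK gK.
rewrite (linearZf _ _ ((pure_bilin _ _).1 _)) (linearZf _ _ ((pure_bilin _ _).2 _)) scalerA.
by rewrite -natrM mulnb.
Qed.

End TensorModules.

(** * Homological dimensions of tensor products *)

Section TensorHomology.
Variables (k : fieldType) (A B : falgType k).
Local Notation L := (tensalg A B).
Implicit Types (X : lmodType A) (Y : lmodType B).

(** Hom_k(A, V) (x) Hom_k(B, W) = Hom_k(L, V (x) W), as A and B are finite-dimensional. *)
Lemma tens_cofree ba bb X Y (V W : lmodType k) eps sig eps' sig' :
  @cofree_on k A ba X V eps sig -> @cofree_on k B bb Y W eps' sig' ->
  exists Eps Sig, @cofree_on k L (tens_basis ba bb) (tensmod X Y) (tens V W) Eps Sig.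
Proof.
move=> [fE fK] [gE gK].
have lE : linear (tmapk eps eps' : restr (tensmod X Y) -> tens V W).
  move=> c x y; rewrite -[RHS]linearP; congr (tmapk _ _ _); congr (_ + _); exact: restr_tens.
have lS p : linear (tmapk (sig p.1) (sig' p.2) : tens V W -> restr (tensmod X Y)).
  move=> c x y; rewrite [LHS]linearP; congr (_ + _); exact: esym (restr_tens _ _).
exists (lin lE), (fun p => lin (lS p)); split=> [z|p q v].
  elim/tens_ind: z => [|x y z IH].
    rewrite big1 // => p _ /=; rewrite scaler0 [tmapk _ _ 0]linear0; exact: linear0.
  have pE : tpure x y = \sum_p (lin (lS p)
      (lin lE (be (tens_basis ba bb) p *: (tpure x y : tensmod X Y))) : tensmod X Y).
    rewrite -(pair_bigA _ (fun i i' => lin (lS (i, i'))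
      (lin lE (be (tens_basis ba bb) (i, i') *: (tpure x y : tensmod X Y))) : tensmod X Y)) /=.
    rewrite {1}[x](fE x) (big_morph (fun x : restr X => tpure x y) (id1 := 0) (op1 := +%R)); first last.
    - by rewrite tpure0l.
    - by move=> u v; rewrite (linearDf _ _ ((pure_bilin _ _).1 y)).
    apply: eq_bigr => i _.
    rewrite {1}[y](gE y) (big_morph (tpure (_ : restr X)) (id1 := 0) (op1 := +%R)); first last.
    - by rewrite tpure0r.
    - by move=> u v; rewrite (linearDf _ _ ((pure_bilin _ _).2 _)).
    by apply: eq_bigr => i' _; rewrite tensmod_scale_pure !tmapk_pure.
  rewrite {1}IH {1}pE -big_split; apply: eq_bigr => p _.
  rewrite -[LHS](linearD (lin (lS p))) -[in LHS](linearD (lin lE)).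
  exact: (congr1 (fun w => lin (lS p) (lin lE w)) (esym (@scalerDr L (tensmod X Y) _ _ _))).
elim/tens_ind: v => [|v w z IH].
  rewrite scaler0 [lin (lS p) 0]linear0 [X in lin _ X]scaler0; exact: linear0.
rewrite [lin (lS p) _]linearD [be _ q *: _]scalerDr [lin lE _]linearD IH scalerDr; congr (_ + _).
rewrite /= tmapk_pure tensmod_scale_pure tmapk_pure fK gK.
rewrite (linearZf _ _ ((pure_bilin _ _).1 _)) (linearZf _ _ ((pure_bilin _ _).2 _)) scalerA.
by rewrite -natrM mulnb.
Qed.

Lemma tens_projective X Y : projective X -> projective Y -> projective (tensmod X Y).
Proof.
move=> /projective_pow[S rS] /projective_pow[T rT].
apply: projective_retract (tens_retract rS rT) _.
have [j [kap fX]] := pow_free (std_basis A) S.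
have [j' [kap' fY]] := pow_free (std_basis B) T.
have [J [Kap fr]] := tens_free fX fY; exact: free_projective fr.
Qed.

Lemma tens_injective X Y : injective_module X -> injective_module Y ->
  injective_module (tensmod X Y).
Proof.
move=> /injective_pow[S rS] /injective_pow[T rT].
apply: injective_retract (tens_retract rS rT) _.
have [j [kap fX]] := pow_cofree (std_basis A) S.
have [j' [kap' fY]] := pow_cofree (std_basis B) T.
have [J [Kap fr]] := tens_cofree fX fY; exact: cofree_injective fr.
Qed.

Lemma tens_perf X Y : perf X -> perf Y -> perf (tensmod X Y).
Proof.
move=> wX; elim: wX Y => {X} [P pP|K E M i p s _ IHK _ IHE|M N r _ IH] Y wY.
- elim: wY => {Y} [Q pQ|K E M i p s _ IHK _ IHE|M N r _ IH].
  + by apply: perf_proj; apply: tens_projective.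
  + exact: perf_coker (tens_mod_sesr P s) IHK IHE.
  + exact: perf_retract (tens_retract (retract_refl _) r) IH.
- exact: perf_coker (tens_mod_sesl Y s) (IHK _ wY) (IHE _ wY).
- exact: perf_retract (tens_retract r (retract_refl _)) (IH _ wY).
Qed.

Lemma tens_injdim n m X Y : injdim_le n X -> injdim_le m Y -> injdim_le (n + m) (tensmod X Y).
Proof.
move=> vX vY; elim: vX m Y vY => {n X} [n I iI|n K E M i p s _ IHE _ IHM|n M N r _ IH] m Y vY.
- elim: vY => {m Y} [m J iJ|m K E M i p s _ IHE _ IHM|m M N r _ IH].
  + by apply: injdim_inj; apply: tens_injective.
  + move: IHE; rewrite addnS => IHE; exact: injdim_ker (tens_mod_sesr I s) IHE IHM.
  + exact: injdim_retract (tens_retract (retract_refl _) r) IH.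
- exact: injdim_ker (tens_mod_sesl Y s) (IHE _ _ vY) (IHM _ _ vY).
- exact: injdim_retract (tens_retract r (retract_refl _)) (IH _ _ vY).
Qed.

(** The space k is written as a power indexed by [unit] to match the powers of A that are known to
    be free. *)
Lemma unit_tens (V : lmodType k) : exists (f : {linear tens (unit -> k^o) V -> V})
  (g : {linear V -> tens (unit -> k^o) V}), cancel g f.
Proof.
have b : bilin (fun (u : unit -> k^o) (v : V) => u tt *: v).
  split=> [v|u] a x y /=; last by rewrite scalerDr !scalerA mulrC.
  by rewrite scalerA -scalerDl.
exists (lin (tlift_linear b)), (lin ((pure_bilin _ _).2 (fun=> 1))) => v.
by rewrite [LHS](tlift_pure _ _ b) scale1r.
Qed.

(** N is a quotient of L (x) k^T = A (x) B^T, where N is a retract of k^T as a vector space. *)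
Lemma tens_cover (N : lmodType L) : exists (P : lmodType A) (Q : lmodType B)
  (p : {linear tensmod P Q -> N}), [/\ projective P, projective Q & surj p].
Proof.
have [T [f fi]] := embed_space (restr N); have [r rP] := vs_retraction fi.
have [u [v uv]] := unit_tens (T -> k^o).
have [j [kap fX]] := pow_free (std_basis A) unit.
have [j' [kap' fY]] := pow_free (std_basis B) T.
have [J [Kap fr]] := tens_free fX fY.
have [|p sp] := free_cover (h := r \o u) fr.
  by move=> y; exists (v (f y)); rewrite /= uv rP.
by exists (unit -> A^o), (T -> B^o), p; split=> //; apply: pow_projective.
Qed.

Lemma tens_embed (N : lmodType L) : exists S T
  (f : {linear N -> tensmod (S -> dreg A : lmodType A) (T -> dreg B : lmodType B)}), injective f.
Proof.
have [T [f fi]] := embed_space (restr N).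
have [u [v uv]] := unit_tens (T -> k^o).
have [j [kap fX]] := pow_cofree (std_basis A) unit.
have [j' [kap' fY]] := pow_cofree (std_basis B) T.
have [J [Kap fr]] := tens_cofree fX fY.
have [|g gi] := cofree_embed (h := v \o f) fr; last by exists unit, T, g.
by move=> x y /= /(can_inj uv)/fi.
Qed.

Lemma tens_gorenstein : gorenstein A -> gorenstein B -> exists n, @gorenstein_dims k L n.
Proof.
move=> gA gB; have [n [_ pA]] := gorenstein_dimsP gA; have [m [_ pB]] := gorenstein_dimsP gB.
exists (n + m)%N; split=> [I iI|P pP].
  have [S [T [f fi]]] := tens_embed I.
  apply: perf_retract (injective_retraction iI fi) (tens_perf _ _).
    exact/pow_perf/gorenstein_dreg.
  exact/pow_perf/gorenstein_dreg.
have [P' [Q [p [pP' pQ sp]]]] := tens_cover P.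
apply: injdim_retract (projective_section pP sp) _.
by apply: tens_injdim; [apply: pA | apply: pB].
Qed.

End TensorHomology.

(** * From filtrations to Gorenstein projectives *)

Section FromFiltration.
Variables (k : fieldType) (A B : falgType k).
Local Notation L := (tensalg A B).
Implicit Types (X : lmodType A) (Y : lmodType B).

Lemma tens_proj_gproj_gsyz m P Y : @projective A P -> gproj Y -> gsyz m (tensmod P Y).
Proof.
move=> pP; elim: m Y => [|m IH] Y gY; first exact: gsyz0.
have [Q [Y' [i [p [s pQ gY']]]]] := gproj_cosyzygy gY.
apply: (gsyzS (tens_mod_sesr P s)) (IH _ gY').
exact/projective_injdim_orth/tens_projective.
Qed.

(** The middle terms P (x) Y are orthogonal to modules of finite injective dimension since they are
    themselves m-th syzygies for every m. *)
Lemma tens_gproj_gsyz m X Y : gproj X -> gproj Y -> gsyz m (tensmod X Y).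
Proof.
move=> + gY; elim: m X => [|m IH] X gX; first exact: gsyz0.
have [P [X' [i [p [s pP gX']]]]] := gproj_cosyzygy gX.
apply: (gsyzS (tens_mod_sesl Y s)) (IH _ gX') => n K.
apply: gsyz_orth (tens_proj_gproj_gsyz n pP gY).
  exact: falg_enough_projectives.
exact: falg_enough_injectives.
Qed.

Variable n : nat.
Hypothesis gL : @gorenstein_dims k L n.

Lemma tens_class_perf_orth Z : tens_class (@gproj A) (@gproj B) Z -> perf_orth Z.
Proof.
move=> [X [Y [f [gX gY /bij_retract[_ r]]]]] K wK; apply: orth_retractl r _.
apply: (gsyz_perf_orth _ _ gL.2 (tens_gproj_gsyz n gX gY)) => //.
  exact: falg_enough_projectives.
exact: falg_enough_injectives.
Qed.

Lemma filt_sub (R : pzRingType) (C D : lmodType R -> Prop) M :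
  (forall F, C F -> D F) -> filt C M -> filt D M.
Proof.
move=> CD [J [le [bot [top [V [wo bt Vsub [Vbot Vtop Vmono Vlim Vsucc]]]]]]].
exists J, le, bot, top, V; split=> //; split=> // i j ij.
by have [F CF hF] := Vsucc i j ij; exists F => //; apply: CD.
Qed.

Lemma filt_bar_gproj M : filt_bar (tens_class (@gproj A) (@gproj B)) M -> gproj M.
Proof.
move=> [N [M' [f [fN bf]]]]; apply/(gorenstein_gprojE _ gL) => K wK.
have rMN : retract M N.
  have [g [fg gf]] := bij_inv bf.
  have l1 : linear (fun x : M => g (x, 0 : M')).
    move=> a x y; rewrite -[RHS](linearP g); congr (g _).
    by apply: injective_projections; rewrite /= ?scaler0 ?addr0.
  have l2 : linear (fun z : N => (f z).1) by move=> a x y; rewrite linearP.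
  by exists (lin l1), (lin l2) => x /=; rewrite gf.
apply: orth_retractl rMN _; apply: eklof; first exact: falg_enough_injectives.
apply: filt_sub fN => F cF; exact: tens_class_perf_orth cF K wK.
Qed.

End FromFiltration.

(** * Finite filtrations *)

Section FiniteFiltration.
Variable R : pzRingType.
Variable C : lmodType R -> Prop.
Implicit Types K L M N E P Q Y Z G : lmodType R.

Inductive extn : lmodType R -> Prop :=
| extn_base Z of C Z : extn Z
| extn_ext Z1 Z Z2 (i : {linear Z1 -> Z}) (p : {linear Z -> Z2}) of
    ses i p & extn Z1 & C Z2 : extn Z.

Lemma preimage_ses Z1 Z Z2 Y (i : {linear Z1 -> Z}) (p : {linear Z -> Z2})
    (j : {linear Y -> Z2}) : ses i p -> injective j ->
  exists Z' (j' : {linear Z' -> Z}) (i' : {linear Z1 -> Z'}) (p' : {linear Z' -> Y}),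
    [/\ ses i' p', injective j', forall x, j (p' x) = p (j' x) &
       forall z, (exists y, j y = p z) -> exists x, j' x = z].
Proof.
move=> [ii sp ex] ij.
have [||Z' [j' [ij' jP]]] := submoduleP (@submod_closedP R Z (fun z => exists y, j y = p z) _ _).
- by exists 0; rewrite !linear0.
- by move=> a x y [u uP] [v vP]; exists (a *: u + v); rewrite !linearP uP vP.
have {}jP z : (exists y, j y = p z) <-> exists x, j' x = z.
  by rewrite -jP inE; split=> [?|/asboolP]; [exact/asboolP|].
have [x|i' i'P] := colift (h := i) ij'.
  by apply/jP; exists 0; rewrite (exact_at0 _ ex) linear0.
have [x|p' p'P] := colift (h := p \o j') ij; first by apply/jP; exists x.
exists Z', j', i', p'; split=> //; last by move=> z /jP.
split=> [x y e|y|x].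
- by apply: ii; rewrite -!i'P e.
- have [z zP] := sp (j y); have /jP[x xz] : exists y', j y' = p z by exists y.
  by exists x; apply: ij; rewrite p'P /= xz.
- split=> [px|[z <-]]; last by apply: ij; rewrite p'P /= i'P (exact_at0 _ ex) linear0.
  have /ex[z zP] : p (j' x) = 0 by rewrite -[LHS]p'P px linear0.
  by exists z; apply: ij'; rewrite i'P.
Qed.

(** The filtration of Z2 is pulled back along p to one of Z that starts at Z1. *)
Lemma extn_ses Z1 Z Z2 (i : {linear Z1 -> Z}) (p : {linear Z -> Z2}) :
  ses i p -> extn Z1 -> extn Z2 -> extn Z.
Proof.
move=> + e1 e2; elim: e2 Z i p => {Z2} [Z2 CZ2|Y Z2 Q j q t eY IH CQ] Z i p s.
  exact: extn_ext s e1 CZ2.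
have [ij sq exq] := t; have [ii sp ex] := s.
have [Z' [j' [i' [p' [s' ij' jp jP]]]]] := preimage_ses s ij.
apply: (extn_ext (i := j') (p := q \o p)) (IH _ _ _ s') CQ.
split=> // [y|z].
  by have [w <-] := sq y; have [x <-] := sp w; exists x.
split=> [/exq[y yP]|[x <-]] /=; first by apply: jP; exists y.
by rewrite -jp (exact_at0 _ exq).
Qed.

Definition fchain n Z : Prop := exists V : nat -> {pred Z},
  [/\ forall j, submod_closed (V j), forall x, x \in V 0%N <-> x = 0,
      forall x, x \in V n, forall j, {subset V j <= V j.+1} &
      forall j, (j < n)%N -> exists2 F, C F & has_quotient (V j) (V j.+1) F].

Lemma fchain_filt n Z : fchain n Z -> filt C Z.
Proof.
move=> [V [Vsub V0 Vn VS Vq]].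
have Vmono i j : (i <= j)%N -> {subset V i <= V j}.
  move=> /subnK <-; elim: (j - i)%N => [//|m IH] x xi.
  by rewrite addSn; apply/VS/IH.
exists 'I_n.+1, (fun i j : 'I_n.+1 => (i <= j)%N), ord0, ord_max, (fun i : 'I_n.+1 => V i).
split=> //.
- move=> P [x0 Px0]; case: (arg_minnP (fun i : 'I_n.+1 => i : nat) Px0) => m Pm mmin.
  exists m; split; first by split.
  move=> m' [Pm' m'min]; apply/val_inj/eqP; rewrite eqn_leq.
  by rewrite mmin // [X in _ && X](m'min m Pm).
- by move=> j; split=> /=; rewrite ?leq0n // -ltnS.
- split=> //; first by move=> i j; apply: Vmono.
  (* A finite chain has no limit points: j covers its predecessor. *)
  + move=> j [[i ij nij] nc]; case: nc.
    have lij : (i < j)%N by rewrite ltn_neqAle nij.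
    have jn : (j.-1 < n.+1)%N by apply: leq_ltn_trans (leq_pred _) (ltn_ord j).
    have j0 : (0 < j)%N by apply: leq_ltn_trans lij.
    exists (Ordinal jn); split=> /=; first exact: leq_pred.
      by apply/eqP => /(congr1 val) /= jj; move: j0; rewrite -jj; case: (j : nat) jj => //= m /esym/eqP; rewrite gtn_eqF.
    move=> l /=; rewrite leq_eqVlt prednK // => /orP[/eqP jl|jl] lj.
      by left; apply: val_inj.
    by right; apply: val_inj => /=; apply/eqP; rewrite eqn_leq lj.
  + move=> i j [ij nij cov].
    have lij : (i < j)%N by rewrite ltn_neqAle nij.
    have iS : (i.+1 < n.+1)%N by apply: leq_ltn_trans lij (ltn_ord j).
    have /= := cov (Ordinal iS) (leqnSn _) lij.
    case=> /(congr1 val) /= e; first by move: (ltnn i); rewrite -{2}e ltnSn.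
    by rewrite -e; apply: Vq; rewrite -ltnS.
Qed.

Lemma extn_fchain Z : extn Z -> exists n, fchain n Z.
Proof.
have sub0 N : submod_closed [pred x : N | x == 0].
  split=> [|a x y]; rewrite !inE // => /eqP-> /eqP->.
  by rewrite scaler0 addr0.
have subT N : submod_closed [pred x : N | true] by split.
elim=> {Z} [Z CZ|Z1 Z Z2 i p s _ [n [V [Vsub V0 Vn VS Vq]]] CZ2].
  exists 1%N, ((fun j => if j is 0%N then (fun x => x == 0) else (fun=> true)) : nat -> {pred Z}).
  split=> // [[|j]//|x|[|j] // _].
    by rewrite unfold_in; split=> /eqP.
  by exists Z => //; exists id; split=> // [y|x _]; [exists y | rewrite unfold_in; split=> /eqP].
have [ii sp ex] := s.
have subI j : submod_closed [pred z | `[< exists2 x, x \in V j & i x = z >]].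
  have [V0j VZ] := Vsub j; apply: submod_closedP; first by exists 0; rewrite ?linear0.
  move=> a x y [u uV <-] [v vV <-]; exists (a *: u + v); first exact: VZ.
  by rewrite linearP.
have imP j z : z \in [pred z | `[< exists2 x, x \in V j & i x = z >]] <->
    exists2 x, x \in V j & i x = z.
  by rewrite inE; split=> /asboolP.
(* The chain of Z1, embedded by i, occupies the indices up to n; Z itself is added at n + 1. *)
pose V' j : {pred Z} := if (j <= n)%N then [pred z | `[< exists2 x, x \in V j & i x = z >]]
  else [pred x : Z | true].
exists n.+1, V'; rewrite /V'; split=> [j|x||j|j].
- by case: ifP.
- rewrite imP; split=> [[y /V0-> <-]|->]; first exact: linear0.
  by exists 0; [apply/V0 | rewrite linear0].
- by move=> x; rewrite ltnn.
- case: (leqP j.+1 n) => [jn|_ //]; rewrite (ltnW jn) => z /imP[x xV <-].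
  by apply/imP; exists x => //; apply: VS.
- rewrite ltnS => jn; rewrite jn; case: (ltnP j n) => [jn'|nj].
    have [F CF [f [fl fs fk]]] := Vq j jn'; exists F => //.
    (* A set-theoretic inverse of i on its image, 0 elsewhere; [has_quotient] looks at the image
       only. *)
    have /choice[r rP] z : exists y, (exists x, i x = z) -> i y = z.
      by have [[x <-]|h] := pselect (exists x, i x = z); [exists x | exists 0 => /h].
    have ri x : r (i x) = x by apply: ii; apply: rP; exists x.
    exists (f \o r); split=> [a _ _ /imP[x xV <-] /imP[y yV <-]|y|_ /imP[x xV <-]] /=.
    + by rewrite -linearP !ri fl.
    + have [x xV xy] := fs y; exists (i x); last by rewrite /= ri.
      by apply/imP; exists x.
    + rewrite ri fk //; rewrite -/(_ <-> _) imP; split=> [xj|[y yj /ii<-]//].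
      by exists x.
  have -> : j = n by apply/eqP; rewrite eqn_leq jn.
  exists Z2 => //; exists p; split=> [a x y _ _|y|x _]; first exact: linearP.
    by have [x xy] := sp y; exists x.
  rewrite imP ex; split=> [[y <-]|[y _ <-]]; last by exists y.
  by exists y.
Qed.

Lemma extn_filt Z : extn Z -> filt C Z.
Proof. by move=> /extn_fchain[n]; apply: fchain_filt. Qed.

Lemma retract_filt_bar M Z : retract M Z -> filt C Z -> filt_bar C M.
Proof.
move=> [s [r rs]] fZ; have sr : surj r by move=> y; exists (s y).
have [K [i t]] := ker_ses sr; have [ii _ ex] := t.
have [z|q qP] := ses_colift (h := idfun \- (s \o r)) t; first by rewrite /= linearB /= rs subrr.
have lf : linear (fun z => (r z, q z)) by move=> a x y; rewrite !linearP.
exists Z, K, (lin lf); split=> //; exists (fun y => s y.1 + i y.2) => [z|[x y]] /=.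
  by rewrite qP /= addrC subrK.
congr (_, _); first by rewrite linearD rs (exact_at0 _ ex) addr0.
by apply: ii; rewrite qP /= linearD rs (exact_at0 _ ex) addr0 addrC addKr.
Qed.

End FiniteFiltration.

(** * Resolutions *)

Section Resolutions.
Variable R : pzRingType.
Implicit Types K L M N E P Q X Y Z G : lmodType R.

(* Z has a projective resolution whose n-th syzygy belongs to C. *)
Fixpoint resdim (C : lmodType R -> Prop) n Z : Prop :=
  if n is m.+1 then exists L P (i : {linear L -> P}) (p : {linear P -> Z}),
    [/\ ses i p, projective P & resdim C m L]
  else C Z.

Lemma projective_prod P Q : projective P -> projective Q -> projective (P * Q)%type.
Proof.
move=> pP pQ M N p f sp.
have l1 : linear (fun x : P => f (x, 0 : Q)).
  move=> a x y; rewrite -[RHS](linearP f); congr (f _).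
  by apply: injective_projections; rewrite /= ?scaler0 ?addr0.
have l2 : linear (fun x : Q => f (0 : P, x)).
  move=> a x y; rewrite -[RHS](linearP f); congr (f _).
  by apply: injective_projections; rewrite /= ?scaler0 ?addr0.
have [g gP] := pP _ _ p (lin l1) sp; have [h hP] := pQ _ _ p (lin l2) sp.
have lg : linear (fun x : P * Q => g x.1 + h x.2).
  by move=> a x y; rewrite !linearP scalerDr addrACA.
exists (lin lg) => -[x y] /=; rewrite linearD gP hP /= -linearD; congr (f _).
by apply: injective_projections; rewrite /= ?add0r ?addr0.
Qed.

Lemma resdim_iso C n Z Z' (f : {linear Z -> Z'}) :
  (forall M N (g : {linear M -> N}), bijective g -> C M -> C N) ->
  bijective f -> resdim C n Z -> resdim C n Z'.
Proof.
move=> Ciso bf; case: n => [|n]; first exact: Ciso bf.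
by move=> [L [P [i [p [s pP cL]]]]]; exists L, P, i, (f \o p); split=> //; apply: ses_bijr.
Qed.

(** Horseshoe lemma: P1 * P2 covers Z through i q1 and a lift h of q2, and the three syzygies again
    form a short exact sequence. *)
Lemma resdim_ses C n Z1 Z Z2 (i : {linear Z1 -> Z}) (p : {linear Z -> Z2}) :
  (forall K E M (j : {linear K -> E}) (q : {linear E -> M}), ses j q -> C K -> C M -> C E) ->
  ses i p -> resdim C n Z1 -> resdim C n Z2 -> resdim C n Z.
Proof.
move=> Cses; elim: n Z1 Z Z2 i p => [|n IH] Z1 Z Z2 i p s; first exact: Cses s.
have [ii sp ex] := s.
move=> [L1 [P1 [j1 [q1 [[ij1 sq1 ex1] pP1 cL1]]]]] [L2 [P2 [j2 [q2 [[ij2 sq2 ex2] pP2 cL2]]]]].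
have [h hP] := pP2 _ _ p q2 sp.
have lq : linear (fun x : P1 * P2 => i (q1 x.1) + h x.2).
  by move=> a x y; rewrite !linearP scalerDr addrACA.
have piq x : p (lin lq x) = q2 x.2 by rewrite /= linearD (exact_at0 _ ex) add0r hP.
have sq : surj (lin lq).
  move=> z; have [y yP] := sq2 (p z).
  have /ex[z1 z1P] : p (z - h y) = 0 by rewrite linearB hP yP subrr.
  by have [x xP] := sq1 z1; exists (x, y); rewrite /= xP z1P subrK.
have [L [j t]] := ker_ses sq; have [ij _ exj] := t.
exists L, (P1 * P2)%type, j, (lin lq); split=> //; first exact: projective_prod.
have la : linear (fun l => (j1 l, 0 : P2)).
  by move=> a x y; apply: injective_projections; rewrite /= ?linearP ?scaler0 ?addr0.
have lb : linear (fun x : P1 * P2 => x.2) by [].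
have [x|a aP] := ses_colift (h := lin la) t.
  by rewrite /= (exact_at0 _ ex1) !linear0 addr0.
have [x|b bP] := colift (h := lin lb \o j) ij2.
  by apply/ex2; rewrite /= -piq (exact_at0 _ exj) linear0.
apply: (IH _ _ _ a b _ cL1 cL2); split.
- by move=> x y e; apply: ij1; have := congr1 j e; rewrite !aP => -[].
- move=> l2; have /ex[z zP] : p (h (j2 l2)) = 0 by rewrite hP (exact_at0 _ ex2).
  have [x xP] := sq1 z.
  have /exj[l lP] : lin lq (- x, j2 l2) = 0 by rewrite /= !linearN xP zP addNr.
  by exists l; apply: ij2; rewrite bP /= lP.
- move=> l; split=> [b0|[l1 <-]]; last by apply: ij2; rewrite bP /= aP linear0.
  have l0 : (j l).2 = 0 by have := bP l; rewrite b0 linear0.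
  have := exact_at0 l exj; rewrite /= l0 linear0 addr0 => iq0.
  have /ex1[l1 l1P] : q1 (j l).1 = 0 by apply: ii; rewrite iq0 linear0.
  by exists l1; apply: ij; rewrite aP /= l1P; case: (j l) l0 => u v /= ->.
Qed.

(** If P covers Z2 with kernel L, it covers Z3 with a kernel K that is an extension 0 -> L -> K ->
    Z1 -> 0. *)
Lemma resdim_coker C n Z1 Z2 Z3 (i : {linear Z1 -> Z2}) (p : {linear Z2 -> Z3}) :
  (forall K E M (j : {linear K -> E}) (q : {linear E -> M}), ses j q -> C K -> C M -> C E) ->
  ses i p -> resdim C n Z1 -> resdim C n.+1 Z2 -> resdim C n.+1 Z3.
Proof.
move=> Cses s c1 [L [P [j [q [[ij sq exq] pP cL]]]]]; have [ii sp ex] := s.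
have spq : surj (p \o q).
  by move=> z; have [y <-] := sp z; have [x <-] := sq y; exists x.
have [K [u t]] := ker_ses spq; have [iu _ exu] := t.
exists K, P, u, (p \o q); split=> //.
have [x|a aP] := ses_colift (h := j) t; first by rewrite /= (exact_at0 _ exq) linear0.
have [x|b bP] := colift (h := q \o u) ii; first by apply/ex; apply: (exact_at0 x exu).
apply: (resdim_ses Cses (i := a) (p := b)) cL c1; split.
- by move=> x y e; apply: ij; rewrite -!aP e.
- move=> z1; have [x xP] := sq (i z1).
  have /exu[w wP] : (p \o q) x = 0 by rewrite /= xP (exact_at0 _ ex).
  by exists w; apply: ii; rewrite bP /= wP.
- move=> w; split=> [b0|[l <-]]; last by apply: ii; rewrite bP /= aP (exact_at0 _ exq) linear0.
  have /exq[l lP] : q (u w) = 0 by have /= <- := bP w; rewrite b0 linear0.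
  by exists l; apply: iu; rewrite aP.
Qed.

(* M is a retract of Z in the stable category. *)
Definition stable_retract M Z : Prop :=
  exists (a : {linear M -> Z}) (b : {linear Z -> M}) P (g : {linear M -> P}) (h : {linear P -> M}),
    projective P /\ forall x, b (a x) + h (g x) = x.

(** Lifting a, b and h to the covers, the discrepancy id - b0 a0 - h0 g p on P takes values in L;
    restricted to L it is the identity minus the composite of the induced maps, and it factors
    through the projective P. *)
Lemma stable_retract_syzygy L P Z L' P' Z' (i : {linear L -> P}) (p : {linear P -> Z})
    (i' : {linear L' -> P'}) (p' : {linear P' -> Z'}) :
  ses i p -> projective P -> ses i' p' -> projective P' ->
  stable_retract Z Z' -> stable_retract L L'.
Proof.
move=> s pP s' pP' [a [b [Q [g [h [pQ abgh]]]]]].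
have [ii sp ex] := s; have [ii' sp' ex'] := s'.
have [a0 a0P] := pP _ _ p' (a \o p) sp'; have [b0 b0P] := pP' _ _ p (b \o p') sp.
have [h0 h0P] := pQ _ _ p h sp.
have [x|al alP] := ses_colift (h := a0 \o i) s'.
  by rewrite /= a0P /= (exact_at0 _ ex) linear0.
have [x|be beP] := ses_colift (h := b0 \o i') s.
  by rewrite /= b0P /= (exact_at0 _ ex') linear0.
have [x|t tP] := ses_colift (h := idfun \- ((b0 \o a0) \+ (h0 \o (g \o p)))) s.
  by rewrite /= linearB linearD b0P /= a0P h0P /= abgh subrr.
exists al, be, P, i, t; split=> // x; apply: ii.
rewrite linearD beP /= alP tP /= (exact_at0 _ ex) !linear0 addr0.
by rewrite addrC subrK.
Qed.

Lemma stable_retract_resdim C n X G Z : stable_retract X Z ->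
  resdim (eq G) n X -> resdim C n Z -> exists2 G', C G' & stable_retract G G'.
Proof.
elim: n X Z => [|n IH] X Z r /=; first by move=> ->; exists Z.
move=> [L [P [i [p [s pP gL]]]]] [L' [P' [i' [p' [s' pP' cL]]]]].
exact: IH (stable_retract_syzygy s pP s' pP' r) gL cL.
Qed.

(** The class [eq M] pins the syzygy down to M itself; X is an iterated cosyzygy. *)
Lemma gproj_is_syzygy n M : gproj M -> exists X, resdim (eq M) n X.
Proof.
move=> gM; suff: forall n m N, resdim (eq M) m N -> gproj N -> exists X, resdim (eq M) (n + m) X.
  by move=> /(_ n 0%N M erefl gM); rewrite addn0.
elim=> [|{}n IH] m N sN gN; first by exists N.
have [P [N' [i [p [s pP gN']]]]] := gproj_cosyzygy gN.
have [X] := IH m.+1 N' (ex_intro _ N (ex_intro _ P (ex_intro _ i (ex_intro _ p (And3 s pP sN))))) gN'.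
by rewrite addnS -addSn; exists X.
Qed.

Lemma stable_retract_refl P X : projective P -> stable_retract X X.
Proof.
move=> pP; exists idfun, idfun, P, \0, \0; split=> // x /=.
by rewrite addr0.
Qed.

Lemma stable_retractE M Z : stable_retract M Z -> exists2 P, projective P & retract M (Z * P)%type.
Proof.
move=> [a [b [P [g [h [pP abgh]]]]]]; exists P => //.
have l1 : linear (fun x => (a x, g x)) by move=> c x y; rewrite !linearP.
have l2 : linear (fun z : Z * P => b z.1 + h z.2).
  by move=> c x y; rewrite !linearP scalerDr addrACA.
by exists (lin l1), (lin l2).
Qed.

(** Each step of the resolution raises the syzygy degree of the kernel by one, from m to n + m. *)
Lemma gsyz_resdim n m X : enough_projectives R ->
  (forall G, gsyz (n + m) G -> gproj G) -> gsyz m X -> resdim (@gproj R) n X.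
Proof.
move=> eP; elim: n m X => [|n IH] m X gg gX /=; first exact: gg.
have [P [p [pP sp]]] := eP X; have [L [i s]] := ker_ses sp.
exists L, P, i, p; split=> //; apply: (IH m.+1); first by rewrite addnS.
exact: gsyzS s (projective_injdim_orth pP) gX.
Qed.

End Resolutions.

(** * Resolutions of tensor products *)

Section TensorResolutions.
Variables (k : fieldType) (A B : falgType k) (nA nB : nat).
Local Notation L := (tensalg A B).
Hypotheses (gA : @gorenstein_dims k A nA) (gB : @gorenstein_dims k B nB).
Implicit Types (X : lmodType A) (Y : lmodType B).

Local Notation F := (extn (tens_class (@gproj A) (@gproj B))).

Lemma gproj_projective (C : falgType k) n (P : lmodType C) :
  gorenstein_dims C n -> projective P -> gproj P.
Proof. by move=> gC pP; apply/(gorenstein_gprojE _ gC) => K _; apply: orth_projective. Qed.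

Lemma gproj_resdim (C : falgType k) n m (X : lmodType C) :
  gorenstein_dims C n -> gproj X -> resdim (@gproj C) m X.
Proof.
move=> gC; elim: m X => [//|m IH] X gX.
have [P [p [pP sp]]] := falg_enough_projectives X; have [K [i s]] := ker_ses sp.
exists K, P, i, p; split=> //; apply/IH/(gorenstein_gprojE _ gC).
apply: (perf_orth_syzygy _ _ gC.1 s pP).
- exact: falg_enough_projectives.
- exact: falg_enough_injectives.
- exact/(gorenstein_gprojE _ gC).
Qed.

(** Any n-th syzygy is Gorenstein projective, and syzygies of such modules remain so, which allows
    padding by m. *)
Lemma all_resdim (C : falgType k) n m (X : lmodType C) :
  gorenstein_dims C n -> resdim (@gproj C) (n + m) X.
Proof.
move=> gC.
suff h r Z : resdim (@gproj C) r Z -> resdim (@gproj C) (r + m) Z.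
  apply: h; apply: (gsyz_resdim (m := 0%N)); [exact: falg_enough_projectives| |exact: gsyz0].
  rewrite addn0 => G gG; apply/(gorenstein_gprojE _ gC).
  apply: (gsyz_perf_orth _ _ gC.2 gG); first exact: falg_enough_projectives.
  exact: falg_enough_injectives.
elim: r Z => [|r IH] Z /=; first by rewrite add0n; apply: gproj_resdim gC.
move=> [K [P [i [p [s pP rK]]]]]; exists K, P, i, p; split=> //; exact: IH.
Qed.

Lemma F_ses (K E M : lmodType L) (i : {linear K -> E}) (p : {linear E -> M}) :
  ses i p -> F K -> F M -> F E.
Proof. exact: extn_ses. Qed.

Lemma F_tens X Y : gproj X -> gproj Y -> F (tensmod X Y).
Proof.
move=> gX gY; apply: extn_base; by exists X, Y, idfun; split=> //; exists idfun.
Qed.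

Lemma resdim_tens_projl m P Y : projective P -> resdim (@gproj B) m Y -> resdim F m (tensmod P Y).
Proof.
move=> pP; elim: m Y => [|m IH] Y /=; first by apply: F_tens; apply: gproj_projective gA pP.
move=> [K [Q [i [p [s pQ cK]]]]].
exists (tensmod P K), (tensmod P Q), (tmap idfun i), (tmap idfun p).
by split; [exact: tens_mod_sesr | exact: tens_projective | exact: IH].
Qed.

Lemma resdim_tens_projr m X Q : projective Q -> resdim (@gproj A) m X -> resdim F m (tensmod X Q).
Proof.
move=> pQ; elim: m X => [|m IH] X /=.
  by move=> gX; apply: F_tens => //; apply: gproj_projective gB pQ.
move=> [K [P [i [p [s pP cK]]]]].
exists (tensmod K Q), (tensmod P Q), (tmap i idfun), (tmap p idfun).
by split; [exact: tens_mod_sesl | exact: tens_projective | exact: IH].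
Qed.

(** In 0 -> X (x) K -> X (x) Q -> X (x) Y -> 0 the middle term need not be projective; it is
    resolved through X, to any length. *)
Lemma resdim_tens_gproj m X Y : gproj X -> resdim (@gproj B) m Y -> resdim F m (tensmod X Y).
Proof.
move=> gX; elim: m Y => [|m IH] Y; first exact: F_tens.
move=> [K [Q [i [p [s pQ cK]]]]].
apply: (resdim_coker F_ses (tens_mod_sesr X s) (IH _ cK)).
exact: resdim_tens_projr pQ (gproj_resdim _ gA gX).
Qed.

(** Lengths add: X (x) Y is the cokernel of K (x) Y -> P (x) Y, where K has a shorter resolution
    than X and P (x) Y is resolved through Y, padded to the required length. *)
Lemma resdim_tens X Y : resdim F (nA + nB) (tensmod X Y).
Proof.
have : resdim (@gproj A) nA X by rewrite -[nA]addn0; apply: all_resdim gA.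
elim: {1 2}nA X => [|n IH] X /=.
  move=> gX; apply: (resdim_tens_gproj gX).
  by rewrite -[nB]addn0; apply: all_resdim gB.
move=> [K [P [i [p [s pP cK]]]]].
apply: (resdim_coker F_ses (tens_mod_sesl Y s) (IH _ cK)).
apply: (resdim_tens_projl pP).
by rewrite -addSn addnC; apply: all_resdim gB.
Qed.

Lemma F_bij (M N : lmodType L) (g : {linear M -> N}) : bijective g -> F M -> F N.
Proof.
move=> bg FM; case: FM N g bg => {M} [M [X [Y [f [gX gY bf]]]]|Z1 Z Z2 i p s F1 C2] N g bg.
  by apply: extn_base; exists X, Y, (g \o f); split=> //; apply: bij_comp.
have [g' [gg' g'g]] := bij_inv bg.
apply: (extn_ext (i := g \o i) (p := p \o g') _ F1 C2); have [ii sp ex] := s.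
split=> [x y /(can_inj gg')/ii//|y|y].
  by have [x <-] := sp y; exists (g x); rewrite /= gg'.
rewrite /= ex; split=> [[x xP]|[x <-]]; exists x; last by rewrite gg'.
by rewrite /= xP g'g.
Qed.

(** The hypothesis isolates the contribution of the splitting field. It is applied to the class
    [resdim F (nA + nB)], closed under extensions by the horseshoe lemma. *)
Lemma gproj_filt_bar :
  (forall C : lmodType L -> Prop,
     (forall (M N : lmodType L) (g : {linear M -> N}), bijective g -> C M -> C N) ->
     (forall (K E M : lmodType L) (i : {linear K -> E}) (p : {linear E -> M}), ses i p -> C K -> C M -> C E) ->
     (forall X Y, C (tensmod X Y)) -> forall M, C M) ->
  forall M : lmodType L, gproj M -> filt_bar (tens_class (@gproj A) (@gproj B)) M.
Proof.
move=> filtL M gM; have [Z MZ] := gproj_is_syzygy (nA + nB) gM.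
have FZ : resdim F (nA + nB) Z.
  apply: (filtL (resdim F (nA + nB))).
  - by move=> K N g bg; apply: resdim_iso bg; apply: F_bij.
  - by move=> K E N i p; apply: resdim_ses; apply: F_ses.
  - exact: resdim_tens.
have [Q [q [pQ sq]]] := falg_enough_projectives Z.
(* Two resolutions of Z are compared: M is the syzygy in one of them, some G in F in the other. *)
have [G FG rMG] := stable_retract_resdim (stable_retract_refl Z pQ) MZ FZ.
have [P pP rMGP] := stable_retractE rMG.
(* The projective summand P is enlarged to P' (x) Q', which belongs to F. *)
have [P' [Q' [u [pP' pQ' su]]]] := tens_cover P.
have rP := projective_section pP su.
apply: (retract_filt_bar (Z := (G * tensmod P' Q')%type)).
  apply: retract_trans rMGP _; case: rP => [s [r rs]].
  have l1 : linear (fun x : G * P => (x.1, s x.2)).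
    by move=> a x y; apply: injective_projections; rewrite /= ?linearP.
  have l2 : linear (fun x : G * tensmod P' Q' => (x.1, r x.2)).
    by move=> a x y; apply: injective_projections; rewrite /= ?linearP.
  by exists (lin l1), (lin l2) => -[x y] /=; rewrite rs.
apply: extn_filt.
have l1 : linear (fun x : G => (x, 0 : tensmod P' Q')).
  by move=> a x y; apply: injective_projections; rewrite /= ?scaler0 ?addr0.
have l2 : linear (fun x : G * tensmod P' Q' => x.2) by [].
apply: (F_ses (i := lin l1) (p := lin l2)) FG (F_tens _ _).
- split=> [x y []//|y|[x y]]; first by exists (0, y).
  by split=> /= [->|[z [_ <-]]//]; exists x.
- exact: gproj_projective gA pP'.
- exact: gproj_projective gB pQ'.
Qed.

End TensorResolutions.

(** * Isotypic modules *)

Section AbsolutelySimple.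
Variables (k : fieldType) (S : falgType k) (T : lmodType S).
Hypotheses (simT : simple_module T)
  (splT : forall f : {linear T -> T}, exists c : k, forall x, f x = c%:A *: x).

Lemma simple_gen (t u : T) : t != 0 -> exists b : S, b *: t = u.
Proof.
move=> t0; have [_ sub] := simT.
have [||h|h] := sub _ (@submod_closedP S T (fun x => exists b : S, b *: t = x) _ _).
- by exists 0; rewrite scale0r.
- by move=> a x y [b <-] [c <-]; exists (a * b + c); rewrite scalerDl scalerA.
- case/eqP: t0; apply: h; rewrite inE; apply/asboolP; exists 1; exact: scale1r.
- by have := h u; rewrite inE => /asboolP.
Qed.

(** T is S modulo the annihilator of t, so maps out of T correspond to elements killed by that
    annihilator. *)
Lemma orbit_map (M : lmodType S) (t : T) (m : M) : t != 0 ->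
  (forall b : S, b *: t = 0 -> b *: m = 0) ->
  exists f : {linear T -> M}, forall b : S, f (b *: t) = b *: m.
Proof.
move=> t0 tm.
have l1 (N : lmodType S) (n : N) : linear (fun b : S^o => (b : S) *: n).
  by move=> a x y; rewrite scalerDl scalerA.
have [|f fP] := @descend S T S^o M (lin (l1 T t)) (lin (l1 M m)) _ tm; last by exists f.
by move=> u; apply: simple_gen.
Qed.

Variables (X : lmodType k) (M : lmodType S) (beta : X -> T -> M).
Hypotheses (betaX : forall t, linear (fun x => beta x t : restr M))
  (betaT : forall x, linear (beta x)) (beta0 : forall x, (forall t, beta x t = 0) -> x = 0).

Lemma beta_bilin : bilin (beta : X -> restr T -> restr M).
Proof. by split=> // x c t u; apply: (betaT x). Qed.

Fixpoint inspan (x : X) (s : seq X) : Prop :=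
  if s is y :: s' then exists c : k, inspan (x - c *: y) s' else x = 0.

Fixpoint indep (s : seq X) : Prop :=
  if s is y :: s' then ~ inspan y s' /\ indep s' else True.

(** If u is a combination of the first components, u (x) v can be absorbed by changing second
    components only. This makes the first components of any tensor independent. *)
Lemma inspan_tens (u : X) (v : T) (s : seq (X * restr T)) : inspan u [seq p.1 | p <- s] ->
  exists s' : seq (X * restr T), [seq p.1 | p <- s'] = [seq p.1 | p <- s] /\
    \sum_(p <- s') tpure p.1 p.2 = tpure u (v : restr T) + \sum_(p <- s) tpure p.1 p.2.
Proof.
elim: s u => [|p s IH] u /=.
  by move=> ->; exists [::]; rewrite !big_nil tpure0l addr0.
move=> [c /IH[s' [s's sE]]]; exists ((p.1, p.2 + c *: (v : restr T)) :: s').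
rewrite /= s's; split=> //; rewrite !big_cons sE /=.
rewrite (linearDf _ _ ((pure_bilin _ _).2 p.1)) (linearDf _ _ ((pure_bilin _ _).1 (v : restr T))).
rewrite (linearZf _ _ ((pure_bilin _ _).2 p.1)) -scaleNr (linearZf _ _ ((pure_bilin _ _).1 (v : restr T))).
by rewrite scaleNr addrA addrACA subrr addr0 [_ + tpure u _]addrC -addrA.
Qed.

Lemma tens_indep (z : tens X (restr T)) : exists s : seq (X * restr T),
  indep [seq p.1 | p <- s] /\ z = \sum_(p <- s) tpure p.1 p.2.
Proof.
elim/tens_ind: z => [|u v z [s [si ->]]]; first by exists [::]; rewrite big_nil.
have [us|us] := pselect (inspan u [seq p.1 | p <- s]).
  by have [s' [s's <-]] := inspan_tens v us; exists s'; rewrite s's.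
by exists ((u, v) :: s); rewrite big_cons.
Qed.

(** The sign suits the relation beta x t + beta y t = 0, which will give x = - y. *)
Lemma beta_comb (t : T) (s : seq (X * restr T)) :
  (forall p, p \in s -> exists c : k, p.2 = c%:A *: t) ->
  exists y, \sum_(p <- s) beta p.1 p.2 = beta y t /\ inspan (- y) [seq p.1 | p <- s].
Proof.
have b0 : beta 0 t = 0 by have := linear0 (lin (betaX t)).
elim: s => [|p s IH] sp; first by exists 0; rewrite big_nil /= oppr0.
have [q qs|y [yE ys]] := IH; first by apply: sp; rewrite inE qs orbT.
have [c cE] := sp p (mem_head _ _).
exists (c *: p.1 + y); rewrite big_cons yE cE; split.
  rewrite [RHS](betaX t c p.1 y); congr (_ + _).
  exact: (linearZ_LR (lin (betaT p.1)) c%:A t).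
by exists (- c); rewrite scaleNr opprK opprD addrAC addNr add0r.
Qed.

(* If t <> 0 is one of the p.2, then by induction its annihilator kills the
   others, which are therefore scalar multiples of t. *)
Lemma beta_indep (s : seq (X * restr T)) : indep [seq p.1 | p <- s] ->
  \sum_(p <- s) beta p.1 p.2 = 0 -> forall p, p \in s -> p.2 = 0.
Proof.
have bZ x (b : S) t : beta x (b *: t) = b *: beta x t by exact: (linearZ_LR (lin (betaT x)) b t).
have bt0 x : beta x 0 = 0 by exact: (linear0 (lin (betaT x))).
move xsE: [seq p.1 | p <- s] => xs; elim: xs s xsE => [|x xs IH] [|[_ t] s] //= [-> sE].
move=> [nx si]; rewrite big_cons /= => sum0.
have [t0|t0] := eqVneq (t : T) 0.
  move=> p; rewrite inE => /orP[/eqP-> //|]; apply: IH sE si _ p.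
  by move: sum0; rewrite t0 bt0 add0r.
have [p ps|y [yE ys]] := @beta_comb t s.
  have [b bt|f fP] := @orbit_map T t p.2 t0.
    (* Multiplied by b, which kills t, the relation loses its head and becomes shorter, so b kills
       p.2 too. Hence t -> p.2 defines an endomorphism of T, a scalar. *)
    apply: (IH [seq (q.1, b *: (q.2 : T)) | q <- s] _ si _ (p.1, b *: (p.2 : T))).
    - by rewrite -map_comp.
    - rewrite big_map /=; under eq_bigr => q _ do rewrite bZ.
      rewrite -scaler_sumr; have := congr1 (fun m : M => b *: m) sum0.
      by rewrite scaler0 scalerDr -bZ bt bt0 add0r.
    - by apply/mapP; exists p.
  have [c cP] := splT f; exists c.
  by rewrite -cP -[t](scale1r (t : T)) fP scale1r.
case: nx; rewrite -sE; suff -> : x = - y by [].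
apply/eqP; rewrite -addr_eq0; apply/eqP/beta0 => u.
have [b <-] := simple_gen u t0.
by rewrite bZ (linearDf _ _ (betaX t)) -yE sum0 scaler0.
Qed.

Lemma beta_injective : injective (tlift (beta : X -> restr T -> restr M)).
Proof.
apply: (@lin_inj k _ _ (lin (tlift_linear beta_bilin))) => z /=.
have [s [si ->]] := tens_indep z.
rewrite -[tlift _ _]/(lin (tlift_linear beta_bilin) _) linear_sum /=.
under eq_bigr => p _ do rewrite (tlift_pure _ _ beta_bilin).
move=> /(beta_indep si) s0; rewrite big_seq big1 // => p ps.
by rewrite s0 // tpure0r.
Qed.

End AbsolutelySimple.

Definition resm (S R : pzRingType) (io : {rmorphism S -> R}) (M : lmodType R) : Type := M.

Section RestrictAlong.
Variables (S R : pzRingType) (io : {rmorphism S -> R}) (M : lmodType R).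

HB.instance Definition _ := GRing.Zmodule.on (resm io M).

Definition resm_scale (a : S) (x : resm io M) : resm io M := io a *: (x : M).

Fact resm_scaleA a b v : resm_scale a (resm_scale b v) = resm_scale (a * b) v.
Proof. by rewrite /resm_scale scalerA rmorphM. Qed.
Fact resm_scale1 : left_id 1 resm_scale.
Proof. by move=> v; rewrite /resm_scale rmorph1 scale1r. Qed.
Fact resm_scaleDr : right_distributive resm_scale +%R.
Proof. by move=> a u v; apply: scalerDr. Qed.
Fact resm_scaleDl v : {morph resm_scale^~ v : a b / a + b}.
Proof. by move=> a b; rewrite /resm_scale rmorphD scalerDl. Qed.
HB.instance Definition _ := GRing.Zmodule_isLmodule.Build S (resm io M)
  resm_scaleA resm_scale1 resm_scaleDr resm_scaleDl.

Lemma resmE (a : S) (x : M) : a *: (x : resm io M) = io a *: x.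
Proof. by []. Qed.

End RestrictAlong.

(** * Filtrations of modules by a chain of left ideals *)

Section LeftIdealChain.
Variables (k : fieldType) (S : falgType k) (R : pzRingType) (io : {rmorphism S -> R}).
(** R is spanned over S by elements commuting with S, as A (x) B is over either factor. This turns
    the S-span of u N into an R-submodule. *)
Hypothesis gen : forall l : R, exists s : seq (S * R), l = \sum_(p <- s) io p.1 * p.2 /\
  forall p, p \in s -> forall a, io a * p.2 = p.2 * io a.
Variable C : lmodType R -> Prop.
Hypothesis C0 : forall M : lmodType R, (forall x : M, x = 0) -> C M.
Hypothesis Cses : forall (K E M : lmodType R) (i : {linear K -> E}) (p : {linear E -> M}),
  ses i p -> C K -> C M -> C E.
(** The condition on M says that, over S, it is a sum of images of T. *)
Hypothesis Ciso : forall (T : lmodType S) (t : T) (M : lmodType R), simple_module T -> t != 0 ->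
  (forall x : M, exists s : seq (S * M), x = \sum_(p <- s) io p.1 *: p.2 /\
     forall p, p \in s -> forall b, b *: t = 0 -> io b *: p.2 = 0) -> C M.

Let lideal (U : {vspace S}) := forall a u : S, u \in U -> a * u \in U.

Let Sspan (U : {vspace S}) (u : S) : {vspace S} := (U + fullv * <[u]>)%VS.

Let SspanP U u v : v \in Sspan U u -> exists2 w, w \in U & exists a, v = w + a * u.
Proof.
by move=> /memv_addP[w wU [_ /memv_cosetP[a _ ->] ->]]; exists w => //; exists a.
Qed.

Let SspanI (U : {vspace S}) u w a : w \in U -> w + a * u \in Sspan U u.
Proof.
by move=> wU; apply: memv_add => //; apply/memv_cosetP; exists a => //; apply: memvf.
Qed.

Let Sspan_mem (U : {vspace S}) u : u \in Sspan U u.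
Proof. by have := SspanI u 1 (mem0v U); rewrite mul1r add0r. Qed.

Let Sspan_lideal (U : {vspace S}) u : lideal U -> lideal (Sspan U u).
Proof.
move=> lU a v /SspanP[w wU [b ->]]; rewrite mulrDr mulrA.
by apply: SspanI; apply: lU.
Qed.

(** Choosing u to minimize the dimension of U + S u makes (U + S u)/U simple: any b u outside U
    generates the same left ideal modulo U. *)
Let Sspan_min (U : {vspace S}) : (\dim U < \dim (fullv : {vspace S}))%N -> lideal U -> exists2 u, u \notin U &
  forall b, b * u \notin U -> exists2 w, w \in U & exists c, u = w + c * (b * u).
Proof.
move=> dU lU.
have [u0 u0U] : exists u, u \notin U.
  apply: contrapT => nu; move: dU; rewrite ltnNge; case/negP; apply: dimvS.
  apply/subvP => v _; apply: contrapT => vU; apply: nu; exists v; exact/negP.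
have ex : exists d, `[< exists2 u, u \notin U & \dim (Sspan U u) = d >].
  by exists (\dim (Sspan U u0)); apply/asboolP; exists u0.
case: (ex_minnP ex) => d /asboolP[u uU ud] dmin; exists u => // b bu.
apply: SspanP.
have sub : (Sspan U (b * u)%R <= Sspan U u)%VS.
  apply/subvP => v /SspanP[w wU [a ->]]; rewrite mulrA; exact: SspanI.
have : (Sspan U (b * u)%R == Sspan U u)%VS.
  rewrite eqEdim sub ud; apply: dmin; apply/asboolP; by exists (b * u).
by move/eqP ->; apply: Sspan_mem.
Qed.

(* Downward induction on a left ideal U: a module killed by U is an extension of
   a module killed by a minimal left ideal U + S u above U by an isotypic one. *)
Lemma lideal_chain M : C M.
Proof.
suff: forall d (U : {vspace S}), lideal U -> (\dim (fullv : {vspace S}) <= d + \dim U)%N ->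
    forall N : lmodType R, (forall u (x : N), u \in U -> io u *: x = 0) -> C N.
  move=> /(_ (\dim (fullv : {vspace S})) 0%VS); apply.
  - by move=> a u; rewrite !memv0 => /eqP->; rewrite mulr0.
  - by rewrite dimv0 addn0.
  - by move=> u x; rewrite memv0 => /eqP->; rewrite rmorph0 scale0r.
move=> {M}; elim=> [|d IH] U lU dU N UN.
  apply: C0 => x; rewrite -[x]scale1r -(rmorph1 io); apply: UN.
  suff -> : U = fullv by apply: memvf.
  by apply/eqP; rewrite eqEdim subvf.
have [dfull|dlt] := leqP (\dim (fullv : {vspace S})) (\dim U).
  by apply: (IH U) => //; apply: leq_trans dfull (leq_addl _ _).
have [u uU umin] := Sspan_min dlt lU.
have IHu (Q : lmodType R) : (forall v (x : Q), v \in Sspan U u -> io v *: x = 0) -> C Q.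
  apply: IH; first exact: Sspan_lideal.
  apply: leq_trans dU _; rewrite addSn -addnS leq_add2l ltnNge; apply/negP => h.
  case/negP: uU; suff -> : U = Sspan U u.
    exact: Sspan_mem.
  by apply/eqP; rewrite eqEdim h addvSl.
(* If u kills N, so does U + S u, and the induction hypothesis applies to N itself. *)
have [[x0 ux0]|nx] := pselect (exists x : N, io u *: x != 0); last first.
  apply: IHu => v x /SspanP[w wU [a ->]].
  rewrite rmorphD scalerDl (UN _ _ wU) add0r rmorphM -scalerA.
  have [->|ux] := eqVneq (io u *: x) 0; first exact: scaler0.
  by case: nx; exists x.
(* The submodule generated by u N. The quotient by it is killed by U + S u. *)
pose PN (x : N) := exists s : seq (S * N), x = \sum_(p <- s) io p.1 *: (io u *: p.2).
have PND x y : PN x -> PN y -> PN (x + y).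
  by move=> [s ->] [t ->]; exists (s ++ t); rewrite big_cat.
have PNZ (l : R) x : PN x -> PN (l *: x).
  move=> [s ->]; rewrite scaler_sumr; elim: s => [|p s IHs].
    by exists [::]; rewrite !big_nil.
  rewrite big_cons; apply: (PND) => //.
  have [t [-> tc]] := gen l; rewrite scaler_suml big_seq.
  apply: (big_ind PN) => [|y z Py Pz|q qt]; first by exists [::]; rewrite big_nil.
    exact: PND.
  exists [:: (q.1 * p.1, q.2 *: p.2)]; rewrite big_seq1 /= !scalerA; congr (_ *: _).
  by rewrite rmorphM -!mulrA; congr (_ * _); rewrite (tc q qt) !mulrA (tc q qt).
have [||N' [i [ii iP]]] := submoduleP (@submod_closedP R N PN _ _).
- by exists [::]; rewrite big_nil.
- by move=> a x y Px Py; apply: PND => //; apply: PNZ.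
have {}iP x : PN x <-> exists y, i y = x.
  by rewrite -iP inE; split=> [?|/asboolP//]; apply/asboolP.
have [Q [p sQ]] := coker_ses ii; have [_ sp ex] := sQ.
(* If b u were outside U, then u would lie in U + S b u by minimality, and b u x0 = 0 would force u
   x0 = 0. So b u lies in U and kills N. *)
have kill b (x : N) : io (b * u) *: x0 = 0 -> io (b * u) *: x = 0.
  move=> bu0; have [bu|bu] := boolP (b * u \in U); first exact: UN.
  have [w wU [c uE]] := umin b bu; case/eqP: ux0.
  by rewrite uE rmorphD scalerDl (UN _ _ wU) add0r rmorphM -scalerA bu0 scaler0.
apply: (Cses sQ); last first.
  apply: IHu => v y /SspanP[w wU [a ->]]; have [x <-] := sp y.
  rewrite -linearZ /= rmorphD scalerDl (UN _ _ wU) add0r; apply/ex/iP.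
  by exists [:: (a, x)]; rewrite big_seq1 rmorphM scalerA.
(* T = S u x0, a copy of the simple module (U + S u)/U. *)
have [||T [j [ij jP]]] := submoduleP (@submod_closedP S (resm io N)
    (fun x => exists b, io (b * u) *: x0 = x) _ _).
- by exists 0; rewrite mul0r rmorph0 scale0r.
- move=> a x y [b <-] [c <-]; exists (a * b + c).
  by rewrite mulrDl rmorphD scalerDl -mulrA rmorphM -scalerA.
have {}jP x : (exists b, io (b * u) *: x0 = x) <-> exists y, j y = x.
  by rewrite -jP inE; split=> [?|/asboolP//]; apply/asboolP.
have [t tE] : exists t, j t = io u *: x0 by apply/jP; exists 1; rewrite mul1r.
have t0 : t != 0 by apply: contraNneq ux0 => t0; rewrite -tE t0 linear0.
have jZ b y : j (b *: y) = io b *: (j y : N) by exact: (linearZ_LR j b y).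
have tgen y : exists b, y = b *: t.
  have /jP[b bP] : exists y', j y' = j y by exists y.
  by exists b; apply: ij; rewrite jZ tE -bP rmorphM scalerA.
have simT : simple_module T.
  split; first by exists t.
  move=> V [V0 VD]; have [[y [yV y0]]|nV] := pselect (exists y, y \in V /\ y <> 0); last first.
    by left=> y yV; apply: contrapT => y0; apply: nV; exists y.
  right=> z.
  have VZ c x : x \in V -> c *: x \in V by move=> xV; rewrite -[_ *: _]addr0 VD.
  have [b yE] := tgen y.
  have buU : b * u \notin U.
    apply/negP => bu; apply: y0; apply: ij; rewrite yE jZ tE linear0 scalerA -rmorphM.
    exact: UN.
  have [w wU [c uE]] := umin b buU.
  have tV : t \in V.
    have -> : t = c *: y; last exact: VZ.
    apply: ij; rewrite yE !jZ tE {1}uE rmorphD scalerDl (UN _ _ wU) add0r.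
    by rewrite !rmorphM !scalerA !mulrA.
  by have [a ->] := tgen z; apply: VZ.
apply: (Ciso simT t0) => x.
have /choice[f fP] y : exists z, i z = io u *: y.
  by apply/iP; exists [:: (1, y)]; rewrite big_seq1 rmorph1 scale1r.
have /iP[s sE] : exists y, i y = i x by exists x.
exists [seq (q.1, f q.2) | q <- s]; split.
  apply: ii; rewrite sE big_map linear_sum; apply: eq_bigr => q _ /=.
  by rewrite linearZ /= fP.
move=> _ /mapP[q qs ->] b bt /=; apply: ii; rewrite linearZ /= fP linear0 scalerA -rmorphM.
by apply: kill; rewrite rmorphM -scalerA -tE -jZ bt linear0.
Qed.

End LeftIdealChain.

Section Isotypic.
Variables (k : fieldType) (S S' : falgType k) (R : pzRingType).
Variables (io : {rmorphism S -> R}) (jo : {rmorphism S' -> R}).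
Hypotheses (ioC : forall a b, io a * jo b = jo b * io a)
  (io_alg : forall c : k, io c%:A = jo c%:A).

(* X consists of the x annihilated by the annihilator of t, and beta x maps
   b t to b x; it is the image of t that identifies Hom_S(T, M) with X. *)
Lemma isotypic_pairing (T : lmodType S) (t : T) (M : lmodType R) :
  splitting_field S -> simple_module T -> t != 0 ->
  (forall x : M, exists s : seq (S * M), x = \sum_(p <- s) io p.1 *: p.2 /\
     forall p, p \in s -> forall b, b *: t = 0 -> io b *: p.2 = 0) ->
  exists (X : lmodType S') (beta : restr X -> restr T -> restr (resm io M)),
   [/\ bilin beta, injective (tlift beta),
       forall b a (x : X) (u : T), beta (b *: x) (a *: u) = (jo b * io a) *: (beta x u : M) &
       forall m : M, exists z, tlift beta z = m].
Proof.
move=> spl simT t0 gen.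
pose PX (x : resm jo M) := forall b : S, b *: t = 0 -> io b *: (x : M) = 0.
have [||X [i [ii iP]]] := submoduleP (@submod_closedP S' (resm jo M) PX _ _).
- by move=> b _; rewrite scaler0.
- move=> a x y Px Py b bt; rewrite scalerDr (Py b bt) addr0 resmE scalerA.
  by rewrite ioC -scalerA (Px b bt) scaler0.
have {}iP x : PX x <-> exists y, i y = x.
  by rewrite -iP inE; split=> [?|/asboolP//]; apply/asboolP.
have iZ a x : i (a *: x) = jo a *: (i x : M) by exact: (linearZ_LR i a x).
have /choice[f fP] (x : X) : exists f : {linear T -> resm io M},
    forall b : S, f (b *: t) = io b *: (i x : M).
  apply: (@orbit_map k S T simT (resm io M) t (i x : M)) => // b bt.
  by have /iP/(_ b bt) : exists y, i y = i x by exists x.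
have gent u := simple_gen simT u t0.
pose beta (x : restr X) (u : T) : resm io M := f x u.
have bX u : linear (fun x => beta x u : restr (resm io M)).
  move=> c x y; have [b <-] := gent u; rewrite /beta.
  have -> : f (c *: x + y) (b *: t) = io b *: (i (c *: x + y) : M) by exact: fP.
  have -> : f x (b *: t) = io b *: (i x : M) by exact: fP.
  have -> : f y (b *: t) = io b *: (i y : M) by exact: fP.
  have -> : i (c *: x + y) = jo c%:A *: (i x : M) + i y by rewrite linearD -iZ.
  rewrite scalerDr; congr (_ + _).
  rewrite [RHS](_ : _ = io c%:A *: (io b *: (i x : M))) //.
  by rewrite !scalerA ioC io_alg.
have bT x : linear (beta x) by exact: linearP.
have b0 x : (forall u, beta x u = 0) -> x = 0.
  move=> /(_ t); rewrite /beta -[t]scale1r fP => ix0; apply: ii; rewrite linear0.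
  by move: ix0; rewrite rmorph1 scale1r.
have bb := beta_bilin bX bT.
have binj := beta_injective simT (spl T simT) bX bT b0.
exists X, beta; split; [exact: bb | exact: binj | |].
  move=> b a x u; have [c <-] := gent u.
  by rewrite /beta scalerA !fP iZ !scalerA rmorphM -mulrA ioC mulrA ioC.
move=> m; have [s [-> sP]] := gen m.
elim: s sP => [|p s IH] sP.
  by exists 0; rewrite big_nil; exact: (linear0 (lin (tlift_linear bb))).
have [q qs|y yE] := IH; first by apply: sP; rewrite inE qs orbT.
have /iP[z zE] : PX p.2 by apply: sP; apply: mem_head.
exists (tpure (z : restr X) (p.1 *: t : restr T) + y).
rewrite big_cons -yE (linearDf _ _ (tlift_linear bb)) (tlift_pure _ _ bb).
by rewrite /beta fP zE.
Qed.

End Isotypic.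

(** * Generation of all modules by tensor products *)

Section TensorGeneration.
Variables (k : fieldType) (A B : falgType k).
Local Notation L := (tensalg A B).

Definition inlA (a : A) : L := tpure a 1.
Definition inrB (b : B) : L := tpure 1 b.

Fact inlA_zmod : zmod_morphism inlA.
Proof.
move=> x y; rewrite -scaleN1r addrC [LHS]((pure_bilin _ _).1 (1 : B)).
by rewrite scaleN1r addrC.
Qed.
Fact inlA_monoid : monoid_morphism inlA.
Proof. by split=> // x y; rewrite /inlA tensalg_mul_pure mulr1. Qed.
HB.instance Definition _ := GRing.isZmodMorphism.Build A L inlA inlA_zmod.
HB.instance Definition _ := GRing.isMonoidMorphism.Build A L inlA inlA_monoid.

Fact inrB_zmod : zmod_morphism inrB.
Proof.
move=> x y; rewrite -scaleN1r addrC [LHS]((pure_bilin _ _).2 (1 : A)).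
by rewrite scaleN1r addrC.
Qed.
Fact inrB_monoid : monoid_morphism inrB.
Proof. by split=> // x y; rewrite /inrB tensalg_mul_pure mulr1. Qed.
HB.instance Definition _ := GRing.isZmodMorphism.Build B L inrB inrB_zmod.
HB.instance Definition _ := GRing.isMonoidMorphism.Build B L inrB inrB_monoid.

Lemma inl_inr a b : inlA a * inrB b = tpure a b.
Proof. by rewrite /inlA /inrB tensalg_mul_pure mulr1 mul1r. Qed.
Lemma inr_inl a b : inrB b * inlA a = tpure a b.
Proof. by rewrite /inlA /inrB tensalg_mul_pure mulr1 mul1r. Qed.
Lemma inlA_alg c : inlA c%:A = c%:A.
Proof. exact: (linearZf c _ ((pure_bilin _ _).1 (1 : B))). Qed.
Lemma inrB_alg c : inrB c%:A = c%:A.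
Proof. exact: (linearZf c _ ((pure_bilin _ _).2 (1 : A))). Qed.

(** a (x) b = (1 (x) b)(a (x) 1), and a (x) 1 commutes with 1 (x) B. *)
Lemma tens_genr (l : L) : exists s : seq (B * L), l = \sum_(p <- s) inrB p.1 * p.2 /\
  forall p, p \in s -> forall b, inrB b * p.2 = p.2 * inrB b.
Proof.
elim/tens_ind: l => [|a b z [s [-> sc]]]; first by exists [::]; rewrite big_nil.
exists ((b, inlA a) :: s); rewrite big_cons inr_inl; split=> // p.
by rewrite inE => /orP[/eqP-> b'|/sc//]; rewrite inl_inr inr_inl.
Qed.

Lemma tens_genl (l : L) : exists s : seq (A * L), l = \sum_(p <- s) inlA p.1 * p.2 /\
  forall p, p \in s -> forall a, inlA a * p.2 = p.2 * inlA a.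
Proof.
elim/tens_ind: l => [|a b z [s [-> sc]]]; first by exists [::]; rewrite big_nil.
exists ((a, inrB b) :: s); rewrite big_cons inl_inr; split=> // p.
by rewrite inE => /orP[/eqP-> a'|/sc//]; rewrite inl_inr inr_inl.
Qed.

Lemma isotypicr (T : lmodType B) (t : T) (M : lmodType L) : splitting_field B ->
  simple_module T -> t != 0 ->
  (forall x : M, exists s : seq (B * M), x = \sum_(p <- s) inrB p.1 *: p.2 /\
     forall p, p \in s -> forall b, b *: t = 0 -> inrB b *: p.2 = 0) ->
  exists (X : lmodType A) (f : {linear tensmod X T -> M}), bijective f.
Proof.
move=> spl simT t0 gen.
have [||X [beta [bb binj bact bsurj]]] := isotypic_pairing (jo := inlA) _ _ spl simT t0 gen.
- by move=> b a; rewrite /= inr_inl inl_inr.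
- by move=> c; rewrite /= inrB_alg inlA_alg.
have lphi : linear (tlift beta : tensmod X T -> M).
  apply: tens_linear => [x y|a b x u]; first exact: (linearDf _ _ (tlift_linear bb)).
  by rewrite !(tlift_pure _ _ bb) bact /= inl_inr.
by exists X, (lin lphi); apply: inj_surj_bij.
Qed.

Lemma isotypicl (T : lmodType A) (t : T) (M : lmodType L) : splitting_field A ->
  simple_module T -> t != 0 ->
  (forall x : M, exists s : seq (A * M), x = \sum_(p <- s) inlA p.1 *: p.2 /\
     forall p, p \in s -> forall a, a *: t = 0 -> inlA a *: p.2 = 0) ->
  exists (Y : lmodType B) (f : {linear tensmod T Y -> M}), bijective f.
Proof.
move=> spl simT t0 gen.
have [||Y [beta [bb binj bact bsurj]]] := isotypic_pairing (jo := inrB) _ _ spl simT t0 gen.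
- by move=> a b; rewrite /= inr_inl inl_inr.
- by move=> c; rewrite /= inrB_alg inlA_alg.
(* The pairing has T as its second factor, whereas T must come first here; hence the swap. *)
pose phi (z : tensmod T Y) : M := tlift beta (tswap (restr T) (restr Y) z).
have phiE x u : phi (tpure (u : restr T) (x : restr Y)) = beta x u.
  by rewrite /phi tswap_pure; exact: (tlift_pure _ _ bb).
have lphi : linear phi.
  apply: tens_linear => [x y|a b u x]; last by rewrite !phiE bact /= inr_inl.
  by rewrite /phi [tswap _ _ _]linearD; exact: (linearDf _ _ (tlift_linear bb)).
exists Y, (lin lphi); apply: inj_surj_bij => [x y /= /binj|m].
  by apply: (can_inj (@tswapK k (restr T) (restr Y))).
by have [z <-] := bsurj m; exists (tswap _ _ z); rewrite /= /phi tswapK.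
Qed.

Lemma tens_generation : splitting_field A \/ splitting_field B ->
  forall C : lmodType L -> Prop,
  (forall (M N : lmodType L) (g : {linear M -> N}), bijective g -> C M -> C N) ->
  (forall (K E M : lmodType L) (i : {linear K -> E}) (p : {linear E -> M}),
     ses i p -> C K -> C M -> C E) ->
  (forall (X : lmodType A) (Y : lmodType B), C (tensmod X Y)) -> forall M, C M.
Proof.
move=> spl C Cbij Cses Ctens.
have C0 (M : lmodType L) : (forall x : M, x = 0) -> C M.
  (* The zero module is 0 (x) B, with row vectors of length 0 as the zero A-module. *)
  move=> M0; apply: (Cbij (tensmod ('rV[A]_0 : lmodType A) (B^o : lmodType B)) M \0) (Ctens _ _).
  exists (fun=> 0) => x; last by rewrite [RHS]M0.
  elim/tens_ind: x => [//|u v z <-]; rewrite addr0.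
  by rewrite [u](thinmx0 (u : 'rV[A]_0)) tpure0l.
case: spl => spl.
- apply: (lideal_chain tens_genl C0 Cses) => T t M sT t0 gen.
  have [Y [f bf]] := isotypicl spl sT t0 gen; exact: Cbij bf (Ctens _ _).
- apply: (lideal_chain tens_genr C0 Cses) => T t M sT t0 gen.
  have [X [f bf]] := isotypicr spl sT t0 gen; exact: Cbij bf (Ctens _ _).
Qed.

End TensorGeneration.

Theorem theorem5p7 (k : fieldType) (A B : falgType k) :
  gorenstein A -> gorenstein B ->
  splitting_field A \/ splitting_field B ->
  forall M : lmodType (tensalg A B),
    gproj M <-> filt_bar (tens_class (@gproj A) (@gproj B)) M.
Proof.
move=> gA gB spl M; split.
  have [n dA] := gorenstein_dimsP gA; have [m dB] := gorenstein_dimsP gB.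
  exact: gproj_filt_bar dA dB (tens_generation spl) M.
have [n gL] := tens_gorenstein gA gB; exact: filt_bar_gproj gL M.
Qed.
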